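(* Let $m>1$ be an integer and let $(B^n,g_B)$ be a complete $n$-dimensional Riemannian manifold with three smooth functions $f>0$, $\lambda$ and $\varphi$ satisfying $$Ric_B+\nabla^{2}\varphi=\lambda g_B+\frac{m}{f}\nabla^{2}f$$ and $$-2\lambda\, d\varphi + d\Big((2-m-n)\lambda + |\nabla\varphi|^{2} - \Delta\varphi - \frac{m}{f}\nabla\varphi(f)\Big)=0.$$ Take the constant $\mu\in\mathbb{R}$ satisfying $$\lambda f^{2}+f\Delta f +(m-1)|\nabla f|^{2} -f\nabla\varphi(f)=\mu$$ on $B$, and a complete $m$-dimensional Riemannian manifold $(\mathbb{F}^m,g_{\mathbb{F}})$ with Ricci tensor $Ric_{\mathbb{F}}=\mu g_{\mathbb{F}}$. Then $(B^n\times_f\mathbb{F}^m,g,\nabla\tilde\varphi,\tilde\lambda)$, where $g$ is the warped product metric, is a gradient Ricci almost soliton.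
   Context: Given Riemannian manifolds $(B^n,g_B)$ and $(\mathbb{F}^m,g_{\mathbb{F}})$ of dimensions $n$ and $m$ and a positive smooth function $f$ on $B$ (the warping function), the warped product $B^n\times_f\mathbb{F}^m$ is $B\times\mathbb{F}$ with the metric $g=\pi^{*}g_{B}+(f\circ\pi)^{2}\sigma^{*}g_{\mathbb{F}}$, where $\pi:B\times\mathbb{F}\to B$ and $\sigma:B\times\mathbb{F}\to\mathbb{F}$ are the projections. For a smooth function $h$ on $B$, $\tilde h=h\circ\pi$ is its lift. A complete Riemannian manifold $(M,g)$ is a gradient Ricci almost soliton $(M,g,\nabla\psi,\Lambda)$, where $\psi,\Lambda\in C^\infty(M)$, if $Ric+\nabla^2\psi=\Lambda g$ on $M$, with $Ric$ the Ricci tensor of $g$ and $\nabla^2\psi$ the Hessian of $\psi$. $Ric_B$ is the Ricci tensor of $g_B$; in the three displayed equations $\nabla$, $\nabla^2$, $\Delta=\mathrm{tr}\,\nabla^2$ and $|\cdot|$ are taken on $(B,g_B)$, and $\nabla\varphi(f)=g_B(\nabla\varphi,\nabla f)$. *)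

(* Defs.v *)
From HB Require Import structures.
From mathcomp Require Import all_boot all_order all_algebra.
From mathcomp Require Import all_classical all_reals all_analysis.

Set Implicit Arguments.
Unset Strict Implicit.
Unset Printing Implicit Defensive.

Import Order.TTheory GRing.Theory Num.Theory.
Import numFieldNormedType.Exports.

Local Open Scope classical_set_scope.
Local Open Scope ring_scope.

(* Riemannian geometry is written in the charts of an atlas.  A tensor field is
   given by its matrices in all charts, so a tensor equation holds when it
   holds at every point of every chart. *)

Section Coordinates.
Context {R : realType} {n : nat}.
Implicit Types (D : set 'rV[R]_n) (u v : 'rV[R]_n -> R).
Implicit Types (G : 'rV[R]_n -> 'M[R]_n) (x : 'rV[R]_n).

Definition pd (i : 'I_n) u x : R := 'D_(delta_mx 0 i) u x.

(* On an open set D: all iterated partial derivatives exist and are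
   continuous. *)
Definition smooth_on D u : Prop :=
  forall (s : seq 'I_n) x, D x ->
    {for x, continuous (foldr pd u s)} /\
    forall i : 'I_n, derivable (foldr pd u s) x (delta_mx 0 i).

Definition christoffel G (k i j : 'I_n) x : R :=
  2^-1 * \sum_(l < n) invmx (G x) k l *
    (pd i (fun y => G y j l) x + pd j (fun y => G y i l) x
     - pd l (fun y => G y i j) x).

(* The coefficient of d_l in R(d_i, d_j) d_k, for the convention
   R(X, Y) Z = D_X D_Y Z - D_Y D_X Z - D_[X, Y] Z. *)
Definition riemann G (l i j k : 'I_n) x : R :=
  pd i (christoffel G l j k) x - pd j (christoffel G l i k) x
  + \sum_(p < n) (christoffel G l i p x * christoffel G p j k x
                  - christoffel G l j p x * christoffel G p i k x).

(* Ric(Y, Z) is the trace of X |-> R(X, Y) Z. *)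
Definition ricci G x : 'M[R]_n :=
  \matrix_(j, k) \sum_(i < n) riemann G i i j k x.

Definition hessian G u x : 'M[R]_n :=
  \matrix_(i, j) (pd i (pd j u) x
                  - \sum_(k < n) christoffel G k i j x * pd k u x).

Definition laplacian G u x : R := \tr (invmx (G x) *m hessian G u x).

(* g(grad u, grad v) *)
Definition grad_dot G u v x : R :=
  \sum_(i < n) \sum_(j < n) invmx (G x) i j * pd i u x * pd j v x.

End Coordinates.

(* [chart_map] is meaningful on [chart_dom], and [chart_inv] on [chart_cod]. *)
Record chart (R : realType) (n : nat) (M : topologicalType) := Chart {
  chart_dom : set M;
  chart_cod : set 'rV[R]_n;
  chart_map : M -> 'rV[R]_n;
  chart_inv : 'rV[R]_n -> M }.

Definition is_chart (R : realType) (n : nat) (M : topologicalType)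
    (c : chart R n M) : Prop :=
  [/\ open (chart_dom c) /\ open (chart_cod c),
      (forall p, chart_dom c p ->
         chart_cod c (chart_map c p) /\ chart_inv c (chart_map c p) = p),
      (forall x, chart_cod c x ->
         chart_dom c (chart_inv c x) /\ chart_map c (chart_inv c x) = x),
      {within chart_dom c, continuous (chart_map c)} &
      {within chart_cod c, continuous (chart_inv c)}].

(* The raw data (space, atlas, metric matrices); the axioms are in
   [riemannian_manifold].  The atlas is an indexed family, so that the metric
   can be attached to the index of a chart. *)
Record riem_data (R : realType) (n : nat) := RiemData {
  space :> topologicalType;
  atlas_index : Type;
  atlas : atlas_index -> chart R n space;
  metric_mx : atlas_index -> 'rV[R]_n -> 'M[R]_n }.

Section Manifold.
Context {R : realType} {n : nat}.
Variable M : riem_data R n.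
Implicit Types (i j : atlas_index M) (x : 'rV[R]_n) (u : M -> R).

Definition in_chart i : set 'rV[R]_n := chart_cod (atlas i).

Definition local i u : 'rV[R]_n -> R := u \o chart_inv (atlas i).

Definition smooth u : Prop := forall i, smooth_on (in_chart i) (local i u).

Definition overlap i j : set 'rV[R]_n :=
  in_chart i `&` (chart_inv (atlas i) @^-1` chart_dom (atlas j)).

Definition transition i j : 'rV[R]_n -> 'rV[R]_n :=
  chart_map (atlas j) \o chart_inv (atlas i).

Definition transition_jacobian i j x : 'M[R]_n :=
  \matrix_(a, b) pd a (fun y => transition i j y 0 b) x.

Definition smooth_manifold : Prop :=
  [/\ hausdorff_space M /\ @second_countable M,
      connected [set: M] /\ [set: M] !=set0,
      (forall i, is_chart (atlas i)),
      (forall p : M, exists i, chart_dom (atlas i) p) &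
      (forall i j (b : 'I_n),
         smooth_on (overlap i j) (fun y => transition i j y 0 b))].

Definition riemannian_metric : Prop :=
  [/\ (forall i (a b : 'I_n),
         smooth_on (in_chart i) (fun y => metric_mx i y a b)),
      (forall i x, in_chart i x -> (metric_mx i x)^T = metric_mx i x),
      (forall i x (v : 'rV[R]_n), in_chart i x -> v != 0 ->
         0 < (v *m metric_mx i x *m v^T) 0 0) &
      (forall i j x, overlap i j x ->
         metric_mx i x = transition_jacobian i j x
                      *m metric_mx j (transition i j x)
                      *m (transition_jacobian i j x)^T)].

Definition riemannian_manifold : Prop := smooth_manifold /\ riemannian_metric.

(* A C^1 curve [0, 1] -> chart i; being C^1 on the whole line is no
   restriction, as a C^1 function on [0, 1] extends to one on the line. *)
Definition c1_curve i (c : R -> 'rV[R]_n) : Prop :=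
  [/\ (forall t, derivable c t 1),
      continuous (derive1 c) &
      (forall t, t \in `[0, 1] -> in_chart i (c t))].

Definition curve_length i (c : R -> 'rV[R]_n) : R :=
  Rintegral (@lebesgue_measure R) `[0, 1]
    (fun t => Num.sqrt
       ((derive1 c t *m metric_mx i (c t) *m (derive1 c t)^T) 0 0)).

(* [pw_curve p q L]: there is a piecewise C^1 curve of length L from p to q,
   cut into finitely many C^1 pieces each of which lies in one chart. *)
Inductive pw_curve : M -> M -> R -> Prop :=
| pw_nil p : pw_curve p p 0
| pw_cons i c q L :
    c1_curve i c -> pw_curve (chart_inv (atlas i) (c 1)) q L ->
    pw_curve (chart_inv (atlas i) (c 0)) q (curve_length i c + L).

Definition riem_dist (p q : M) : \bar R :=
  ereal_inf [set L%:E | L in pw_curve p q].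

(* Completeness of the Riemannian distance (equivalent to geodesic
   completeness by the Hopf-Rinow theorem). *)
Definition complete_manifold : Prop :=
  forall s : nat -> M,
    (forall e : R, 0 < e -> exists N : nat, forall j k : nat,
       (N <= j)%N -> (N <= k)%N -> (riem_dist (s j) (s k) < e%:E)%E) ->
    exists p : M, (fun k => riem_dist (s k) p) @ \oo --> 0%:E.

Definition gradient_ricci_almost_soliton (psi Lambda : M -> R) : Prop :=
  [/\ riemannian_manifold, complete_manifold, smooth psi, smooth Lambda &
      forall i x, in_chart i x ->
        ricci (metric_mx i) x + hessian (metric_mx i) (local i psi) x
        = local i Lambda x *: metric_mx i x].

End Manifold.

Definition product_chart (R : realType) (n m : nat) (B F : topologicalType)
    (c : chart R n B) (d : chart R m F) : chart R (n + m) (B * F)%type :=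
  Chart
    (chart_dom c `*` chart_dom d)
    [set x | chart_cod c (lsubmx x) /\ chart_cod d (rsubmx x)]
    (fun p => row_mx (chart_map c p.1) (chart_map d p.2))
    (fun x => (chart_inv c (lsubmx x), chart_inv d (rsubmx x))).

Definition warped_product (R : realType) (n m : nat)
    (B : riem_data R n) (F : riem_data R m) (f : B -> R) :
    riem_data R (n + m) :=
  @RiemData R (n + m) (B * F)%type (atlas_index B * atlas_index F)%type
    (fun ij => product_chart (atlas ij.1) (atlas ij.2))
    (fun ij x =>
       block_mx (metric_mx ij.1 (lsubmx x)) 0
                0 (local ij.1 f (lsubmx x) ^+ 2 *: metric_mx ij.2 (rsubmx x))).

Definition base_lift (R : realType) (n m : nat)
    (B : riem_data R n) (F : riem_data R m) (f h : B -> R) :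
    warped_product F f -> R := fun p => h p.1.

Section Equations.
Context {R : realType} {n : nat}.
Variables (B : riem_data R n) (m : nat) (f lambda phi : B -> R).

Definition base_equation : Prop :=
  forall i x, in_chart i x ->
    ricci (metric_mx i) x + hessian (metric_mx i) (local i phi) x
    = local i lambda x *: metric_mx i x
      + (m%:R / local i f x) *: hessian (metric_mx i) (local i f) x.

Definition base_differential_equation : Prop :=
  forall i x (a : 'I_n), in_chart i x ->
    - 2 * local i lambda x * pd a (local i phi) x
    + pd a (fun y =>
        (2 - m%:R - n%:R) * local i lambda y
        + grad_dot (metric_mx i) (local i phi) (local i phi) y
        - laplacian (metric_mx i) (local i phi) y
        - m%:R / local i f y
          * grad_dot (metric_mx i) (local i phi) (local i f) y) x
    = 0.

Definition is_warping_constant (mu : R) : Prop :=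
  forall i x, in_chart i x ->
    local i lambda x * local i f x ^+ 2
    + local i f x * laplacian (metric_mx i) (local i f) x
    + (m%:R - 1) * grad_dot (metric_mx i) (local i f) (local i f) x
    - local i f x * grad_dot (metric_mx i) (local i phi) (local i f) x
    = mu.

End Equations.

Definition einstein_with (R : realType) (n : nat) (M : riem_data R n)
    (mu : R) : Prop :=
  forall (i : atlas_index M) x, in_chart i x ->
    ricci (metric_mx i) x = mu *: metric_mx i x.

(* Main.v *)
(* In a chart, Christoffel symbols, curvature and Hessian are formed from the entries
   of the metric and of its inverse by ring operations and commuting derivations, so
   the pointwise identities are proved in an arbitrary commutative ring with commuting
   derivations and then read in the ring of smooth functions on a chart domain.

   The trace of the base equation, its divergence and the contracted second Bianchi
   identity show, together with the second equation, that m times every partial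
   derivative of lambda f^2 + f Lap f + (m-1)|grad f|^2 - f <grad phi, grad f>
   vanishes; this scalar function is thus constant on the connected manifold B.

   The Ricci tensor of the warped product is computed from its Christoffel symbols:
   its base block is Ric_B - (m/f) Hess f, its mixed blocks vanish, and its fibre block
   is Ric_F - (f Lap f + (m-1)|grad f|^2) g_F, so the soliton equation amounts to the
   base equation and to the definition of mu.

   For completeness, the base components of a Cauchy sequence converge to a point b,
   as projecting to B does not increase lengths.  Near b the warping function is
   bounded below by a positive constant; a Lipschitz bump function supported there
   keeps short curves starting close to b in that region, so the fibre components are
   Cauchy as well.  A horizontal curve followed by a vertical one over b then joins
   the sequence to its limit. *)
Require Import Defs.
From HB Require Import structures.
From mathcomp Require Import all_boot all_order all_algebra.
From mathcomp Require Import all_classical all_reals all_analysis.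
From mathcomp Require Import ring lra.
Import Order.TTheory GRing.Theory Num.Theory.
Import numFieldNormedType.Exports.
Set Implicit Arguments.
Unset Strict Implicit.
Unset Printing Implicit Defensive.
Local Open Scope classical_set_scope.
Local Open Scope ring_scope.

(** * Tensor calculus over a commutative ring with derivations *)

(** Vanishing partial derivatives in every chart do not yet make a constant on B: [laplacian] and
    [grad_dot] are chart formulas, so their values in overlapping charts must first be shown to
    agree. For the Laplacian, the divergence form reduces this to one cancellation, between the
    derivative of the inverse Jacobian and the Jacobian part of the volume density. Different charts
    have different rings of functions, so they are compared after pullback to the ring of the
    overlap; pullback along the two projections likewise brings base and fibre into the ring of a
    product chart. The abstract ring has no division: 1/2, 1/f and the inverse metric are elements
    subject to the equations that characterise them, and the factor m is cancelled only after
    evaluation at a point. In the completeness argument the obstacle is that f may become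
    arbitrarily small away from b: a short curve could run through a region where fibre distances
    shrink, and its length would then say nothing about the distance of its fibre ends. The
    Lipschitz bound on the bump function puts a definite price on leaving the neighbourhood of b. *)

Section Derivation.
Context {A : comNzRingType}.

Definition derivation (d : A -> A) : Prop :=
  (forall u v, d (u + v) = d u + d v) /\
  (forall u v, d (u * v) = d u * v + u * d v).

Variable d : A -> A.
Hypothesis der : derivation d.

Lemma derD u v : d (u + v) = d u + d v. Proof. exact: der.1. Qed.
Lemma derM u v : d (u * v) = d u * v + u * d v. Proof. exact: der.2. Qed.

Lemma der0 : d 0 = 0.
Proof. by apply: (addIr (d 0)); rewrite -derD !add0r. Qed.

Lemma derN u : d (- u) = - d u.
Proof. by apply: (addIr (d u)); rewrite -derD !addNr der0. Qed.

Lemma derB u v : d (u - v) = d u - d v.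
Proof. by rewrite derD derN. Qed.

Lemma der1 : d 1 = 0.
Proof. by apply: (addIr (d 1)); rewrite add0r -[in RHS](mulr1 1) derM mulr1 mul1r. Qed.

Lemma der_nat k : d k%:R = 0.
Proof. by elim: k => [|k IH]; rewrite ?der0 // -natr1 derD IH der1 addr0. Qed.

Lemma der_sum (I : Type) (r : seq I) (P : pred I) (F : I -> A) :
  d (\sum_(i <- r | P i) F i) = \sum_(i <- r | P i) d (F i).
Proof. exact: (big_morph d derD der0). Qed.

Lemma der_inv u v : u * v = 1 -> d v = - (v * v * d u).
Proof.
move=> uv; have := congr1 d uv; rewrite derM der1 => /(congr1 ( *%R v)).
rewrite mulr0 mulrDr => E; have E2 : v * (u * d v) = d v.
  by rewrite mulrA [v * u]mulrC uv mul1r.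
move: E; rewrite E2 => /eqP; rewrite addrC addr_eq0 => /eqP ->.
by congr (- _); ring.
Qed.

Definition dmx p q (M : 'M[A]_(p, q)) : 'M[A]_(p, q) := map_mx d M.

Lemma dmxE p q (M : 'M[A]_(p, q)) i j : dmx M i j = d (M i j).
Proof. exact: mxE. Qed.

Lemma dmxD p q (M N : 'M[A]_(p, q)) : dmx (M + N) = dmx M + dmx N.
Proof. by apply/matrixP => i j; rewrite !mxE derD. Qed.

Lemma dmxN p q (M : 'M[A]_(p, q)) : dmx (- M) = - dmx M.
Proof. by apply/matrixP => i j; rewrite !mxE derN. Qed.

Lemma dmx_mul p q r (M : 'M[A]_(p, q)) (N : 'M[A]_(q, r)) :
  dmx (M *m N) = dmx M *m N + M *m dmx N.
Proof.
apply/matrixP => i j; rewrite !mxE der_sum -big_split /=.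
by apply: eq_bigr => k _; rewrite derM !mxE.
Qed.

Lemma dmx_tr p q (M : 'M[A]_(p, q)) : dmx M^T = (dmx M)^T.
Proof. by apply/matrixP => i j; rewrite !mxE. Qed.

Lemma dmx1 p : dmx (1%:M : 'M[A]_p) = 0.
Proof. by apply/matrixP => i j; rewrite !mxE der_nat. Qed.

Lemma dmx_inv p (M N : 'M[A]_p) : M *m N = 1%:M ->
  dmx N = - (N *m dmx M *m N).
Proof.
move=> MN; have NM := mulmx1C MN.
have := congr1 (@dmx p p) MN; rewrite dmx_mul dmx1 => /(congr1 (mulmx N)).
rewrite mulmx0 mulmxDr !mulmxA NM mul1mx addrC => /eqP.
by rewrite addr_eq0 => /eqP.
Qed.

End Derivation.

Lemma addmxE (A : nmodType) p q (M N : 'M[A]_(p, q)) i j :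
  (M + N) i j = M i j + N i j.
Proof. exact: mxE. Qed.

Lemma oppmxE (A : zmodType) p q (M : 'M[A]_(p, q)) i j :
  (- M) i j = - M i j.
Proof. exact: mxE. Qed.

Lemma scalemxE (A : pzRingType) p q u (M : 'M[A]_(p, q)) i j :
  (u *: M) i j = u * M i j.
Proof. exact: mxE. Qed.

Lemma trD (A : nmodType) p q (M N : 'M[A]_(p, q)) : (M + N)^T = M^T + N^T.
Proof. by apply/matrixP => i j; rewrite !mxE. Qed.

Lemma trN (A : zmodType) p q (M : 'M[A]_(p, q)) : (- M)^T = - M^T.
Proof. by apply/matrixP => i j; rewrite !mxE. Qed.

Ltac mxabel :=
  apply/matrixP => ? ?; rewrite !(addmxE, oppmxE); ring.

(** * Levi-Civita connection, curvature, and the Bianchi and Bochner identities *)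

Section Riemann.
Context {A : comNzRingType} {n : nat}.
Variables (half : A) (d : 'I_n -> A -> A) (G H : 'M[A]_n).

(* The connection matrix of d_i: the entry [Gam i k j] is the Christoffel symbol
   with upper index k and lower indices i, j.  Accordingly [curv i j] below is the
   matrix of the endomorphism R(d_i, d_j). *)
Definition Gam (i : 'I_n) : 'M[A]_n :=
  \matrix_(k, j) (half * \sum_(l < n) H k l *
                    (d i (G j l) + d j (G i l) - d l (G i j))).

Definition curv (i j : 'I_n) : 'M[A]_n :=
  dmx (d i) (Gam j) - dmx (d j) (Gam i) + (Gam i *m Gam j - Gam j *m Gam i).

Definition ric : 'M[A]_n := \matrix_(j, k) \sum_(i < n) curv i j i k.

Definition hess (u : A) : 'M[A]_n :=
  \matrix_(i, j) (d i (d j u) - \sum_(k < n) Gam i k j * d k u).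

Lemma curv_entry i j k l : curv i j l k = d i (Gam j l k) - d j (Gam i l k)
  + \sum_p (Gam i l p * Gam j p k - Gam j l p * Gam i p k).
Proof.
rewrite /curv !(addmxE, oppmxE) !dmxE; congr (_ + _).
by rewrite [in X in X - _]mxE [in X in _ - X]mxE sumrB.
Qed.

Lemma hessE u i j :
  hess u i j = d i (d j u) - \sum_(k < n) Gam i k j * d k u.
Proof. by rewrite mxE. Qed.

Definition lap (u : A) : A := \tr (H *m hess u).

Definition gdot (u v : A) : A :=
  \sum_(i < n) \sum_(j < n) H i j * d i u * d j v.

Definition grad (u : A) : 'cV[A]_n := \col_i d i u.

Lemma gradE u i j : grad u i j = d i u.
Proof. by rewrite mxE. Qed.

(** The columns of [Y] are vector fields; each is differentiated covariantly in the direction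
    d_i. *)
Definition covd (i : 'I_n) p (Y : 'M[A]_(n, p)) : 'M[A]_(n, p) :=
  dmx (d i) Y + Gam i *m Y.

(* [dive P a] is the divergence \nabla_i P^i_a of an endomorphism field. *)
Definition dive (P : 'M[A]_n) (a : 'I_n) : A :=
  \sum_i (dmx (d i) P + Gam i *m P - P *m Gam i) i a.

Hypotheses (half2 : half + half = 1) (dd : forall i, derivation (d i)).
Hypothesis dC : forall i j u, d i (d j u) = d j (d i u).
Hypotheses (GT : G^T = G) (GH : G *m H = 1%:M).

Let HG : H *m G = 1%:M. Proof. exact: mulmx1C. Qed.

Let GTE i j : G i j = G j i. Proof. by rewrite -{1}GT mxE. Qed.

Lemma metric_invT : H^T = H.
Proof.
have HTG : H^T *m G = 1%:M by rewrite -GT -trmx_mul GH trmx1.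
by rewrite -[LHS]mulmx1 -GH mulmxA HTG mul1mx.
Qed.

Lemma Gam_sym i j k : Gam i k j = Gam j k i.
Proof.
rewrite !mxE; congr (half * _); apply: eq_bigr => l _.
by rewrite (GTE i j); ring.
Qed.

(** Lowering the upper index cancels the inverse metric and leaves the Christoffel symbols of the
    first kind. *)
Lemma G_Gam a i j : (G *m Gam a) i j =
  half * (d a (G i j) + d j (G a i) - d i (G a j)).
Proof.
pose w := \col_l (half * (d a (G j l) + d j (G a l) - d l (G a j))).
have -> : (G *m Gam a) i j = (G *m (H *m w)) i 0.
  rewrite !mxE; apply: eq_bigr => k _; rewrite !mxE; congr (_ * _).
  by rewrite mulr_sumr; apply: eq_bigr => l _; rewrite mxE; ring.
by rewrite mulmxA GH mul1mx mxE (GTE j i).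
Qed.

(** In the sum of the first-kind symbols and their transpose the antisymmetric terms cancel, and two
    halves of d_a G_ij remain. *)
Lemma metric_compat a : dmx (d a) G = (Gam a)^T *m G + G *m Gam a.
Proof.
have -> : (Gam a)^T *m G = (G *m Gam a)^T by rewrite trmx_mul GT.
apply/matrixP => i j; rewrite dmxE addmxE mxE !G_Gam (GTE j i).
transitivity ((half + half) * d a (G i j)); first by rewrite half2 mul1r.
by ring.
Qed.

Lemma metric_compat_inv a :
  dmx (d a) H = - (Gam a *m H) - H *m (Gam a)^T.
Proof.
rewrite (dmx_inv (dd a) GH) metric_compat mulmxDr mulmxDl !mulmxA HG mul1mx.
by rewrite -!mulmxA GH mulmx1 opprD addrC.
Qed.

Lemma hessT u : (hess u)^T = hess u.
Proof.
apply/matrixP => i j; rewrite mxE !hessE dC; congr (_ - _).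
by apply: eq_bigr => k _; rewrite Gam_sym.
Qed.

(** The inverse metric is parallel, so raising an index commutes with covariant differentiation: as
    an endomorphism, the Hessian is the covariant derivative of the gradient field. *)
Lemma hess_endo u i a : (H *m hess u) i a = covd a (H *m grad u) i 0.
Proof.
have -> : covd a (H *m grad u) = H *m (dmx (d a) (grad u) - (Gam a)^T *m grad u).
  rewrite /covd dmx_mul // metric_compat_inv mulmxBr mulmxBl mulNmx -!mulmxA.
  by mxabel.
rewrite mxE [RHS]mxE; apply: eq_bigr => k _; congr (_ * _).
rewrite hessE addmxE oppmxE dmxE gradE dC; congr (_ - _).
by rewrite [RHS]mxE; apply: eq_bigr => l _; rewrite gradE Gam_sym [in RHS]mxE.
Qed.

(** The Ricci identity for coordinate fields, whose brackets vanish. *)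
Lemma curvE i j p (Y : 'M[A]_(n, p)) :
  covd i (covd j Y) - covd j (covd i Y) = curv i j *m Y.
Proof.
rewrite /covd /curv !dmxD // !dmx_mul // !mulmxDl !mulNmx !mulmxDr !mulmxA.
have -> : dmx (d i) (dmx (d j) Y) = dmx (d j) (dmx (d i) Y).
  by apply/matrixP => ? ?; rewrite !mxE dC.
by mxabel.
Qed.

Lemma lapE u : lap u = \sum_i covd i (H *m grad u) i 0.
Proof. by rewrite /lap /mxtrace; apply: eq_bigr => i _; rewrite hess_endo. Qed.

(** The commutation behind Bochner's formula: in the trace of nabla_i nabla_a grad u the two
    derivatives are exchanged by [curvE], and the curvature term contracts to the Ricci tensor. *)
Lemma dive_hess u a :
  dive (H *m hess u) a = d a (lap u) + (ric *m (H *m grad u)) a 0.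
Proof.
set X := H *m grad u; pose V b := covd b X.
have PE i b : (H *m hess u) i b = V b i 0 by exact: hess_endo.
(* [covd] ignores the lower index [a]. The last sum is the connection term of that index; it cancels
   against the same sum coming from the trace of nabla_a, because the connection is torsion free. *)
transitivity (\sum_i (covd i (V a)) i 0 - \sum_i \sum_p V p i 0 * Gam i p a).
  rewrite -sumrB; apply: eq_bigr => i _; rewrite /covd.
  rewrite !(addmxE, oppmxE) !dmxE PE; congr (_ + _ - _); rewrite !mxE.
    by apply: eq_bigr => k _; rewrite PE.
  by apply: eq_bigr => k _; rewrite PE.
have -> : \sum_i covd i (V a) i 0 =
   \sum_i covd a (V i) i 0 + \sum_i (curv i a *m X) i 0.
  rewrite -big_split; apply: eq_bigr => i _ /=.
  by rewrite -curvE !(addmxE, oppmxE) /V; ring.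
have -> : \sum_i covd a (V i) i 0 =
   d a (lap u) + \sum_i \sum_p V p i 0 * Gam i p a.
  rewrite lapE der_sum // [X in _ + X]exchange_big -big_split.
  apply: eq_bigr => i _ /=; rewrite {1}/covd addmxE dmxE; congr (_ + _).
  rewrite mxE; apply: eq_bigr => p _.
  by rewrite mulrC Gam_sym.
have -> : \sum_i (curv i a *m X) i 0 = (ric *m X) a 0; last by ring.
rewrite mxE; under [RHS]eq_bigr => k _ do rewrite mxE mulr_suml.
by rewrite exchange_big; apply: eq_bigr => i _; rewrite mxE.
Qed.

Lemma curvN i j : curv i j = - curv j i.
Proof. by rewrite /curv; mxabel. Qed.

(** Since [H] is parallel, [nabla_i, nabla_j] H = R H + H R^T vanishes. The proof extracts this from
    the commutation of [d i] and [d j] on [H], after substituting [metric_compat_inv] twice. *)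
Lemma curvH i j : (curv i j *m H)^T = - (curv i j *m H).
Proof.
have dd2 : dmx (d i) (dmx (d j) H) = dmx (d j) (dmx (d i) H).
  by apply/matrixP => ? ?; rewrite !mxE dC.
move: dd2; rewrite !metric_compat_inv !dmxD // !dmxN // !dmx_mul // !dmx_tr.
rewrite !metric_compat_inv => E; rewrite trmx_mul metric_invT.
apply/eqP; rewrite -addr_eq0; apply/eqP; move: E => /eqP; rewrite -subr_eq0.
rewrite -oppr_eq0 => /eqP <-; rewrite /curv.
rewrite !(trD, trN) !trmx_mul.
rewrite !(mulmxDl, mulmxDr, mulNmx, mulmxN) !mulmxA.
by mxabel.
Qed.

(** The second Bianchi identity with one index raised. [D] differentiates only the two matrix
    indices: the connection terms of the form indices would cancel in the cyclic sum, as [Gam] is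
    symmetric and [curv] antisymmetric. *)
Lemma bianchi a i j p q :
  let D b (M : 'M[A]_n) := dmx (d b) M + Gam b *m M + M *m (Gam b)^T in
  (D a (curv i j *m H) + D i (curv j a *m H) + D j (curv a i *m H)) p q = 0.
Proof.
move=> D.
have DH b M : D b (M *m H) = (dmx (d b) M + Gam b *m M - M *m Gam b) *m H.
  rewrite /D dmx_mul // metric_compat_inv !(mulmxDl, mulmxDr, mulNmx, mulmxN).
  by rewrite !mulmxA; mxabel.
rewrite !DH -!mulmxDl.
suff -> : dmx (d a) (curv i j) + Gam a *m curv i j - curv i j *m Gam a +
  (dmx (d i) (curv j a) + Gam i *m curv j a - curv j a *m Gam i) +
  (dmx (d j) (curv a i) + Gam j *m curv a i - curv a i *m Gam j) = 0.
  by rewrite mul0mx mxE.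
have ddC b c M : dmx (d b) (dmx (d c) M) = dmx (d c) (dmx (d b) M) :> 'M[A]_n.
  by apply/matrixP => ? ?; rewrite !mxE dC.
rewrite /curv !dmxD // !dmxN // !dmx_mul //.
rewrite (ddC a i (Gam j)) (ddC a j (Gam i)) (ddC i j (Gam a)).
rewrite !(mulmxDl, mulmxDr, mulNmx, mulmxN) !mulmxA.
by apply/matrixP => ? ?; rewrite !(addmxE, oppmxE) [RHS]mxE; ring.
Qed.

(** Both form indices of the Bianchi identity are contracted with the matrix indices. One cyclic
    term becomes the differential of the scalar curvature; the other two are equal, and each becomes
    minus the divergence of the Ricci endomorphism. *)
Lemma contracted_bianchi a :
  d a (\tr (H *m ric^T)) = dive (H *m ric^T) a + dive (H *m ric^T) a.
Proof.
set N := H *m ric^T; pose K i j := curv i j *m H.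
have KN i j p q : K i j p q = - K j i p q.
  by rewrite /K curvN mulNmx oppmxE.
have KT i j p q : K i j p q = - K i j q p.
  by rewrite -[in LHS](trmxK (K i j)) mxE curvH oppmxE.
have NE p i : \sum_j K i j p j = N p i.
  rewrite (_ : N = (ric *m H)^T); last by rewrite trmx_mul metric_invT.
  rewrite mxE [RHS]mxE; under [RHS]eq_bigr => k _ do rewrite mxE mulr_suml.
  rewrite exchange_big; apply: eq_bigr => j _.
  by rewrite KN KT opprK mxE.
have trN : \sum_i \sum_j K i j i j = \tr N.
  by apply: eq_bigr => i _; rewrite NE.
have mulE (M P : 'M[A]_n) p q : (M *m P) p q = \sum_k M p k * P k q.
  by rewrite mxE.
have mulTE (M P : 'M[A]_n) p q : (M *m P^T) p q = \sum_k M p k * P q k.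
  by rewrite mxE; apply: eq_bigr => k _; rewrite mxE.
pose D b (M : 'M[A]_n) : 'M[A]_n := dmx (d b) M + Gam b *m M + M *m (Gam b)^T.
(* As [D] skips the form indices, two copies of tr(Gam_a N) are left over here; [dE] below supplies
   one to each of the two divergences. *)
have S1 : \sum_i \sum_j D a (K i j) i j =
    d a (\tr N) + \tr (Gam a *m N) + \tr (Gam a *m N).
  rewrite -trN (der_sum (dd a)).
  have tr1 : \tr (Gam a *m N) = \sum_i \sum_j (Gam a *m K i j) i j.
    apply: eq_bigr => i _; rewrite mulE.
    under eq_bigr => k _ do rewrite -NE mulr_sumr.
    by rewrite exchange_big; apply: eq_bigr => j _; rewrite mulE.
  have tr2 : \tr (Gam a *m N) = \sum_i \sum_j (K i j *m (Gam a)^T) i j.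
    rewrite tr1 exchange_big /=; apply: eq_bigr => j _.
    apply: eq_bigr => i _; rewrite mulE mulTE; apply: eq_bigr => p _.
    by rewrite KN KT opprK mulrC.
  rewrite [X in _ = _ + X + _]tr1 [X in _ = _ + X]tr2.
  rewrite -!big_split /=; apply: eq_bigr => i _.
  rewrite (der_sum (dd a)) -!big_split /=; apply: eq_bigr => j _.
  by rewrite /D !addmxE dmxE.
have S2 : \sum_i \sum_j D i (K j a) i j =
    - \sum_i (dmx (d i) N + Gam i *m N) i a.
  have -> : \sum_i \sum_j D i (K j a) i j =
      \sum_i \sum_j (d i (K j a i j) + (Gam i *m K j a) i j) +
      \sum_i \sum_j (K j a *m (Gam i)^T) i j.
    rewrite -big_split; apply: eq_bigr => i _ /=.
    rewrite -big_split; apply: eq_bigr => j _ /=.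
    by rewrite /D !addmxE dmxE.
  have -> : \sum_i \sum_j (K j a *m (Gam i)^T) i j = 0.
    rewrite exchange_big /=; apply: big1 => j _.
    set S := \sum_i _.
    (* [Gam] is symmetric and [K] antisymmetric in the two summed indices; then S = 0 because 2 is
       invertible. *)
    have SN : S = - S.
      rewrite {1}/S; under eq_bigr => i _ do rewrite mulTE.
      rewrite exchange_big /= /S -sumrN; apply: eq_bigr => i _.
      rewrite mulTE -sumrN; apply: eq_bigr => p _.
      by rewrite KT Gam_sym mulNr.
    by rewrite -[S]mul1r -half2 mulrDl {1}SN mulrN addNr.
  rewrite addr0 -sumrN; apply: eq_bigr => i _.
  rewrite addmxE dmxE -NE (der_sum (dd i)) big_split /= opprD; congr (_ + _).
    rewrite -sumrN; apply: eq_bigr => j _.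
    by rewrite KN derN.
  rewrite mulE -sumrN; under eq_bigr => j _ do rewrite mulE.
  rewrite exchange_big /=; apply: eq_bigr => p _.
  by rewrite -NE mulr_sumr -sumrN; apply: eq_bigr => j _; rewrite (KN j a) mulrN.
have S3 : \sum_i \sum_j D j (K a i) i j = \sum_i \sum_j D i (K j a) i j.
  rewrite exchange_big /=; apply: eq_bigr => i _; apply: eq_bigr => j _.
  have DT b M : D b M^T = (D b M)^T.
    rewrite /D !trD !trmx_mul !trmxK dmx_tr; mxabel.
  have -> : K a j = (K j a)^T.
    by apply/matrixP => p q; rewrite [RHS]mxE KN KT opprK.
  by rewrite DT [LHS]mxE.
have : \sum_i \sum_j D a (K i j) i j + \sum_i \sum_j D i (K j a) i j +
       \sum_i \sum_j D j (K a i) i j = 0.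
  rewrite -!big_split /=; apply: big1 => i _; rewrite -!big_split /=.
  apply: big1 => j _; have := bianchi a i j i j; cbv zeta; rewrite 2!addmxE; exact.
have dE : dive N a = \sum_i (dmx (d i) N + Gam i *m N) i a - \tr (Gam a *m N).
  have -> : \tr (Gam a *m N) = \sum_i (N *m Gam i) i a.
    rewrite mxtrace_mulC; apply: eq_bigr => i _.
    by rewrite !mulE; apply: eq_bigr => p _; rewrite Gam_sym.
  by rewrite -sumrB; apply: eq_bigr => i _; rewrite addmxE oppmxE.
rewrite S3 S2 S1 dE => /eqP.
rewrite -addrA addr_eq0 => /eqP E.
apply: (addIr (\tr (Gam a *m N) + \tr (Gam a *m N))).
rewrite addrA E; ring.
Qed.

Lemma gdotE u v : gdot u v = \sum_i d i u * (H *m grad v) i 0.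
Proof.
apply: eq_bigr => i _; rewrite mxE mulr_sumr; apply: eq_bigr => j _.
by rewrite gradE; ring.
Qed.

Lemma d_gdot a u v : d a (gdot u v) =
  (hess u *m (H *m grad v)) a 0 + (hess v *m (H *m grad u)) a 0.
Proof.
set X := H *m grad v.
have dX i : d a (X i 0) = (H *m hess v) i a - \sum_k Gam a i k * X k 0.
  by rewrite hess_endo /covd addmxE dmxE -/X [X in _ + X - _]mxE addrK.
have hX : (hess v *m (H *m grad u)) a 0 = \sum_i d i u * (H *m hess v) i a.
  transitivity (((H *m hess v)^T *m grad u) a 0).
    by rewrite trmx_mul hessT metric_invT mulmxA.
  by rewrite mxE; apply: eq_bigr => i _; rewrite mxE gradE mulrC.
rewrite gdotE (der_sum (dd a)) hX -/X.
under eq_bigr => i _ do rewrite (derM (dd a)) dX mulrBr addrCA.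
rewrite big_split addrC /=; congr (_ + _); rewrite sumrB.
have -> : \sum_i d i u * \sum_k Gam a i k * X k 0 =
          \sum_k (\sum_i Gam a i k * d i u) * X k 0.
  under eq_bigr => i _ do rewrite mulr_sumr.
  rewrite exchange_big; apply: eq_bigr => k _; rewrite mulr_suml.
  by apply: eq_bigr => i _; ring.
by rewrite -sumrB mxE; apply: eq_bigr => k _; rewrite hessE; ring.
Qed.

Lemma diveD P Q a : dive (P + Q) a = dive P a + dive Q a.
Proof.
rewrite -big_split; apply: eq_bigr => i _ /=.
by rewrite dmxD // mulmxDr mulmxDl !(addmxE, oppmxE); ring.
Qed.

Lemma diveZ u P a : dive (u *: P) a = \sum_i d i u * P i a + u * dive P a.
Proof.
rewrite mulr_sumr -big_split; apply: eq_bigr => i _ /=.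
rewrite -scalemxAr -scalemxAl !(addmxE, oppmxE) !dmxE.
have sE (M : 'M[A]_n) p q : (u *: M) p q = u * M p q by rewrite mxE.
by rewrite !sE (derM (dd i)); ring.
Qed.

Lemma dive1 a : dive 1%:M a = 0.
Proof.
by apply: big1 => i _; rewrite dmx1 // mulmx1 mul1mx add0r subrr mxE.
Qed.

Lemma dive_scalar u a : dive (u%:M) a = d a u.
Proof.
rewrite -scalemx1 diveZ dive1 mulr0 addr0 (bigD1 a) //= big1 => [|i ia].
  by rewrite addr0 mxE eqxx mulr1.
by rewrite mxE (negPf ia) mulr0.
Qed.

(** * The differential of the warping expression *)

Section SolitonConstant.
Variables (m : nat) (f fi lam phi : A).
Hypothesis ffi : f * fi = 1.
Hypothesis base_eq : ric + hess phi = lam *: G + (m%:R * fi) *: hess f.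
Hypothesis base_deq : forall a,
  - 2 * lam * d a phi + d a ((2 - m%:R - n%:R) * lam + gdot phi phi - lap phi
                              - m%:R * fi * gdot phi f) = 0.

Let c := m%:R * fi.

Lemma ric_grad u a : (ric *m (H *m grad u)) a 0 =
  lam * d a u + c * (hess f *m (H *m grad u)) a 0
  - (hess phi *m (H *m grad u)) a 0.
Proof.
have -> : ric = lam *: G + c *: hess f - hess phi by rewrite -base_eq addrK.
rewrite mulmxBl mulmxDl -!scalemxAl.
rewrite (mulmxA G) GH mul1mx.
have sE w (M : 'cV[A]_n) p q : (w *: M) p q = w * M p q by rewrite mxE.
by rewrite !(addmxE, oppmxE) !sE gradE.
Qed.

Lemma warping_constant_der a :
  m%:R * d a (lam * f ^+ 2 + f * lap f + (m%:R - 1) * gdot f f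
              - f * gdot phi f) = 0.
Proof.
have NE : H *m ric^T = lam%:M + (c *: (H *m hess f) - H *m hess phi).
  have -> : ric = lam *: G + c *: hess f - hess phi by rewrite -base_eq addrK.
  have trZ u (M : 'M[A]_n) : (u *: M)^T = u *: M^T.
    by apply/matrixP => i j; rewrite !mxE.
  rewrite !(trD, trN) !trZ !hessT GT mulmxBr mulmxDr -!scalemxAr HG.
  by rewrite scalemx1 addrA.
have dfi : d a fi = - (fi * fi * d a f) by exact: (der_inv (dd a) ffi).
have trN : \tr (H *m ric^T) = n%:R * lam + c * lap f - lap phi.
  rewrite NE mxtraceD mxtrace_scalar -[lam *+ n]mulr_natl -addrA.
  by rewrite mxtraceD mxtraceZ raddfN.
have := contracted_bianchi a; rewrite trN.
have -> : dive (H *m ric^T) a = d a lam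
   - m%:R * fi * fi * (hess f *m (H *m grad f)) a 0
   + c * (d a (lap f) + (ric *m (H *m grad f)) a 0)
   - (d a (lap phi) + (ric *m (H *m grad phi)) a 0).
  rewrite NE !diveD dive_scalar diveZ dive_hess.
  have -> : dive (- (H *m hess phi)) a = - dive (H *m hess phi) a.
    by rewrite -scaleN1r diveZ mulN1r big1 ?add0r // => i _;
      rewrite (derN (dd i)) (der1 (dd i)) oppr0 mul0r.
  rewrite dive_hess.
  suff -> : \sum_i d i c * (H *m hess f) i a =
     - (m%:R * fi * fi * (hess f *m (H *m grad f)) a 0) by ring.
  have -> : (hess f *m (H *m grad f)) a 0 = \sum_i d i f * (H *m hess f) i a.
    transitivity (((H *m hess f)^T *m grad f) a 0).
      by rewrite trmx_mul hessT metric_invT mulmxA.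
    by rewrite mxE; apply: eq_bigr => i _; rewrite mxE gradE mulrC.
  rewrite mulr_sumr -sumrN; apply: eq_bigr => i _.
  by rewrite /c (derM (dd i)) (der_nat (dd i)) (der_inv (dd i) ffi); ring.
(* The Ricci terms of the Bochner identity are themselves eliminated by the base equation. This
   yields the 2 lam d phi that cancels the first term of the second equation. *)
rewrite !ric_grad.
have := base_deq a.
have [aD aM] := dd a; have aN := derN (dd a).
rewrite !(aD, aM, aN, d_gdot).
rewrite (der1 (dd a)) !(der_nat (dd a)) dfi => E2 /eqP.
rewrite -subr_eq0 => /eqP E1.
(* In the sum of the two equations d lam has coefficient (n - 2) + (2 - m - n) = - m. The factor - f
   ^+ 2 turns it into m f^2 and clears the denominators of m/f and m/f^2. *)
match type of E1 with ?l = 0 => match type of E2 with ?r = 0 =>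
  transitivity (- f ^+ 2 * (l + r)) end end; last by rewrite E1 E2; ring.
by rewrite /c; ring: ffi.
Qed.

End SolitonConstant.

End Riemann.

(** * The Laplacian in divergence form *)

Section DivergenceForm.
Context {A : comNzRingType} {n : nat}.
Variables (half : A) (d : 'I_n -> A -> A) (G H : 'M[A]_n).

(* The Laplacian in divergence form, with tr(G^-1 d_b G) / 2 for the logarithmic
   derivative of sqrt(det G).  Its invariance under a change of chart does not need
   the transformation law of the Christoffel symbols. *)
Definition lap_div (u : A) : A :=
  \sum_a d a ((H *m grad d u) a 0)
  + half * \sum_b \tr (H *m dmx (d b) G) * (H *m grad d u) b 0.

Hypotheses (half2 : half + half = 1) (dd : forall i, derivation (d i)).
Hypothesis dC : forall i j u, d i (d j u) = d j (d i u).
Hypotheses (GT : G^T = G) (GH : G *m H = 1%:M).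

(** The divergence of a field contracts the upper index of [Gam] with a lower one, and by metric
    compatibility tr(Gam_k) is half of tr(H d_k G). *)
Lemma lap_divE u : lap half d G H u = lap_div u.
Proof.
rewrite lapE // /lap_div mulr_sumr -/(grad d u).
set X := H *m grad d u.
transitivity (\sum_i d i (X i 0) + \sum_k \tr (Gam half d G H k) * X k 0).
  rewrite -[X in _ + X](_ : \sum_i \sum_k Gam half d G H i i k * X k 0 = _).
    rewrite -big_split; apply: eq_bigr => i _ /=.
    by rewrite /covd addmxE dmxE [X in _ + X]mxE.
  rewrite exchange_big; apply: eq_bigr => k _; rewrite mulr_suml.
  by apply: eq_bigr => i _; rewrite (Gam_sym half _ _ GT).
congr (_ + _); apply: eq_bigr => k _.
rewrite (metric_compat d half2 GT GH).
have HG : H *m G = 1%:M by exact: mulmx1C.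
rewrite mulmxDr mxtraceD (mulmxA H G) HG mul1mx mxtrace_mulC -mulmxA GH mulmx1.
rewrite mxtrace_tr.
set t := \tr _.
by rewrite -[t in LHS]mul1r -half2; ring.
Qed.

End DivergenceForm.

(** * Invariance of gradient products and of the Laplacian under a change of frame *)

Section ChangeOfFrame.
Context {A : comNzRingType} {n : nat}.
Variables (half : A) (d : 'I_n -> A -> A) (G H G' H' J Ji : 'M[A]_n).
Variable d' : 'I_n -> A -> A.
Hypotheses (half2 : half + half = 1) (dd : forall i, derivation (d i)).
Hypotheses (JJi : J *m Ji = 1%:M) (GJ : G = J *m G' *m J^T).
Hypotheses (GH : G *m H = 1%:M) (GH' : G' *m H' = 1%:M).
Hypothesis dJ : forall a b c, d a (J c b) = d c (J a b).
Hypothesis d'E : forall b u, d' b u = \sum_a Ji b a * d a u.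

Let JiJ : Ji *m J = 1%:M. Proof. exact: mulmx1C. Qed.

Lemma frame_inv : H = Ji^T *m H' *m Ji.
Proof.
have HG : H *m G = 1%:M by exact: mulmx1C.
suff GK : G *m (Ji^T *m H' *m Ji) = 1%:M.
  by rewrite -[LHS]mulmx1 -GK mulmxA HG mul1mx.
rewrite GJ -!mulmxA (mulmxA J^T) -trmx_mul JiJ trmx1 mul1mx (mulmxA G') GH'.
by rewrite mul1mx.
Qed.

Lemma grad_frame u : grad d' u = Ji *m grad d u.
Proof.
by apply/matrixP => i j; rewrite gradE d'E mxE; apply: eq_bigr => a _; rewrite gradE.
Qed.

Lemma gdot_frame u v : gdot d H u v = gdot d' H' u v.
Proof.
have gE (D : 'I_n -> A -> A) K : gdot D K u v = ((grad D u)^T *m K *m grad D v) 0 0.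
  rewrite -mulmxA mxE; apply: eq_bigr => i _.
  rewrite [(grad D u)^T _ _]mxE gradE mxE mulr_sumr.
  by apply: eq_bigr => j _; rewrite gradE; ring.
by rewrite !gE !grad_frame frame_inv trmx_mul !mulmxA.
Qed.

(** Differentiating the inverse Jacobian contributes - tr(J^-1 d_b J), by the symmetry [dJ] of
    second derivatives. The logarithmic derivative of sqrt(det G) contributes + tr(J^-1 d_b J),
    since det G is det G' times the square of det J. The two cancel. *)
Lemma lap_div_frame u : lap_div half d G H u = lap_div half d' G' H' u.
Proof.
rewrite /lap_div; set X := H *m grad d u; set X' := H' *m grad d' u.
have XE : X = Ji^T *m X' by rewrite /X /X' grad_frame frame_inv !mulmxA.
have XEa a : X a 0 = \sum_b Ji b a * X' b 0.
  by rewrite XE mxE; apply: eq_bigr => b _; rewrite mxE.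
have contr (t : 'I_n -> A) :
    \sum_b t b * X b 0 = \sum_c (\sum_b Ji c b * t b) * X' c 0.
  under eq_bigr => b _ do rewrite XEa mulr_sumr.
  rewrite exchange_big; apply: eq_bigr => c _; rewrite mulr_suml.
  by apply: eq_bigr => b _; ring.
have dJi b : \sum_a d a (Ji b a) = - \sum_c Ji b c * \tr (Ji *m dmx (d c) J).
  have E a : d a (Ji b a) = - \sum_c \sum_e Ji b c * (Ji e a * d c (J a e)).
    rewrite -dmxE (dmx_inv (dd a) JJi) oppmxE -mulmxA mxE; congr (- _).
    apply: eq_bigr => c _; rewrite mxE mulr_sumr; apply: eq_bigr => e _.
    by rewrite dmxE dJ; ring.
  under eq_bigr => a _ do rewrite E.
  rewrite sumrN exchange_big; congr (- _); apply: eq_bigr => c _ /=.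
  rewrite exchange_big mulr_sumr; apply: eq_bigr => e _ /=.
  by rewrite mxE mulr_sumr; apply: eq_bigr => a _; rewrite dmxE.
have trE b : \tr (H *m dmx (d b) G) = \tr (Ji *m dmx (d b) J)
    + \tr (Ji *m dmx (d b) J) + \tr (H' *m dmx (d b) G').
  have J'J : J^T *m Ji^T = 1%:M by rewrite -trmx_mul JiJ trmx1.
  have HG' : H' *m G' = 1%:M by exact: mulmx1C.
  rewrite GJ frame_inv !(dmx_mul (dd b)) dmx_tr mulmxDl !mulmxDr !mxtraceD.
  set D := dmx (d b) J.
  have -> : \tr (Ji^T *m H' *m Ji *m (D *m G' *m J^T)) = \tr (Ji *m D).
    rewrite !mulmxA mxtrace_mulC !mulmxA J'J mul1mx mxtrace_mulC !mulmxA.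
    by rewrite GH' mul1mx.
  have -> : \tr (Ji^T *m H' *m Ji *m (J *m dmx (d b) G' *m J^T)) =
            \tr (H' *m dmx (d b) G').
    rewrite -!mulmxA (mulmxA Ji J) JiJ mul1mx mxtrace_mulC !mulmxA.
    by rewrite -(mulmxA _ J^T) J'J mulmx1.
  have -> : \tr (Ji^T *m H' *m Ji *m (J *m G' *m D^T)) = \tr (Ji *m D).
    rewrite -!mulmxA (mulmxA Ji J) JiJ mul1mx (mulmxA H' G') HG' mul1mx.
    by rewrite -trmx_mul mxtrace_tr mxtrace_mulC.
  by ring.
under eq_bigr => a _ do rewrite XEa (der_sum (dd a)).
rewrite exchange_big /=.
have -> : \sum_b \sum_a d a (Ji b a * X' b 0) =
    - \sum_b \tr (Ji *m dmx (d b) J) * X b 0 + \sum_b d' b (X' b 0).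
  rewrite contr -sumrN -big_split; apply: eq_bigr => b _ /=.
  under eq_bigr => a _ do rewrite (derM (dd a)).
  by rewrite big_split /= -mulr_suml dJi mulNr d'E.
have -> : \sum_b \tr (H *m dmx (d b) G) * X b 0 =
    \sum_b \tr (Ji *m dmx (d b) J) * X b 0
    + \sum_b \tr (Ji *m dmx (d b) J) * X b 0
    + \sum_c \tr (H' *m dmx (d' c) G') * X' c 0.
  under eq_bigr => b _ do rewrite trE !mulrDl.
  rewrite !big_split /=; congr (_ + _); rewrite contr; apply: eq_bigr => c _.
  congr (_ * _); rewrite /mxtrace.
  under eq_bigr => b _ do rewrite mulr_sumr.
  rewrite exchange_big; apply: eq_bigr => i _ /=.
  transitivity (\sum_a \sum_j H' i j * (Ji c a * d a (G' j i))).
    apply: eq_bigr => a _; rewrite mxE mulr_sumr; apply: eq_bigr => j _.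
    by rewrite dmxE; ring.
  rewrite exchange_big mxE; apply: eq_bigr => j _ /=.
  by rewrite dmxE d'E mulr_sumr.
set T := \sum_b _ * _; set S := \sum_b d' b _; set U := \sum_c _.
by rewrite -[T in - T]mul1r -half2; ring.
Qed.

End ChangeOfFrame.

(** * Naturality under ring morphisms that intertwine the derivations *)

Section Naturality.
Context {A B : comNzRingType} {n : nat} (phi : {rmorphism A -> B}).
Variables (half : A) (d : 'I_n -> A -> A) (d' : 'I_n -> B -> B) (G H : 'M[A]_n).
Hypothesis phid : forall i u, phi (d i u) = d' i (phi u).
Local Notation "M ^phi" := (map_mx phi M) (at level 2, format "M ^phi").

Lemma map_dmx p q i (M : 'M[A]_(p, q)) : (dmx (d i) M)^phi = dmx (d' i) M^phi.
Proof. by apply/matrixP => a b; rewrite !mxE phid. Qed.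

Lemma map_Gam i : (Gam half d G H i)^phi = Gam (phi half) d' G^phi H^phi i.
Proof.
apply/matrixP => a b; rewrite !mxE rmorphM rmorph_sum; congr (_ * _).
by apply: eq_bigr => k _; rewrite rmorphM rmorphB rmorphD /= !phid !mxE.
Qed.

Lemma map_curv i j :
  (curv half d G H i j)^phi = curv (phi half) d' G^phi H^phi i j.
Proof. by rewrite /curv !(map_mxD, map_mxN, map_mxM, map_dmx, map_Gam). Qed.

Lemma map_ric : (ric half d G H)^phi = ric (phi half) d' G^phi H^phi.
Proof.
apply/matrixP => a b; rewrite !mxE rmorph_sum; apply: eq_bigr => i _.
by rewrite -map_curv [in RHS]mxE.
Qed.

Lemma map_hess u : (hess half d G H u)^phi = hess (phi half) d' G^phi H^phi (phi u).
Proof.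
apply/matrixP => a b; rewrite [LHS]mxE !hessE rmorphB rmorph_sum !phid.
congr (_ - _); apply: eq_bigr => k _.
by rewrite rmorphM phid -map_Gam [in RHS]mxE.
Qed.

Lemma map_lap u : phi (lap half d G H u) = lap (phi half) d' G^phi H^phi (phi u).
Proof. by rewrite /lap -trace_map_mx map_mxM map_hess. Qed.

Lemma map_gdot u v : phi (gdot d H u v) = gdot d' H^phi (phi u) (phi v).
Proof.
rewrite rmorph_sum; apply: eq_bigr => i _; rewrite rmorph_sum.
by apply: eq_bigr => j _; rewrite !rmorphM !phid mxE.
Qed.

Lemma map_grad u : (grad d u)^phi = grad d' (phi u).
Proof. by apply/matrixP => i j; rewrite !mxE phid. Qed.

Lemma map_lap_div u :
  phi (lap_div half d G H u) = lap_div (phi half) d' G^phi H^phi (phi u).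
Proof.
rewrite /lap_div rmorphD rmorphM !rmorph_sum; congr (_ + _ * _).
  by apply: eq_bigr => i _; rewrite phid -map_grad -map_mxM [in RHS]mxE.
apply: eq_bigr => i _; rewrite rmorphM -trace_map_mx map_mxM map_dmx.
by rewrite -map_grad -map_mxM [in RHS]mxE.
Qed.

End Naturality.

(** * Christoffel symbols, Ricci tensor and Hessians of a warped product *)

Section Warped.
Context {A : comNzRingType} {n m : nat}.
Variables (half : A) (d : 'I_(n + m) -> A -> A).
Variables (gB hB : 'M[A]_n) (gF hF : 'M[A]_m) (f fi : A).
Let dB (i : 'I_n) := d (lshift m i).
Let dF (i : 'I_m) := d (rshift n i).
Let G : 'M[A]_(n + m) := block_mx gB 0 0 (f ^+ 2 *: gF).
Let H : 'M[A]_(n + m) := block_mx hB 0 0 (fi ^+ 2 *: hF).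

Hypotheses (half2 : half + half = 1) (dd : forall i, derivation (d i)).
Hypothesis dC : forall i j u, d i (d j u) = d j (d i u).
Hypotheses (gBT : gB^T = gB) (gFT : gF^T = gF).
Hypotheses (gBhB : gB *m hB = 1%:M) (gFhF : gF *m hF = 1%:M).
Hypothesis ffi : f * fi = 1.
Hypotheses (dFf : forall a, dF a f = 0) (dFgB : forall a i j, dF a (gB i j) = 0)
  (dFhB : forall a i j, dF a (hB i j) = 0).
Hypotheses (dBgF : forall a i j, dB a (gF i j) = 0)
  (dBhF : forall a i j, dB a (hF i j) = 0).

Local Notation Gm := (Gam half d G H).
Local Notation GB := (Gam half dB gB hB).
Local Notation GF := (Gam half dF gF hF).
Local Notation L := (lshift m).
Local Notation R := (rshift n).
Local Notation X := (hB *m grad dB f).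

Let ddB i : derivation (dB i). Proof. exact: dd. Qed.
Let ddF i : derivation (dF i). Proof. exact: dd. Qed.

Let GLL i j : G (L i) (L j) = gB i j. Proof. exact: block_mxEul. Qed.
Let GLR i j : G (L i) (R j) = 0. Proof. by rewrite /G block_mxEur mxE. Qed.
Let GRL i j : G (R i) (L j) = 0. Proof. by rewrite /G block_mxEdl mxE. Qed.
Let GRR i j : G (R i) (R j) = f ^+ 2 * gF i j.
Proof. by rewrite /G block_mxEdr mxE. Qed.
Let HLL i j : H (L i) (L j) = hB i j. Proof. exact: block_mxEul. Qed.
Let HLR i j : H (L i) (R j) = 0. Proof. by rewrite /H block_mxEur mxE. Qed.
Let HRL i j : H (R i) (L j) = 0. Proof. by rewrite /H block_mxEdl mxE. Qed.
Let HRR i j : H (R i) (R j) = fi ^+ 2 * hF i j.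
Proof. by rewrite /H block_mxEdr mxE. Qed.

Let dBC i j u : dB i (dB j u) = dB j (dB i u). Proof. exact: dC. Qed.
Let d0 i : d i 0 = 0. Proof. exact: (der0 (dd i)). Qed.
Let dLf i x : dB i (f ^+ 2 * x) = 2 * f * dB i f * x + f ^+ 2 * dB i x.
Proof. by rewrite expr2 !(derM (ddB i)); ring. Qed.
Let dRf i x : dF i (f ^+ 2 * x) = f ^+ 2 * dF i x.
Proof. by rewrite expr2 !(derM (ddF i)) dFf; ring. Qed.

Let gFE i j : gF i j = gF j i. Proof. by rewrite -{1}gFT mxE. Qed.

(** [F] and [F'] are twice the first-kind symbols with lowered index in the base and in the fibre.
    As [H] is block diagonal, one of the two sums drops out in each use. *)
Let Gsum i k j (F : 'I_n -> A) (F' : 'I_m -> A) :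
  (forall l, d i (G j (L l)) + d j (G i (L l)) - d (L l) (G i j) = F l) ->
  (forall l, d i (G j (R l)) + d j (G i (R l)) - d (R l) (G i j) = F' l) ->
  Gm i k j = half * (\sum_l H k (L l) * F l + \sum_l H k (R l) * F' l).
Proof.
move=> FE FE'; rewrite mxE big_split_ord /=; congr (half * (_ + _)).
  by apply: eq_bigr => l _; rewrite FE.
by apply: eq_bigr => l _; rewrite FE'.
Qed.

Let Gl0 k (F : 'I_n -> A) : \sum_l H (R k) (L l) * F l = 0.
Proof. by apply: big1 => l _; rewrite HRL mul0r. Qed.
Let Gr0 k (F : 'I_m -> A) : \sum_l H (L k) (R l) * F l = 0.
Proof. by apply: big1 => l _; rewrite HLR mul0r. Qed.

Lemma Gam_LLL i k j : Gm (L i) (L k) (L j) = GB i k j.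
Proof.
rewrite (Gsum (L k) (F := fun l => dB i (gB j l) + dB j (gB i l) - dB l (gB i j))
  (F' := fun l => 0)).
- rewrite Gr0 addr0 mxE; congr (half * _).
  by apply: eq_bigr => l _; rewrite HLL.
- by move=> l; rewrite !GLL.
- by move=> l; rewrite !GLR GLL !d0 add0r add0r [d _ _]dFgB oppr0.
Qed.

Lemma Gam_LRL i k j : Gm (L i) (R k) (L j) = 0.
Proof.
rewrite (Gsum (R k) (F := fun l => dB i (gB j l) + dB j (gB i l) - dB l (gB i j))
  (F' := fun l => 0)).
- by rewrite Gl0 add0r big1 ?mulr0 // => l _; rewrite mulr0.
- by move=> l; rewrite !GLL.
- by move=> l; rewrite !GLR GLL !d0 add0r add0r [d _ _]dFgB oppr0.
Qed.

Let lowLR i j : (forall l, d (L i) (G (R j) (L l)) + d (R j) (G (L i) (L l))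
    - d (L l) (G (L i) (R j)) = 0) /\
  (forall l, d (L i) (G (R j) (R l)) + d (R j) (G (L i) (R l))
    - d (R l) (G (L i) (R j)) = 2 * f * dB i f * gF j l).
Proof.
split=> l.
  by rewrite GRL GLR GLL !d0 [d _ _]dFgB addr0 subrr.
by rewrite GLR GRR GLR !d0 [d _ _]dLf dBgF; ring.
Qed.

Lemma Gam_LLR i k j : Gm (L i) (L k) (R j) = 0.
Proof.
rewrite (Gsum (L k) (lowLR i j).1 (lowLR i j).2).
by rewrite Gr0 addr0 big1 ?mulr0 // => l _; rewrite mulr0.
Qed.

Lemma Gam_LRR i k j : Gm (L i) (R k) (R j) = fi * dB i f * (k == j)%:R.
Proof.
rewrite (Gsum (R k) (lowLR i j).1 (lowLR i j).2) Gl0 add0r.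
transitivity ((half + half) * fi * (f * fi) * dB i f * (hF *m gF) k j).
  rewrite mxE !mulr_sumr; apply: eq_bigr => l _.
  by rewrite HRR (gFE j); ring.
by rewrite half2 ffi (mulmx1C gFhF) mxE !mul1r mulr1.
Qed.

Let GmT : G^T = G.
Proof.
rewrite /G tr_block_mx !trmx0 gBT; congr (block_mx _ _ _ _).
by apply/matrixP => i j; rewrite !mxE gFE.
Qed.

Lemma Gam_RLL i k j : Gm (R i) (L k) (L j) = 0.
Proof. by rewrite (Gam_sym half _ _ GmT) Gam_LLR. Qed.

Lemma Gam_RRL i k j : Gm (R i) (R k) (L j) = fi * dB j f * (k == i)%:R.
Proof. by rewrite (Gam_sym half _ _ GmT) Gam_LRR. Qed.

Let lowRR i j : (forall l, d (R i) (G (R j) (L l)) + d (R j) (G (R i) (L l))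
    - d (L l) (G (R i) (R j)) = - (2 * f * dB l f * gF i j)) /\
  (forall l, d (R i) (G (R j) (R l)) + d (R j) (G (R i) (R l))
    - d (R l) (G (R i) (R j)) =
     f ^+ 2 * (dF i (gF j l) + dF j (gF i l) - dF l (gF i j))).
Proof.
split=> l.
  by rewrite !GRL GRR !d0 [d _ _]dLf dBgF; ring.
by rewrite !GRR ![d _ _]dRf; ring.
Qed.

Lemma Gam_RLR i k j : Gm (R i) (L k) (R j) = - (f * X k 0 * gF i j).
Proof.
rewrite (Gsum (L k) (lowRR i j).1 (lowRR i j).2) Gr0 addr0.
transitivity (- ((half + half) * f * X k 0 * gF i j)).
  rewrite [X k 0]mxE !(mulr_sumr, mulr_suml) -sumrN; apply: eq_bigr => l _.
  by rewrite HLL gradE; ring.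
by rewrite half2 mul1r.
Qed.

Lemma Gam_RRR i k j : Gm (R i) (R k) (R j) = GF i k j.
Proof.
rewrite (Gsum (R k) (lowRR i j).1 (lowRR i j).2) Gl0 add0r mxE.
congr (half * _); apply: eq_bigr => l _; rewrite HRR.
by ring: ffi.
Qed.

Let dFfi a : dF a fi = 0.
Proof. by rewrite (der_inv (ddF a) ffi) dFf mulr0 oppr0. Qed.

Let dFsum a (I : finType) (E : I -> A) :
  (forall i, dF a (E i) = 0) -> dF a (\sum_i E i) = 0.
Proof. by move=> E0; rewrite (der_sum (ddF a)) big1. Qed.

Let dFdB a b u : dF a u = 0 -> dF a (dB b u) = 0.
Proof. by rewrite /dF /dB dC => ->; rewrite d0. Qed.

Let dBdF a b u : dB a u = 0 -> dB a (dF b u) = 0.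
Proof. by rewrite /dF /dB dC => ->; rewrite d0. Qed.

(** [half] is known only through half + half = 1: its derivative doubles to d 1 = 0, and 2 is
    invertible. *)
Let dFhalf a : d a half = 0.
Proof.
have : d a half + d a half = 0.
  by rewrite -(derD (dd a)) half2 (der1 (dd a)).
move=> E; rewrite -[LHS]mul1r -half2 mulrDl -mulrDr E mulr0 //.
Qed.

Let dF_GB a i k j : dF a (GB i k j) = 0.
Proof.
rewrite mxE (derM (ddF a)) [dF a half]dFhalf mul0r add0r dFsum ?mulr0 // => l.
rewrite (derM (ddF a)) dFhB mul0r add0r (derB (ddF a)) (derD (ddF a)).
by rewrite !dFdB // addr0 subr0 mulr0.
Qed.

Let dB_GF a i k j : dB a (GF i k j) = 0.
Proof.
rewrite mxE (derM (ddB a)) [dB a half]dFhalf mul0r add0r (der_sum (ddB a)).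
rewrite big1 ?mulr0 // => l _.
rewrite (derM (ddB a)) dBhF mul0r add0r (derB (ddB a)) (derD (ddB a)).
by rewrite !dBdF // addr0 subr0 mulr0.
Qed.

Let Gam_r := (Gam_LLL, Gam_LRL, Gam_LLR, Gam_LRR, Gam_RLL, Gam_RRL, Gam_RLR,
  Gam_RRR).

Let ricE j k : ric half d G H j k =
  \sum_i curv half d G H (L i) j (L i) k + \sum_i curv half d G H (R i) j (R i) k.
Proof. by rewrite mxE big_split_ord. Qed.

Let d_delta i u (b : bool) : d i (u * b%:R) = d i u * b%:R.
Proof. by rewrite (derM (dd i)) (der_nat (dd i)) mulr0 addr0. Qed.

(** In the trace, the base directions reproduce the curvature of the base, and each of the m fibre
    directions contributes - (1/f) Hess f. *)
Lemma ric_LL j k : ric half d G H (L j) (L k) =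
  ric half dB gB hB j k - m%:R * fi * hess half dB gB hB f j k.
Proof.
rewrite ricE; congr (_ + _).
  rewrite [RHS]mxE; apply: eq_bigr => i _; rewrite !curv_entry big_split_ord /=.
  rewrite [X in _ + (_ + X)]big1 ?addr0 => [|p _]; last first.
    by rewrite !Gam_r; ring.
  by congr (_ + _); [rewrite !Gam_r | apply: eq_bigr => p _; rewrite !Gam_r].
transitivity (\sum_(i < m) - (fi * hess half dB gB hB f j k)); last first.
  by rewrite sumr_const card_ord -mulr_natl; ring.
apply: eq_bigr => i _; rewrite curv_entry big_split_ord /= hessE.
rewrite !Gam_r d0 sub0r d_delta eqxx mulr1.
rewrite -/(dB j _) (derM (ddB j)) (der_inv (ddB j) ffi).
under eq_bigr => p _ do rewrite !Gam_r eqxx mul0r subr0 mulr1 -mulrA.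
rewrite -mulr_sumr [X in _ + (_ + X)](bigD1 i) //=.
rewrite [X in _ + (_ + (_ + X))]big1 => [|p pi]; last first.
  by rewrite !Gam_r eq_sym (negPf pi) /=; ring.
rewrite !Gam_r eqxx.
have -> : \sum_p dB p f * GB j p k = \sum_p GB j p k * dB p f.
  by apply: eq_bigr => p _; rewrite mulrC.
by rewrite /=; ring.
Qed.

Lemma ric_LR j k : ric half d G H (L j) (R k) = 0.
Proof.
rewrite ricE [X in X + _]big1 ?add0r => [|i _]; last first.
  rewrite curv_entry big_split_ord /= !Gam_r !d0 !big1 => [|p _|p _].
  - by rewrite subr0 !addr0.
  - by rewrite !Gam_r; ring.
  - by rewrite !Gam_r; ring.
apply: big1 => i _.
rewrite curv_entry big_split_ord /= !Gam_r d_delta -/(dF i _) (derM (ddF i)).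
rewrite dFfi dFdB // -/(dB j _) dB_GF [X in _ + (X + _)]big1 => [|p _]; last first.
  by rewrite !Gam_r; ring.
rewrite sumrB (bigD1 k) //= big1 => [|p pk]; last first.
  by rewrite !Gam_r (negPf pk) /=; ring.
rewrite (bigD1 i) //= big1 => [|p pk]; last first.
  by rewrite !Gam_r eq_sym (negPf pk) /=; ring.
by rewrite !Gam_r !eqxx /=; ring.
Qed.

Lemma ric_RL j k : ric half d G H (R j) (L k) = 0.
Proof.
rewrite ricE [X in X + _]big1 ?add0r => [|i _]; last first.
  rewrite curv_entry big_split_ord /= !Gam_r d0 -/(dF j _) dF_GB !big1 => [|p _|p _].
  - by rewrite subr0 !addr0.
  - by rewrite !Gam_r; ring.
  - by rewrite !Gam_r; ring.
apply: big1 => i _.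
rewrite curv_entry big_split_ord /= !Gam_r !d_delta -/(dF i _) -/(dF j _).
rewrite !(derM (ddF _)) !dFfi !dFdB //.
rewrite [X in _ + (X + _)]big1 => [|p _]; last first.
  by rewrite !Gam_r; ring.
rewrite sumrB (bigD1 j) //= big1 => [|p pk]; last first.
  by rewrite !Gam_r (negPf pk) /=; ring.
rewrite (bigD1 i) //= big1 => [|p pk]; last first.
  by rewrite !Gam_r (negPf pk) /=; ring.
by rewrite !Gam_r !eqxx (Gam_sym half _ _ gFT i j i) /=; ring.
Qed.

(** The base directions of the trace add up to - f times the divergence of grad f; the fibre
    directions give the curvature of the fibre and the gradient term. *)
Lemma ric_RR j k : ric half d G H (R j) (R k) = ric half dF gF hF j k
  - (f * lap half dB gB hB f + (m%:R - 1) * gdot dB hB f f) * gF j k.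
Proof.
rewrite ricE.
have -> : \sum_i curv half d G H (L i) (R j) (L i) (R k) =
   - (f * lap half dB gB hB f) * gF j k.
  rewrite (lapE half2 ddB dBC gBT gBhB) mulr_sumr -sumrN mulr_suml; apply: eq_bigr => i _.
  rewrite curv_entry big_split_ord /= !Gam_r -/(dF j _) -/(dB i _).
  rewrite (derN (ddB i)) !(derM (ddB i)) dBgF.
  rewrite [X in _ - X + _]d0.
  rewrite [X in _ + (_ + X)](bigD1 k) //= [X in _ + (_ + (_ + X))]big1 => [|p pk]; last first.
    by rewrite !Gam_r (negPf pk) /=; ring.
  rewrite !Gam_r eqxx /covd addmxE dmxE [(_ *m X) i 0]mxE.
  under eq_bigr => p _ do rewrite !Gam_r.
  rewrite (_ : \sum_p _ = - (f * gF j k * \sum_p GB i i p * X p 0)).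
    by set S := \sum_p _; rewrite -/S /=; ring: ffi.
  by rewrite mulr_sumr -sumrN; apply: eq_bigr => p _; ring.
have -> : \sum_i curv half d G H (R i) (R j) (R i) (R k) =
   ric half dF gF hF j k - (m%:R - 1) * gdot dB hB f f * gF j k; last by ring.
pose T := gdot dB hB f f * gF j k.
(* Products of symbols through the base subtract [T] in every fibre direction, and give it back for
   i = j. Hence the coefficient m - 1. *)
transitivity (\sum_i (curv half dF gF hF i j i k + (T * (i == j)%:R - T))).
  apply: eq_bigr => i _; rewrite !curv_entry big_split_ord /= !Gam_r.
  rewrite -/(dF i _) -/(dF j _).
  under [in LHS]eq_bigr => p _ do rewrite !Gam_r eqxx.
  under [X in _ + (_ + X) = _]eq_bigr => p _ do rewrite !Gam_r.
  rewrite (_ : \sum_p _ = T * (i == j)%:R - T); first by rewrite addrA addrAC.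
  rewrite /T gdotE // mulrAC !mulr_suml -sumrB; apply: eq_bigr => p _.
  case: eqP => [->|_] /=; last by ring: ffi.
  by ring: ffi.
rewrite big_split sumrB /= -mulr_sumr sumr_const card_ord -mulr_natl.
have -> : \sum_(i < m) (i == j)%:R = 1 :> A.
  by rewrite (bigD1 j) //= big1 ?eqxx ?addr0 // => i /negPf ->.
by rewrite [in RHS]mxE /T; ring.
Qed.

(** A function lifted from the base still has a fibre block: the symbols [Gam_RLR], which equal - f
    grad f times gF, pair with du. *)
Lemma hess_warped u (dFu : forall a, dF a u = 0) :
  hess half d G H u =
  block_mx (hess half dB gB hB u) 0 0 ((f * gdot dB hB u f) *: gF).
Proof.
apply/matrixP => i j; rewrite hessE big_split_ord /=.
rewrite [X in _ - (_ + X)]big1 ?addr0 => [|k _]; last by rewrite [d _ u]dFu mulr0.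
case: (split_ordP i) => {}i ->; case: (split_ordP j) => {}j ->.
- rewrite block_mxEul hessE; congr (_ - _).
  by apply: eq_bigr => k _; rewrite Gam_LLL.
- rewrite block_mxEur mxE [d (R j) u]dFu d0 big1 ?subr0 // => k _.
  by rewrite Gam_LLR mul0r.
- rewrite block_mxEdl mxE [d (R i) _]dFdB // big1 ?subr0 // => k _.
  by rewrite Gam_RLL mul0r.
- rewrite block_mxEdr mxE [d (R j) u]dFu d0 gdotE sub0r mulr_sumr mulr_suml.
  rewrite -sumrN; apply: eq_bigr => k _.
  by rewrite Gam_RLR -/(dB k u); ring.
Qed.

Lemma ric_warped : ric half d G H =
  block_mx (ric half dB gB hB - (m%:R * fi) *: hess half dB gB hB f) 0 0
    (ric half dF gF hF
     - (f * lap half dB gB hB f + (m%:R - 1) * gdot dB hB f f) *: gF).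
Proof.
apply/matrixP => i j.
case: (split_ordP i) => {}i ->; case: (split_ordP j) => {}j ->.
- by rewrite block_mxEul ric_LL addmxE oppmxE scalemxE.
- by rewrite block_mxEur ric_LR mxE.
- by rewrite block_mxEdl ric_RL mxE.
- by rewrite block_mxEdr ric_RR addmxE oppmxE scalemxE.
Qed.

Lemma warped_soliton (lam phi mu : A) :
  (forall a, dF a phi = 0) ->
  ric half dB gB hB + hess half dB gB hB phi
    = lam *: gB + (m%:R * fi) *: hess half dB gB hB f ->
  lam * f ^+ 2 + f * lap half dB gB hB f + (m%:R - 1) * gdot dB hB f f
    - f * gdot dB hB phi f = mu ->
  ric half dF gF hF = mu *: gF ->
  ric half d G H + hess half d G H phi = lam *: G.
Proof.
move=> dFphi base_eq muE einstein.
rewrite ric_warped hess_warped // add_block_mx scale_block_mx !scaler0 !addr0.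
congr (block_mx _ _ _ _); first by rewrite addrAC base_eq addrK.
rewrite einstein -scalerBl -scalerDl scalerA -muE; congr (_ *: _).
by ring.
Qed.

End Warped.

(** * Calculus in coordinates *)

Lemma differentiable_of_linear (R : realType) (V W : normedModType R)
    (f : V -> W) (df : {linear V -> W}) (x : V) :
  continuous df ->
  (forall e : R, 0 < e ->
     \forall h \near (0 : V), `|f (h + x) - f x - df h| <= e * `|h|) ->
  differentiable f x /\ 'd f x = df :> (V -> W).
Proof.
move=> cdf fo.
have dE : f \o shift x = cst (f x) + df +o_ 0 id.
  apply/eqaddoP => e e0; apply: filterS (fo e e0) => h.
  by rewrite /= /GRing.add /= opprD addrA.
have E := diff_unique cdf dE.
by split=> //; apply/diff_locallyP; rewrite E.
Qed.

Section RowVectors.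
Context {R : realType} {n : nat}.
Implicit Types (x y z : 'rV[R]_n) (u : 'rV[R]_n -> R).
Local Notation e_ i := (delta_mx 0 i : 'rV[R]_n).

Lemma rV_norm_le x (r : R) : 0 <= r -> (forall i, `|x 0 i| <= r) -> `|x| <= r.
Proof.
move=> r0 xr; rewrite [leLHS]/Num.Def.normr/= mx_normrE (bigmax_le _ r0)//=.
by move=> [i j] _ /=; rewrite (ord1 i).
Qed.

Lemma rV_coord_norm x i : `|x 0 i| <= `|x|.
Proof.
rewrite [leRHS]/Num.Def.normr/= mx_normrE.
exact: (le_bigmax _ (fun ij : 'I_1 * 'I_n => `|x ij.1 ij.2|) (0, i)).
Qed.

Lemma norm_delta (s : R) i : `|s *: e_ i| = `|s|.
Proof.
apply/eqP; rewrite eq_le; apply/andP; split.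
  apply: rV_norm_le => // j; rewrite !mxE eqxx /=.
  by case: eqP => _; rewrite ?mulr1 ?mulr0 ?normr0.
by have := rV_coord_norm (s *: e_ i) i; rewrite !mxE !eqxx mulr1.
Qed.

Lemma is_derive_line u z i t : derivable u (t *: e_ i + z) (e_ i) ->
  is_derive t 1 (fun t => u (t *: e_ i + z)) (pd i u (t *: e_ i + z)).
Proof.
move=> du.
suff E : (fun h : R => h^-1 *: (u ((h *: 1 + t) *: e_ i + z) - u (t *: e_ i + z)))
    = (fun h => h^-1 *: (u (h *: e_ i + (t *: e_ i + z)) - u (t *: e_ i + z))).
  by apply: DeriveDef; rewrite /derivable /pd /derive /= E.
by apply/funext => h; rewrite scalerDl addrA /GRing.scale /= mulr1.
Qed.

Lemma mean_value_line u z i (s : R) :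
  (forall t : R, `|t| <= `|s| -> derivable u (t *: e_ i + z) (e_ i)) ->
  exists2 t : R, `|t| <= `|s| &
    u (s *: e_ i + z) - u z = s * pd i u (t *: e_ i + z).
Proof.
move=> du; pose g (t : R) : R := u (t *: e_ i + z).
have g0 : u z = g 0 by rewrite /g scale0r add0r.
have dg (t : R) : `|t| <= `|s| -> is_derive t 1 g (pd i u (t *: e_ i + z)).
  by move=> ts; apply: is_derive_line; exact: du.
have cg (t : R) : `|t| <= `|s| -> {for t, continuous g}.
  move=> /dg [dgt _]; apply: differentiable_continuous.
  exact/derivable1_diffP.
have [s0|s0] := leP 0 s.
  have inI (t : R) : t \in `[0, s] -> `|t| <= `|s|.
    by rewrite in_itv /= => /andP[t0 ts]; rewrite !ger0_norm.
  have [||t tI E] := MVT_segment s0 (f := g) (df := fun t : R => pd i u (t *: e_ i + z)).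
  - by move=> t tI; apply/dg/inI/(subset_itv_oo_cc tI).
  - apply: continuous_in_subspaceT => t; rewrite inE /= => tI.
    exact/cg/inI.
  - exists t; first exact: inI.
    by rewrite g0 -/(g s) E subr0 mulrC.
have inI (t : R) : t \in `[s, 0] -> `|t| <= `|s|.
  by rewrite in_itv /= => /andP[t0 ts]; rewrite !ler0_norm ?lerN2 // ltW.
have [||t tI E] := MVT_segment (ltW s0) (f := g) (df := fun t : R => pd i u (t *: e_ i + z)).
- by move=> t tI; apply/dg/inI/(subset_itv_oo_cc tI).
- apply: continuous_in_subspaceT => t; rewrite inE /= => tI.
  exact/cg/inI.
- exists t; first exact: inI.
  by rewrite g0 -/(g s) -opprB E sub0r; ring.
Qed.

(** From [x] to [y] one coordinate is changed at a time, with the mean value theorem on each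
    segment. The norm is the maximum norm, so the whole path stays within the distance of [y] from
    [x]. *)
Lemma partial_increment u x (r eps : R) :
  (forall y i, `|y - x| < r ->
     derivable u y (e_ i) /\ `|pd i u y - pd i u x| <= eps) ->
  forall y, `|y - x| < r ->
  `|u y - u x - \sum_i (y - x) 0 i * pd i u x| <= n%:R * eps * `|y - x|.
Proof.
move=> du y yr.
pose z k := \row_j (if (j < k)%N then y 0 j else x 0 j).
have zb k : `|z k - x| <= `|y - x|.
  apply: rV_norm_le => // j; rewrite !mxE; case: ifP => _.
    by have := rV_coord_norm (y - x) j; rewrite !mxE.
  by rewrite subrr normr0.
have z0 : z 0%N = x by apply/rowP => j; rewrite mxE.
have zn : z n = y by apply/rowP => j; rewrite mxE ltn_ord.
have step (k : 'I_n) : z k.+1 = (y - x) 0 k *: e_ k + z k.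
  apply/rowP => j; rewrite !mxE ltnS leq_eqVlt eqxx /=.
  have -> : (j == k :> nat) = (j == k) by [].
  by case: eqP => [->|_]; rewrite ?ltnn /= ?mulr1 ?mulr0 ?add0r ?subrK.
have incr (k : 'I_n) : `|u (z k.+1) - u (z k) - (y - x) 0 k * pd k u x|
    <= eps * `|y - x|.
  have near_x (t : R) : `|t| <= `|(y - x) 0 k| -> `|t *: e_ k + z k - x| < r.
    move=> tb; apply: le_lt_trans yr; apply: rV_norm_le => // j; rewrite !mxE eqxx.
    have [->|jk] := eqVneq j k.
      rewrite ltnn mulr1 addrK; apply: (le_trans tb); exact: rV_coord_norm.
    rewrite mulr0 add0r; case: ifP => _; last by rewrite subrr normr0.
    by have := rV_coord_norm (y - x) j; rewrite !mxE.
  have [t /near_x/(du _ k)[]//|t tb E] := @mean_value_line u (z k) k ((y - x) 0 k).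
  rewrite step E -mulrBr normrM mulrC.
  have [_ pb] := du _ k (near_x _ tb).
  by apply: ler_pM => //; exact: rV_coord_norm.
have -> : u y - u x = \sum_(k < n) (u (z k.+1) - u (z k)).
  rewrite -{1}zn -{1}z0 -(telescope_sumr (fun k => u (z k)) (leq0n n)).
  by rewrite big_mkord.
rewrite -sumrB; apply: (le_trans (ler_norm_sum _ _ _)).
apply: (@le_trans _ _ (\sum_(k < n) eps * `|y - x|)); first exact: ler_sum.
by rewrite sumr_const card_ord -mulrA mulr_natl.
Qed.

(** When all partial derivatives vanish, [partial_increment] applies with eps = 0. *)
Lemma constant_on_ball u x (r : R) :
  (forall y i, `|y - x| < r -> derivable u y (e_ i) /\ pd i u y = 0) ->
  forall y, `|y - x| < r -> u y = u x.
Proof.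
move=> du y yr; apply/eqP; rewrite -subr_eq0 -normr_le0.
have r0 : 0 < r by apply: le_lt_trans yr.
have x0 : `|x - x| < r by rewrite subrr normr0.
have H z i : `|z - x| < r -> derivable u z (e_ i) /\ `|pd i u z - pd i u x| <= 0.
  by move=> zr; have [? ->] := du z i zr; rewrite (du x i x0).2 subrr normr0.
have := @partial_increment u x r 0 H y yr.
rewrite mulr0 mul0r big1 ?subr0 // => i _.
by rewrite (du x i x0).2 mulr0.
Qed.

Definition differential_at u x (v : 'rV[R]_n) : R := \sum_i v 0 i * pd i u x.

Lemma differential_at_is_linear u x : linear (differential_at u x : _ -> R^o).
Proof.
move=> a v w; rewrite /differential_at scaler_sumr -big_split.
apply: eq_bigr => i _; rewrite !mxE /GRing.scale /=; ring.
Qed.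

HB.instance Definition _ u x := GRing.isLinear.Build R 'rV[R]_n R^o _
  (differential_at u x) (differential_at_is_linear u x).

Lemma cvg_sumR (T : Type) (F : set_system T) {FF : Filter F} (I : Type)
    (r : seq I) (f : I -> T -> R) (a : I -> R) :
  (forall i, f i t @[t --> F] --> a i) ->
  \sum_(i <- r) f i t @[t --> F] --> \sum_(i <- r) a i.
Proof.
move=> fa; elim: r => [|i r IH].
  by under eq_fun do rewrite big_nil; rewrite big_nil; exact: cvg_cst.
under eq_fun do rewrite big_cons.
by rewrite big_cons; apply: cvgD.
Qed.

Lemma C1_differentiable u x :
  (\forall y \near x, forall i, derivable u y (e_ i)) ->
  (forall i, {for x, continuous (pd i u)}) ->
  differentiable u x /\ 'd u x = differential_at u x :> (_ -> _).
Proof.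
move=> du cu.
have cl : continuous (differential_at u x).
  move=> y; apply: (@cvg_sumR _ (nbhs y) _ _ _ (fun i v => v 0 i * pd i u x)) => i.
  by apply: cvgM; [exact: coord_continuous | exact: cvg_cst].
apply: (@differentiable_of_linear R 'rV[R]_n R^o u (differential_at u x) x cl).
move=> e e0.
  (* [partial_increment] loses a factor n; dividing by n + 1 also covers n = 0. *)
  have en : 0 < e / n.+1%:R by rewrite divr_gt0.
  have : \forall y \near x, forall i, derivable u y (e_ i) /\
      `|pd i u y - pd i u x| <= e / n.+1%:R.
    near=> y => i; split; first by move: i; near: y.
    move: i; near: y; apply: filter_forall => i.
    move/cvgrPdist_le: (cu i) => /(_ _ en); apply: filterS => y.
    by rewrite distrC.
  move=> /nbhs_ballP [r /= r0 rb].
  apply/nbhs_ballP; exists r => //= h; rewrite -ball_normE /= sub0r normrN => hr.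
  have H y i : `|y - x| < r -> derivable u y (e_ i) /\
      `|pd i u y - pd i u x| <= e / n.+1%:R.
    by move=> yr; apply: rb; rewrite -ball_normE /= distrC.
  have := partial_increment H (y := h + x); rewrite addrK => /(_ hr).
  move=> /le_trans; apply.
  rewrite ler_wpM2r // mulrCA ler_piMr ?(ltW e0) //.
  by rewrite ler_pdivrMr // mul1r ler_nat.
Unshelve. all: by end_near. Qed.

Lemma chain_rule u (c : R -> 'rV[R]_n) t :
  (\forall y \near c t, forall i, derivable u y (e_ i)) ->
  (forall i, {for c t, continuous (pd i u)}) ->
  (forall i, derivable (fun s => c s 0 i) t 1) ->
  is_derive t 1 (u \o c)
    (\sum_i 'D_1 (fun s => c s 0 i) t * pd i u (c t)).
Proof.
move=> du cu dc; have [dif difE] := C1_differentiable du cu.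
have dct : derivable c t 1 by apply/derivable_mxP => i j; rewrite (ord1 i).
have difc : differentiable c t by apply/derivable1_diffP.
have difuc := differentiable_comp difc dif.
apply: DeriveDef; first exact/derivable1_diffP.
rewrite deriveE // diff_comp // difE /differential_at /=; apply: eq_bigr => i _.
by rewrite -deriveE // derive_mx // mxE.
Qed.

End RowVectors.

(** * Symmetry of second partial derivatives *)

Section Schwarz.
Context {R : realType} {n : nat}.
Implicit Types (x y z : 'rV[R]_n) (u v : 'rV[R]_n -> R).
Local Notation e_ i := (delta_mx 0 i : 'rV[R]_n).

Lemma is_derive_translate u a y i : derivable u (a + y) (e_ i) ->
  is_derive y (e_ i) (fun z => u (a + z)) (pd i u (a + y)).
Proof.
move=> du.
suff E : (fun h : R => h^-1 *: (u (a + (h *: e_ i + y)) - u (a + y)))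
    = (fun h => h^-1 *: (u (h *: e_ i + (a + y)) - u (a + y))).
  by apply: DeriveDef; rewrite /derivable /pd /derive /= E.
by apply/funext => h; rewrite addrCA.
Qed.

(** The mean value theorem is used twice: in direction i on the difference of [u] in direction j,
    then in direction j on the partial derivative [pd i u]. *)
Lemma second_difference u x (r h : R) i j : 0 < h -> 2 * h < r ->
  (forall y, `|y - x| < r -> derivable u y (e_ i) /\ derivable (pd i u) y (e_ j)) ->
  exists2 p, `|p - x| <= 2 * h &
    u (h *: e_ i + (h *: e_ j + x)) - u (h *: e_ j + x) - (u (h *: e_ i + x) - u x)
    = h * h * pd j (pd i u) p.
Proof.
move=> h0 hr du.
have near_x (s t : R) : `|s| <= h -> `|t| <= h ->
    `|s *: e_ j + (t *: e_ i + x) - x| <= 2 * h.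
  move=> sh th; rewrite addrA addrK (le_trans (ler_normD _ _)) //.
  by rewrite !norm_delta mulr2n mulrDl mul1r lerD.
have near_x0 (t : R) : `|t| <= h -> `|t *: e_ i + x - x| <= 2 * h.
  by move=> th; have := near_x 0 t; rewrite normr0 scale0r add0r; apply => //; exact: ltW.
have hh : `|h| = h by rewrite gtr0_norm.
pose v y := u (h *: e_ j + y) - u y.
have dv (t : R) : `|t| <= h -> is_derive (t *: e_ i + x) (e_ i) v
    (pd i u (h *: e_ j + (t *: e_ i + x)) - pd i u (t *: e_ i + x)).
  move=> th; apply: is_deriveB.
    apply: is_derive_translate; apply: (du _ _).1.
    by apply: le_lt_trans hr; apply: near_x; rewrite ?hh.
  apply: derivableP; apply: (du _ _).1.
  by apply: le_lt_trans hr; apply: near_x0.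
have [t|t] := @mean_value_line _ _ v x i h; first by rewrite hh => /dv [].
rewrite hh => th E.
have [s|s] := @mean_value_line _ _ (pd i u) (t *: e_ i + x) j h.
  rewrite hh => sh; apply: (du _ _).2.
  by apply: le_lt_trans hr; exact: near_x.
rewrite hh => sh E2.
exists (s *: e_ j + (t *: e_ i + x)); first exact: near_x.
rewrite -mulrA -E2 -(@derive_val _ _ _ _ _ _ _ (dv t th)) -/(pd i v _) -E /v.
by rewrite (addrCA (h *: e_ i)); ring.
Qed.

Lemma schwarz u x i j :
  (\forall y \near x, [/\ derivable u y (e_ i), derivable u y (e_ j),
     derivable (pd i u) y (e_ j) & derivable (pd j u) y (e_ i)]) ->
  {for x, continuous (pd i (pd j u))} -> {for x, continuous (pd j (pd i u))} ->
  pd i (pd j u) x = pd j (pd i u) x.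
Proof.
move=> /nbhs_ballP[r /= r0 rb] cij cji.
have du y : `|y - x| < r -> [/\ derivable u y (e_ i), derivable u y (e_ j),
     derivable (pd i u) y (e_ j) & derivable (pd j u) y (e_ i)].
  by move=> yr; apply: rb; rewrite -ball_normE /= distrC.
apply/eqP; rewrite -subr_eq0 -normr_le0; apply/ler_addgt0Pl => e e0.
rewrite addr0.
have e2 : 0 < e / 2 by rewrite divr_gt0.
move/cvgrPdist_le: cij => /(_ _ e2) /nbhs_ballP[r1 /= r10 rb1].
move/cvgrPdist_le: cji => /(_ _ e2) /nbhs_ballP[r2 /= r20 rb2].
(* The mean value points lie within 2 h of [x], so 2 h must be below all three radii. The second
   difference is symmetric in i and j, so both mixed derivatives, each at its own point, equal its
   quotient by h^2. *)
pose h := Num.min r (Num.min r1 r2) / 4.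
have m0 : 0 < Num.min r (Num.min r1 r2) by rewrite !lt_min r0 r10 r20.
have h0 : 0 < h by rewrite divr_gt0.
have hm : 2 * h < Num.min r (Num.min r1 r2) by rewrite /h; lra.
move: hm; rewrite !lt_min => /and3P[hr hr1 hr2].
have [|p px Ep] := @second_difference u x r h i j h0 hr.
  by move=> y /du[].
have [|q qx Eq] := @second_difference u x r h j i h0 hr.
  by move=> y /du[].
have pq : pd j (pd i u) p = pd i (pd j u) q.
  have hh0 : h * h != 0 by rewrite mulf_neq0 // gt_eqF.
  apply: (mulfI hh0); apply: etrans (esym Ep) (etrans _ Eq).
  by rewrite (addrCA (h *: e_ i)) !opprB addrACA [RHS]addrACA [- _ + - _]addrC.
have /= B1 := rb1 q; have /= B2 := rb2 p.
rewrite -ball_normE /= distrC in B1; rewrite -ball_normE /= distrC in B2.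
have {}B1 := B1 (le_lt_trans qx hr1); have {}B2 := B2 (le_lt_trans px hr2).
rewrite (splitr e) -(subrKA (pd i (pd j u) q)).
apply: (le_trans (ler_normD _ _)); apply: lerD; first exact: B1.
by rewrite -pq distrC; exact: B2.
Qed.

End Schwarz.

(** * Functions of class C^k and their closure properties *)

Section Ck.
Context {R : realType} {n : nat}.
Implicit Types (D : set 'rV[R]_n) (x y z : 'rV[R]_n) (u v : 'rV[R]_n -> R).
Local Notation e_ i := (delta_mx 0 i : 'rV[R]_n).

(** [smooth_on] quantifies over all words of partial derivatives and offers no order to induct on.
    The finite order does: closure under products, inverses and composition goes by induction on
    [k]. *)
Fixpoint Ck (k : nat) D u : Prop :=
  (forall x, D x -> {for x, continuous u}) /\
  if k is k'.+1 then
    (forall x i, D x -> derivable u x (e_ i)) /\ forall i, Ck k' D (pd i u)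
  else True.

Lemma smooth_on_pd D u i : smooth_on D u -> smooth_on D (pd i u).
Proof. by move=> su s x Dx; have := su (rcons s i) x Dx; rewrite foldr_rcons. Qed.

Lemma smooth_Ck D u : smooth_on D u <-> forall k, Ck k D u.
Proof.
split=> [su k|].
  elim: k u su => [|k IH] u su /=; first by split=> // x /(su [::])[].
  split; first by move=> x /(su [::])[].
  split; first by move=> x i /(su [::])[].
  by move=> i; apply/IH/smooth_on_pd.
move=> cu s; elim/last_ind: s u cu => [|s i IH] u cu x Dx.
  by have [c [d _]] := cu 1%N; split; [exact: c|move=> i; exact: d].
rewrite foldr_rcons; apply: IH => // k.
by have [_ [_]] := cu k.+1; exact.
Qed.

Lemma Ck_mono k D u : Ck k.+1 D u -> Ck k D u.
Proof.
elim: k u => [|k IH] u [cu [du pu]]; first by [].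
by split=> //; split=> // i; apply: IH.
Qed.

Lemma near_open D x (P : 'rV[R]_n -> Prop) :
  open D -> D x -> (forall y, D y -> P y) -> \forall y \near x, P y.
Proof. by move=> oD Dx DP; apply: filterS DP _; exact: open_nbhs_nbhs. Qed.

Lemma eq_pd D u v x i : open D -> D x -> (forall y, D y -> u y = v y) ->
  pd i u x = pd i v x.
Proof. by move=> oD Dx uv; apply: near_eq_derive; exact: near_open Dx uv. Qed.

(** The derivative formulas for products, inverses and compositions hold only at points of [D];
    since [D] is open, equality there suffices to transport the class. *)
Lemma eq_Ck k D u v : open D -> (forall y, D y -> u y = v y) ->
  Ck k D u -> Ck k D v.
Proof.
move=> oD.
have cv w w' x : D x -> (forall y, D y -> w y = w' y) ->
    {for x, continuous w} -> {for x, continuous w'}.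
  move=> Dx ww' cw; have N : \forall y \near x, w y = w' y := near_open oD Dx ww'.
  suff: w' @ x --> w' x by [].
  by rewrite -ww' //; apply: cvg_trans cw; exact: near_eq_cvg N.
elim: k u v => [|k IH] u v uv.
  by move=> [cu _]; split=> // x Dx; exact: cv Dx uv (cu x Dx).
move=> [cu [du pu]]; split; last split.
- by move=> x Dx; exact: cv Dx uv (cu x Dx).
- move=> x i Dx; have N : \forall y \near x, u y = v y := near_open oD Dx uv.
  exact: near_eq_derivable N (du x i Dx).
- move=> i; apply: IH (pu i) => y Dy; exact: (eq_pd i oD Dy uv).
Qed.

Lemma eq_smooth D u v : open D -> (forall y, D y -> u y = v y) ->
  smooth_on D u -> smooth_on D v.
Proof. by move=> oD uv /smooth_Ck su; apply/smooth_Ck => k; exact: eq_Ck uv (su k). Qed.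

Lemma pd_cst a i : pd i (cst a : 'rV[R]_n -> R) = cst 0.
Proof. by apply/funext => x; rewrite /pd derive_cst. Qed.

Lemma Ck_cst k D a : Ck k D (cst a).
Proof.
elim: k a => [|k IH] a; first by split=> // x _; exact: cst_continuous.
split; first by move=> x _; exact: cst_continuous.
by split=> [x i _|i]; [exact: derivable_cst | rewrite pd_cst].
Qed.

Lemma CkD k D u v : open D -> Ck k D u -> Ck k D v -> Ck k D (u \+ v).
Proof.
move=> oD; elim: k u v => [|k IH] u v [cu +] [cv +].
  by split=> // x Dx; exact: continuousD (cu x Dx) (cv x Dx).
move=> [du pu] [dv pv]; split; last split.
- by move=> x Dx; exact: continuousD (cu x Dx) (cv x Dx).
- by move=> x i Dx; apply: derivableD; [exact: du|exact: dv].
- move=> i; apply: eq_Ck oD _ (IH _ _ (pu i) (pv i)) => y Dy.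
  by rewrite /pd deriveD //; [exact: du|exact: dv].
Qed.

Lemma CkM k D u v : open D -> Ck k D u -> Ck k D v -> Ck k D (u \* v).
Proof.
move=> oD; elim: k u v => [|k IH] u v.
  move=> [cu _] [cv _].
  by split=> // x Dx; exact: continuousM (cu x Dx) (cv x Dx).
move=> Cu Cv; have [cu [du pu]] := Cu; have [cv [dv pv]] := Cv.
have Cu' := Ck_mono Cu; have Cv' := Ck_mono Cv.
split; last split.
- by move=> x Dx; exact: continuousM (cu x Dx) (cv x Dx).
- by move=> x i Dx; apply: derivableM; [exact: du|exact: dv].
- move=> i; apply: eq_Ck oD _ (CkD oD (IH _ _ Cu' (pv i)) (IH _ _ (pu i) Cv')).
  move=> y Dy; rewrite /pd deriveM; [|exact: du|exact: dv].
  by rewrite /GRing.scale /= [v y * _]mulrC.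
Qed.

Lemma CkV k D u : open D -> (forall x, D x -> u x != 0) ->
  Ck k D u -> Ck k D (fun x => (u x)^-1).
Proof.
move=> oD u0; elim: k => [|k IH] Cu.
  by split=> // x Dx; exact: continuousV (u0 x Dx) (Cu.1 x Dx).
have [cu [du pu]] := Cu; have Cv := IH (Ck_mono Cu).
split; last split.
- by move=> x Dx; exact: continuousV (u0 x Dx) (cu x Dx).
- by move=> x i Dx; apply: derivableV; [exact: u0|exact: du].
- move=> i.
  have C := CkM oD (Ck_cst k D (-1)) (CkM oD (CkM oD Cv Cv) (pu i)).
  apply: eq_Ck oD _ C => y Dy.
  rewrite /pd deriveV; [|exact: u0|exact: du].
  by rewrite /GRing.scale /= -exprVn expr2; ring.
Qed.

End Ck.

Lemma cvg_rV (R : realType) (p : nat) (T : Type) (F : set_system T)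
    {FF : Filter F} (f : T -> 'rV[R]_p) (l : 'rV[R]_p) :
  (forall b, f t 0 b @[t --> F] --> l 0 b) -> f t @[t --> F] --> l.
Proof.
move=> fl; apply/cvgrPdist_le => e e0; near=> t.
apply: rV_norm_le => [|b]; first exact: ltW.
rewrite !mxE; move: b; near: t; apply: filter_forall => b.
by move/cvgrPdist_le: (fl b) => /(_ _ e0).
Unshelve. all: by end_near. Qed.

(** * Chain rule and composition of smooth maps *)

Section CkComp.
Context {R : realType} {n p : nat}.
Implicit Types (D : set 'rV[R]_n) (E : set 'rV[R]_p).
Variable T : 'rV[R]_n -> 'rV[R]_p.

Lemma rV_continuous x : (forall b, {for x, continuous (fun y => T y 0 b)}) ->
  {for x, continuous T}.
Proof. by move=> cT; exact: (@cvg_rV _ _ _ (nbhs x)). Qed.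

Lemma Ck_differentiable E u y : open E -> Ck 1 E u -> E y ->
  (\forall y \near y, forall i, derivable u y (delta_mx 0 i)) /\
  (forall i, {for y, continuous (pd i u)}).
Proof.
move=> oE [_ [du pu]] Ey; split; last by move=> i; apply: (pu i).1.
by apply: (near_open oE Ey) => z Ez i; exact: du.
Qed.

Lemma is_derive_comp E u x i : open E -> Ck 1 E u -> E (T x) ->
  (forall b, derivable (fun y => T y 0 b) x (delta_mx 0 i)) ->
  is_derive x (delta_mx 0 i) (u \o T)
    (\sum_b pd i (fun y => T y 0 b) x * pd b u (T x)).
Proof.
move=> oE Cu Ex dT.
pose c (h : R) := T (h *: delta_mx 0 i + x).
have c0 : c 0 = T x by rewrite /c scale0r add0r.
have dc b : is_derive (0 : R) 1 (fun h => c h 0 b) (pd i (fun y => T y 0 b) x).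
  have := @is_derive_line R n (fun y => T y 0 b) x i 0.
  by rewrite scale0r add0r; apply.
have [|Hn Hc] := @Ck_differentiable E u (c 0) oE Cu; first by rewrite c0.
have := @chain_rule R p u c 0 Hn Hc (fun b => @ex_derive _ _ _ _ _ _ _ (dc b)).
have dE : \sum_b 'D_1 (fun h => c h 0 b) 0 * pd b u (c 0) =
    \sum_b pd i (fun y => T y 0 b) x * pd b u (T x).
  by apply: eq_bigr => b _; rewrite c0 (@derive_val _ _ _ _ _ _ _ (dc b)).
have E' : (fun h : R => h^-1 *: ((u \o T) (h *: delta_mx 0 i + x) - (u \o T) x))
   = (fun h => h^-1 *: ((u \o c) (h *: 1 + 0) - (u \o c) 0)).
  by apply/funext => h; rewrite /= /c addr0 scale0r add0r [_%:A]mulr1.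
rewrite dE => -[H1 H2].
by apply: DeriveDef; [rewrite /derivable E' | rewrite /derive E'].
Qed.

Lemma Ck_comp k D E u : open D -> open E -> (forall x, D x -> E (T x)) ->
  (forall b, Ck k D (fun y => T y 0 b)) -> Ck k E u -> Ck k D (u \o T).
Proof.
move=> oD oE DE; elim: k u => [|k IH] u CT Cu.
  split=> // x Dx; apply: continuous_comp; last by apply: Cu.1; exact: DE.
  by apply: rV_continuous => b; apply: (CT b).1.
have [cu [du pu]] := Cu.
have C1u : Ck 1 E u.
  by split=> //; split=> // i; split=> //; case: k {IH CT Cu} pu => [|k] pu; exact: (pu i).1.
have dcomp x i : D x -> is_derive x (delta_mx 0 i) (u \o T)
    (\sum_b pd i (fun y => T y 0 b) x * pd b u (T x)).
  move=> Dx; apply: (is_derive_comp oE C1u (DE _ Dx)) => b.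
  exact: (CT b).2.1.
split; last split.
- move=> x Dx; apply: continuous_comp; last by apply: cu; exact: DE.
  by apply: rV_continuous => b; apply: (CT b).1.
- by move=> x i /(dcomp x i)[].
- move=> i.
  suff C : Ck k D (fun x => \sum_b pd i (fun y => T y 0 b) x * pd b u (T x)).
    apply: eq_Ck oD _ C => y Dy; rewrite /pd.
    by rewrite (@derive_val _ _ _ _ _ _ _ (dcomp y i Dy)).
  have -> : (fun x => \sum_b pd i (fun y => T y 0 b) x * pd b u (T x)) =
     \sum_b ((pd i (fun y => T y 0 b)) \* (pd b u \o T)).
    by apply/funext => x; rewrite fct_sumE.
  elim/big_ind: _ => [|v w Cv Cw|b _].
  + exact: (Ck_cst k D 0).
  + exact: CkD.
  + apply: CkM => //; first exact: (CT b).2.2.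
    by apply: IH (pu b) => a; exact: Ck_mono.
Qed.

End CkComp.

(** * The ring of smooth functions on an open set *)

Section SmoothOn.
Context {R : realType} {n : nat}.
Implicit Types (D : set 'rV[R]_n) (u v : 'rV[R]_n -> R).

Lemma smooth_cst D a : smooth_on D (cst a).
Proof. by apply/smooth_Ck => k; exact: Ck_cst. Qed.

Arguments smooth_cst D a : clear implicits.
Lemma smoothD D u v : open D -> smooth_on D u -> smooth_on D v ->
  smooth_on D (u \+ v).
Proof.
by move=> oD /smooth_Ck su /smooth_Ck sv; apply/smooth_Ck => k; exact: CkD.
Qed.

Lemma smoothM D u v : open D -> smooth_on D u -> smooth_on D v ->
  smooth_on D (u \* v).
Proof.
by move=> oD /smooth_Ck su /smooth_Ck sv; apply/smooth_Ck => k; exact: CkM.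
Qed.

Lemma smoothN D u : open D -> smooth_on D u -> smooth_on D (fun x => - u x).
Proof.
move=> oD su; have H := smoothM oD (smooth_cst D (-1)) su.
by refine (eq_smooth oD _ H) => x _; rewrite /= mulN1r.
Qed.

Lemma smoothV D u : open D -> (forall x, D x -> u x != 0) -> smooth_on D u ->
  smooth_on D (fun x => (u x)^-1).
Proof. by move=> oD u0 /smooth_Ck su; apply/smooth_Ck => k; exact: CkV. Qed.

Lemma pd_coord i j : pd i (fun y : 'rV[R]_n => y 0 j) = cst ((i == j)%:R).
Proof.
apply/funext => x; rewrite /pd /derive.
have N : \forall h \near (0 : R)^',
    (i == j)%:R = h^-1 *: ((h *: delta_mx 0 i + x) 0 j - x 0 j) :> R.
  near=> h; rewrite !mxE eqxx /= addrK eq_sym /GRing.scale /= mulKf //.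
  by near: h; exact: nbhs_dnbhs_neq.
by apply: cvg_lim => //; apply: cvg_trans (near_eq_cvg N) (cvg_cst _).
Unshelve. all: by end_near. Qed.

Lemma derivable_coord i j x :
  derivable (fun y : 'rV[R]_n => y 0 j) x (delta_mx 0 i).
Proof. exact/diff_derivable/differentiable_coord. Qed.

Lemma smooth_coord D j : smooth_on D (fun y => y 0 j).
Proof.
apply/smooth_Ck; case=> [|k].
  by split=> // x _; exact: coord_continuous.
split; first by move=> x _; exact: coord_continuous.
by split=> [x i _|i]; [exact: derivable_coord | rewrite pd_coord; exact: Ck_cst].
Qed.

Lemma smooth_pdC D u i j x : open D -> smooth_on D u -> D x ->
  pd i (pd j u) x = pd j (pd i u) x.
Proof.
move=> oD su Dx; apply: schwarz; last 2 first.
- exact: (su [:: i; j] x Dx).1.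
- exact: (su [:: j; i] x Dx).1.
apply: (near_open oD Dx) => y Dy.
have [_ d0] := su [::] y Dy; have [_ di] := su [:: i] y Dy.
by have [_ dj] := su [:: j] y Dy; split.
Qed.

End SmoothOn.

Arguments smooth_cst {R n} D a.

Lemma smooth_comp (R : realType) (n p : nat) (T : 'rV[R]_n -> 'rV[R]_p) D E u :
  open D -> open E -> (forall x, D x -> E (T x)) ->
  (forall b, smooth_on D (fun y => T y 0 b)) -> smooth_on E u ->
  smooth_on D (u \o T).
Proof.
move=> oD oE DE sT /smooth_Ck su; apply/smooth_Ck => k.
by apply: (Ck_comp oD oE DE) => // b; move/smooth_Ck: (sT b).
Qed.

(* The point [dom_pt] makes the ring of functions on the domain nontrivial. *)
Record domain (R : realType) (n : nat) := Domain {
  dom_set :> set 'rV[R]_n;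
  dom_open : open dom_set;
  dom_pt : 'rV[R]_n;
  dom_ptP : dom_set dom_pt }.

(* Smooth functions on an open set, extended by 0 so that Leibniz equality is
   equality on the set. *)
Record sfun (R : realType) (n : nat) (D : domain R n) := SFun {
  sfun_val :> 'rV[R]_n -> R;
  sfun_smooth : smooth_on (dom_set D) sfun_val;
  sfun_out : forall x, ~ dom_set D x -> sfun_val x = 0 }.

Section SmoothRing.
Context {R : realType} {n : nat} (dom : domain R n).
Local Notation D := (dom_set dom).
Implicit Types a b : sfun dom.

Lemma sfun_eq a b : (forall x, D x -> a x = b x) -> a = b.
Proof.
case: a => u su ou; case: b => v sv ov /= uv.
suff E : u = v.
  by case: v / E sv ov {uv} => sv ov; congr SFun; exact: Prop_irrelevance.
apply/funext => x; have [/uv//|Dx] := pselect (D x).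
by rewrite ou // ov.
Qed.

Definition restr (u : 'rV[R]_n -> R) x : R := if `[< D x >] then u x else 0.

Lemma restrE u x : D x -> restr u x = u x.
Proof. by move=> Dx; rewrite /restr asboolT. Qed.

Lemma restr_out u x : ~ D x -> restr u x = 0.
Proof. by move=> Dx; rewrite /restr asboolF. Qed.

Lemma restr_smooth u : smooth_on D u -> smooth_on D (restr u).
Proof.
move=> su; refine (eq_smooth (@dom_open _ _ dom) _ su) => x Dx.
by rewrite restrE.
Qed.

Definition mks u (su : smooth_on D u) : sfun dom :=
  SFun (restr_smooth su) (@restr_out u).

Lemma mksE u (su : smooth_on D u) x : D x -> mks su x = u x.
Proof. exact: restrE. Qed.

HB.instance Definition _ := gen_eqMixin (sfun dom).
HB.instance Definition _ := gen_choiceMixin (sfun dom).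

Let oD : open D := @dom_open _ _ dom.

Definition szero : sfun dom := mks (smooth_cst D 0).
Definition sone : sfun dom := mks (smooth_cst D 1).
Definition sadd a b : sfun dom := mks (smoothD oD (sfun_smooth a) (sfun_smooth b)).
Definition sopp a : sfun dom := mks (smoothN oD (sfun_smooth a)).
Definition smul a b : sfun dom := mks (smoothM oD (sfun_smooth a) (sfun_smooth b)).

Let szeroE x : D x -> szero x = 0. Proof. exact: mksE. Qed.
Let soneE x : D x -> sone x = 1. Proof. exact: mksE. Qed.
Let saddE a b x : D x -> sadd a b x = a x + b x. Proof. exact: mksE. Qed.
Let soppE a x : D x -> sopp a x = - a x. Proof. exact: mksE. Qed.
Let smulE a b x : D x -> smul a b x = a x * b x. Proof. exact: mksE. Qed.

Lemma saddA : associative sadd.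
Proof. by move=> a b c; apply: sfun_eq => x Dx; rewrite !saddE // addrA. Qed.
Lemma saddC : commutative sadd.
Proof. by move=> a b; apply: sfun_eq => x Dx; rewrite !saddE // addrC. Qed.
Lemma sadd0 : left_id szero sadd.
Proof. by move=> a; apply: sfun_eq => x Dx; rewrite saddE // szeroE // add0r. Qed.
Lemma saddN : left_inverse szero sopp sadd.
Proof.
move=> a; apply: sfun_eq => x Dx.
by rewrite saddE // soppE // szeroE // addNr.
Qed.

HB.instance Definition _ := GRing.isZmodule.Build (sfun dom) saddA saddC sadd0 saddN.

Lemma smulA : associative smul.
Proof. by move=> a b c; apply: sfun_eq => x Dx; rewrite !smulE // mulrA. Qed.
Lemma smulC : commutative smul.
Proof. by move=> a b; apply: sfun_eq => x Dx; rewrite !smulE // mulrC. Qed.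
Lemma smul1 : left_id sone smul.
Proof. by move=> a; apply: sfun_eq => x Dx; rewrite smulE // soneE // mul1r. Qed.
Lemma smulDl : left_distributive smul sadd.
Proof.
move=> a b c; apply: sfun_eq => x Dx.
by rewrite smulE // !saddE // !smulE // mulrDl.
Qed.
Lemma sone_neq0 : sone != szero.
Proof.
apply/eqP => /(congr1 (fun a : sfun dom => a (dom_pt dom))).
have Dp := @dom_ptP _ _ dom.
by rewrite soneE // szeroE // => /eqP; rewrite oner_eq0.
Qed.

HB.instance Definition _ := GRing.Zmodule_isComNzRing.Build (sfun dom)
  smulA smulC smul1 smulDl sone_neq0.

Definition ev x (Dx : D x) a : R := a x.

Lemma ev_additive x (Dx : D x) : additive (ev Dx).
Proof. by move=> a b; rewrite /ev saddE // soppE. Qed.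

HB.instance Definition _ x (Dx : D x) :=
  GRing.isZmodMorphism.Build (sfun dom) R (ev Dx) (ev_additive Dx).

Lemma ev_monoid x (Dx : D x) : monoid_morphism (ev Dx).
Proof.
split; first by rewrite /ev soneE.
by move=> a b; rewrite /ev smulE.
Qed.

HB.instance Definition _ x (Dx : D x) :=
  GRing.isMonoidMorphism.Build (sfun dom) R (ev Dx) (ev_monoid Dx).

Definition sder (i : 'I_n) a : sfun dom := mks (smooth_on_pd i (sfun_smooth a)).

Lemma sderE i a x : D x -> sder i a x = pd i a x.
Proof. exact: mksE. Qed.

Lemma sfunDE a b x : D x -> (a + b) x = a x + b x.
Proof. exact: saddE. Qed.

Lemma sfunBE a b x : D x -> (a - b) x = a x - b x.
Proof. by move=> Dx; rewrite -/(ev Dx _) raddfB. Qed.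

Lemma sfun_sumE x (I : Type) (r : seq I) (P : pred I) (F : I -> sfun dom) : D x ->
  (\sum_(i <- r | P i) F i) x = \sum_(i <- r | P i) F i x.
Proof. by move=> Dx; exact: (raddf_sum (ev Dx)). Qed.

Lemma sfunME a b x : D x -> (a * b) x = a x * b x.
Proof. exact: smulE. Qed.

Lemma sfun1E x : D x -> (1 : sfun dom) x = 1.
Proof. exact: soneE. Qed.

Lemma sfun_derivable a x i : D x -> derivable a x (delta_mx 0 i).
Proof. by move=> Dx; exact: (@sfun_smooth _ _ _ a [::] x Dx).2. Qed.

Lemma sder_derivation i : derivation (sder i).
Proof.
split=> a b; apply: sfun_eq => x Dx.
  rewrite sfunDE // !sderE // (eq_pd i oD Dx (@sfunDE a b)).
  by rewrite /pd deriveD //; exact: sfun_derivable.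
rewrite sfunDE // !sfunME // !sderE // (eq_pd i oD Dx (@sfunME a b)).
rewrite /pd deriveM; [|exact: sfun_derivable..].
by rewrite addrC [b x *: _]mulrC.
Qed.

Lemma sderC i j a : sder i (sder j a) = sder j (sder i a).
Proof.
apply: sfun_eq => x Dx.
have E k l : sder k (sder l a) x = pd k (pd l a) x.
  exact: etrans (sderE k (sder l a) Dx) (eq_pd k oD Dx (@sderE l a)).
refine (etrans (E i j) (etrans _ (esym (E j i)))).
exact: (smooth_pdC i j oD (sfun_smooth a) Dx).
Qed.

Definition shalf : sfun dom := mks (smooth_cst D 2^-1).

Lemma shalf2 : shalf + shalf = 1.
Proof.
apply: sfun_eq => x Dx; rewrite sfunDE // mksE //.
by rewrite sfun1E // /cst -mulr2n -[2^-1 *+ 2]mulr_natl divff.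
Qed.

Lemma sfun_inv a : (forall x, D x -> a x != 0) -> {b | a * b = 1}.
Proof.
move=> a0; exists (mks (smoothV oD a0 (sfun_smooth a))).
apply: sfun_eq => x Dx; rewrite sfunME // mksE // divff ?a0 //.
by rewrite sfun1E.
Qed.

End SmoothRing.

Arguments mks {R n dom u} su.

Record smap (R : realType) (n p : nat) (D : domain R n) (E : domain R p) := SMap {
  smap_fun :> 'rV[R]_n -> 'rV[R]_p;
  smap_smooth : forall b, smooth_on (dom_set D) (fun y => smap_fun y 0 b);
  smap_in : forall x, dom_set D x -> dom_set E (smap_fun x) }.

(** * Pullback of smooth functions along smooth maps *)

Section Pullback.
Context {R : realType} {n p : nat} {D : domain R n} {E : domain R p}.
Variable T : smap D E.
Implicit Types a b : sfun E.

Definition pull a : sfun D :=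
  mks (smooth_comp (@dom_open _ _ D) (@dom_open _ _ E) (@smap_in _ _ _ _ _ T)
         (@smap_smooth _ _ _ _ _ T) (sfun_smooth a)).

Lemma pullE a x : dom_set D x -> pull a x = a (T x).
Proof. exact: mksE. Qed.

Lemma pull_additive : additive pull.
Proof.
move=> a b; apply: sfun_eq => x Dx; have Ex := @smap_in _ _ _ _ _ T x Dx.
by rewrite pullE // !sfunBE // !pullE.
Qed.

HB.instance Definition _ :=
  GRing.isZmodMorphism.Build (sfun E) (sfun D) pull pull_additive.

Lemma pull_monoid : monoid_morphism pull.
Proof.
split=> [|a b]; apply: sfun_eq => x Dx; have Ex := @smap_in _ _ _ _ _ T x Dx.
  by rewrite pullE // !sfun1E.
by rewrite pullE // !sfunME // !pullE.
Qed.

HB.instance Definition _ :=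
  GRing.isMonoidMorphism.Build (sfun E) (sfun D) pull pull_monoid.

Definition smap_coord (b : 'I_p) : sfun D := mks (@smap_smooth _ _ _ _ _ T b).

Lemma pull_shalf : pull (shalf E) = shalf D.
Proof.
apply: sfun_eq => x Dx; rewrite pullE // !mksE //.
exact: (@smap_in _ _ _ _ _ T).
Qed.

Lemma sder_pull i a :
  sder i (pull a) = \sum_b sder i (smap_coord b) * pull (sder b a).
Proof.
apply: sfun_eq => x Dx; have Ex := @smap_in _ _ _ _ _ T x Dx.
have oD := @dom_open _ _ D; have oE := @dom_open _ _ E.
have C1 : Ck 1 (dom_set E) a by have /smooth_Ck := sfun_smooth a; exact.
have dT (b : 'I_p) : derivable (fun y => T y 0 b) x (delta_mx 0 i).
  exact: (@smap_smooth _ _ _ _ _ T b [::] x Dx).2.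
have dc := is_derive_comp oE C1 Ex dT.
refine (etrans (sderE i (pull a) Dx) _).
refine (etrans (eq_pd i oD Dx (@pullE a)) _).
refine (etrans (@derive_val _ _ _ _ _ _ _ dc) _).
rewrite sfun_sumE //; apply: eq_bigr => b _.
refine (etrans _ (esym (sfunME _ _ Dx))); congr (_ * _).
  exact: esym (etrans (sderE i (smap_coord b) Dx)
    (eq_pd i oD Dx (@mksE _ _ _ _ (@smap_smooth _ _ _ _ _ T b)))).
exact: esym (etrans (pullE (sder b a) Dx) (sderE b a Ex)).
Qed.

End Pullback.

(** * Product domains and functions lifted from the factors *)

Section ProductDomain.
Context {R : realType} {n m : nat} (D : domain R n) (E : domain R m).

Definition prod_set : set 'rV[R]_(n + m) :=
  [set x | dom_set D (lsubmx x) /\ dom_set E (rsubmx x)].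

Lemma lsubmx_continuous : continuous (@lsubmx R 1 n m).
Proof.
move=> x; apply: (@cvg_rV _ _ _ (nbhs x)) => b.
under eq_fun do rewrite mxE; rewrite mxE; exact: coord_continuous.
Qed.

Lemma rsubmx_continuous : continuous (@rsubmx R 1 n m).
Proof.
move=> x; apply: (@cvg_rV _ _ _ (nbhs x)) => b.
under eq_fun do rewrite mxE; rewrite mxE; exact: coord_continuous.
Qed.

Lemma prod_set_open : open prod_set.
Proof.
apply: openI.
  by apply: open_comp; [move=> x _; exact: lsubmx_continuous | exact: dom_open].
by apply: open_comp; [move=> x _; exact: rsubmx_continuous | exact: dom_open].
Qed.

Lemma prod_pt : prod_set (row_mx (dom_pt D) (dom_pt E)).
Proof. by rewrite /prod_set /= row_mxKl row_mxKr; split; exact: dom_ptP. Qed.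

Definition prod_dom : domain R (n + m) := Domain prod_set_open prod_pt.

Lemma projl_smooth b : smooth_on prod_set (fun y => lsubmx y 0 b).
Proof.
have -> : (fun y : 'rV[R]_(n + m) => lsubmx y 0 b) = (fun y => y 0 (lshift m b)).
  by apply/funext => y; rewrite mxE.
exact: smooth_coord.
Qed.

Lemma projr_smooth b : smooth_on prod_set (fun y => rsubmx y 0 b).
Proof.
have -> : (fun y : 'rV[R]_(n + m) => rsubmx y 0 b) = (fun y => y 0 (rshift n b)).
  by apply/funext => y; rewrite mxE.
exact: smooth_coord.
Qed.

Definition projl : smap prod_dom D :=
  @SMap _ _ _ prod_dom D (@lsubmx R 1 n m) projl_smooth (fun x xP => xP.1).

Definition projr : smap prod_dom E :=
  @SMap _ _ _ prod_dom E (@rsubmx R 1 n m) projr_smooth (fun x xP => xP.2).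

Let sder_coord i (p : nat) (F : domain R p) (T : smap prod_dom F) b j :
  (forall y, T y 0 b = y 0 j) -> sder i (smap_coord T b) = (i == j)%:R.
Proof.
move=> Tj; apply: sfun_eq => x Dx.
refine (etrans (sderE i _ Dx) _).
refine (etrans (eq_pd i (@dom_open _ _ prod_dom) Dx
  (@mksE _ _ _ _ (@smap_smooth _ _ _ _ _ T b))) _).
have -> : (fun y => T y 0 b) = (fun y : 'rV[R]_(n + m) => y 0 j) by exact/funext.
by rewrite pd_coord /= -/(ev Dx _) rmorph_nat.
Qed.

Let delta_sum (p : nat) (F : 'I_p -> sfun prod_dom) j :
  \sum_b (j == b)%:R * F b = F j.
Proof.
rewrite (bigD1 j) //= eqxx mul1r big1 ?addr0 // => b bj.
by rewrite eq_sym (negPf bj) mul0r.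
Qed.

Lemma sder_projl_l i a : sder (lshift m i) (pull projl a) = pull projl (sder i a).
Proof.
rewrite sder_pull -[RHS](delta_sum (fun b => pull projl (sder b a))).
apply: eq_bigr => b _; rewrite (@sder_coord _ _ _ projl b (lshift m b)).
  by rewrite eq_lshift.
by move=> y; rewrite mxE.
Qed.

Lemma sder_projl_r i a : sder (rshift n i) (pull projl a) = 0.
Proof.
rewrite sder_pull big1 // => b _; rewrite (@sder_coord _ _ _ projl b (lshift m b)).
  by rewrite eq_rlshift mul0r.
by move=> y; rewrite mxE.
Qed.

Lemma sder_projr_r i a : sder (rshift n i) (pull projr a) = pull projr (sder i a).
Proof.
rewrite sder_pull -[RHS](delta_sum (fun b => pull projr (sder b a))).
apply: eq_bigr => b _; rewrite (@sder_coord _ _ _ projr b (rshift n b)).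
  by rewrite eq_rshift.
by move=> y; rewrite mxE.
Qed.

Lemma sder_projr_l i a : sder (lshift m i) (pull projr a) = 0.
Proof.
rewrite sder_pull big1 // => b _; rewrite (@sder_coord _ _ _ projr b (rshift n b)).
  by rewrite eq_lrshift mul0r.
by move=> y; rewrite mxE.
Qed.

End ProductDomain.

(** * Pointwise values of the ring-level tensors *)

Section Translation.
Context {R : realType} {n : nat} (D : domain R n).
Variables (G : 'rV[R]_n -> 'M[R]_n) (SG SH : 'M[sfun D]_n).
Local Notation DD := (dom_set D).
Hypothesis SGE : forall x, DD x -> forall i j, SG i j x = G x i j.
Hypothesis SHE : forall x, DD x -> forall i j, SH i j x = invmx (G x) i j.
Let oD : open DD := @dom_open _ _ D.

Local Notation dS := (@sder R n D).
Local Notation GmS := (Gam (shalf D) dS SG SH).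

Lemma sder_val i (a : sfun D) u x : (forall y, DD y -> a y = u y) -> DD x ->
  sder i a x = pd i u x.
Proof. by move=> au Dx; exact: etrans (sderE i a Dx) (eq_pd i oD Dx au). Qed.

Lemma christoffel_val k i j x : DD x -> GmS i k j x = christoffel G k i j x.
Proof.
move=> Dx; rewrite mxE sfunME // mksE //; congr (_ * _).
rewrite sfun_sumE //; apply: eq_bigr => l _.
rewrite sfunME // sfunBE // sfunDE // SHE //.
have dG a b c : sder a (SG b c) x = pd a (fun y => G y b c) x.
  by apply: sder_val => // y Dy; exact: SGE.
by rewrite !dG.
Qed.

Lemma riemann_val l i j k x : DD x ->
  curv (shalf D) dS SG SH i j l k x = riemann G l i j k x.
Proof.
move=> Dx; rewrite curv_entry; refine (etrans (sfunDE _ _ Dx) _).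
rewrite (sfunBE _ _ Dx) (sfun_sumE _ _ _ Dx).
have dGm a b c d : sder a (GmS b c d) x = pd a (christoffel G c b d) x.
  by apply: sder_val => // y Dy; exact: christoffel_val.
rewrite /riemann; congr (_ - _ + _); [exact: dGm | exact: dGm |].
apply: eq_bigr => p _; refine (etrans (sfunBE _ _ Dx) _).
by congr (_ - _); refine (etrans (sfunME _ _ Dx) _); congr (_ * _);
  exact: christoffel_val.
Qed.

Lemma ricci_val x (Dx : DD x) :
  ricci G x = map_mx (ev Dx) (ric (shalf D) dS SG SH).
Proof.
apply/matrixP => j k; rewrite !mxE /ev (sfun_sumE _ _ _ Dx); apply: eq_bigr => i _.
exact: esym (riemann_val i i j k Dx).
Qed.

Section Fun.
Variables (u v : 'rV[R]_n -> R) (U V : sfun D).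
Hypotheses (uU : forall x, DD x -> U x = u x) (vV : forall x, DD x -> V x = v x).

Lemma hessian_val x (Dx : DD x) :
  hessian G u x = map_mx (ev Dx) (hess (shalf D) dS SG SH U).
Proof.
apply/matrixP => i j; rewrite [RHS]mxE hessE mxE.
rewrite /ev (sfunBE _ _ Dx) (sfun_sumE _ _ _ Dx); congr (_ - _).
  by symmetry; apply: (sder_val _ _ Dx) => y Dy; exact: (sder_val _ uU Dy).
apply: eq_bigr => k _; rewrite (sfunME _ _ Dx); congr (_ * _); symmetry.
  exact: christoffel_val.
exact: (sder_val _ uU Dx).
Qed.

Lemma SH_val x (Dx : DD x) : invmx (G x) = map_mx (ev Dx) SH.
Proof. by apply/matrixP => i j; rewrite [RHS]mxE /ev SHE. Qed.

Lemma laplacian_val x : DD x -> lap (shalf D) dS SG SH U x = laplacian G u x.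
Proof.
move=> Dx; rewrite /laplacian (SH_val Dx) (hessian_val Dx) -map_mxM.
by rewrite trace_map_mx.
Qed.

Lemma grad_dot_val x : DD x -> gdot dS SH U V x = grad_dot G u v x.
Proof.
move=> Dx; rewrite (sfun_sumE _ _ _ Dx); apply: eq_bigr => i _.
rewrite (sfun_sumE _ _ _ Dx); apply: eq_bigr => j _.
rewrite !(sfunME _ _ Dx) (SHE Dx); congr (_ * _ * _).
  exact: (sder_val _ uU Dx).
exact: (sder_val _ vV Dx).
Qed.

End Fun.

End Translation.

(** Cramer's rule shows that the inverse metric has smooth entries: the determinant vanishes
    nowhere, so it is a unit of the ring of smooth functions. *)
Lemma metric_ring (R : realType) (n : nat) (D : domain R n)
    (G : 'rV[R]_n -> 'M[R]_n) :
  (forall i j, smooth_on (dom_set D) (fun x => G x i j)) ->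
  (forall x, dom_set D x -> (G x)^T = G x) ->
  (forall x, dom_set D x -> G x \in unitmx) ->
  exists SG SH : 'M[sfun D]_n,
  [/\ forall x, dom_set D x -> forall i j, SG i j x = G x i j,
      forall x, dom_set D x -> forall i j, SH i j x = invmx (G x) i j,
      SG^T = SG & SG *m SH = 1%:M].
Proof.
move=> sG GT Gu; pose SG : 'M[sfun D]_n := \matrix_(i, j) mks (sG i j).
have SGE x (Dx : dom_set D x) i j : SG i j x = G x i j.
  by rewrite /SG mxE mksE.
have SGm x (Dx : dom_set D x) : map_mx (ev Dx) SG = G x.
  by apply/matrixP => i j; rewrite mxE /ev SGE.
have [x Dx|b bP] := @sfun_inv _ _ D (\det SG).
  by rewrite -/(ev Dx _) -det_map_mx SGm -unitfE -unitmxE; exact: Gu.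
have SGSH : SG *m (b *: \adj SG) = 1%:M.
  by rewrite -scalemxAr mul_mx_adj scale_scalar_mx mulrC bP.
exists SG, (b *: \adj SG); split=> //.
  move=> x Dx i j; have := congr1 (map_mx (ev Dx)) SGSH.
  rewrite map_mxM SGm map_mx1 => /(congr1 (mulmx (invmx (G x)))).
  rewrite mulmxA mulVmx ?Gu // mul1mx mulmx1 => /matrixP/(_ i j) <-.
  by rewrite [RHS]mxE.
apply/matrixP => i j; apply: sfun_eq => x Dx.
by rewrite mxE !SGE // -[in RHS](GT x Dx) mxE.
Qed.

(** * The warping constant *)

Lemma posdef_unitmx (R : realType) (n : nat) (G : 'M[R]_n) :
  (forall v : 'rV[R]_n, v != 0 -> 0 < (v *m G *m v^T) 0 0) -> G \in unitmx.
Proof.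
move=> Gpos; rewrite unitmxE unitfE; apply/negP => /det0P[v v0 vG].
by have := Gpos v v0; rewrite vG mul0mx mxE ltxx.
Qed.

(** * Laplacian and gradient products on the overlap of two charts *)

Section ChartTransition.
Context {R : realType} {n : nat} {Di Dj O : domain R n}.
Variables (r : smap O Di) (T : smap O Dj).
Hypothesis rE : forall x, r x = x.
Variables (Gi Hi : 'M[sfun Di]_n) (Gj Hj : 'M[sfun Dj]_n).
Hypotheses (GiT : Gi^T = Gi) (GHi : Gi *m Hi = 1%:M).
Hypotheses (GjT : Gj^T = Gj) (GHj : Gj *m Hj = 1%:M).

Let J : 'M[sfun O]_n := \matrix_(a, b) sder a (smap_coord T b).
Hypothesis GJ : map_mx (pull r) Gi = J *m map_mx (pull T) Gj *m J^T.

Local Notation Gi' := (map_mx (pull r) Gi).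
Local Notation Hi' := (map_mx (pull r) Hi).
Local Notation Gj' := (map_mx (pull T) Gj).
Local Notation Hj' := (map_mx (pull T) Hj).
(** The inverse Jacobian is read off from the transformation law [GJ] of the metric, rather than
    obtained by differentiating the reverse transition. *)
Let Ji := Gj' *m J^T *m Hi'.

Let GHi' : Gi' *m Hi' = 1%:M. Proof. by rewrite -map_mxM GHi map_mx1. Qed.
Let GHj' : Gj' *m Hj' = 1%:M. Proof. by rewrite -map_mxM GHj map_mx1. Qed.
Let JJi : J *m Ji = 1%:M. Proof. by rewrite /Ji !mulmxA -GJ GHi'. Qed.

(** By the chain rule, these are the coordinate derivations of the second chart seen on the overlap;
    [pull_T] makes this precise. *)
Let d' b (u : sfun O) := \sum_a Ji b a * sder a u.

Let pull_r i a : pull r (sder i a) = sder i (pull r a).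
Proof.
have oO := @dom_open _ _ O.
apply: sfun_eq => x Ox; have Dx := @smap_in _ _ _ _ _ r x Ox.
refine (etrans (pullE r (sder i a) Ox) _).
refine (etrans (sderE i a Dx) _); rewrite [X in pd _ _ X]rE.
refine (esym (etrans (sderE i (pull r a) Ox) _)).
by apply: (eq_pd i oO Ox) => y Oy; rewrite pullE // rE.
Qed.

Let pull_T i a : pull T (sder i a) = d' i (pull T a).
Proof.
rewrite /d'; under eq_bigr => b _ do rewrite sder_pull mulr_sumr.
rewrite exchange_big /= (bigD1 i) //= [X in _ = _ + X]big1 => [|b bi].
  rewrite addr0; under eq_bigr => k _ do rewrite mulrA.
  rewrite -mulr_suml -[LHS]mul1r; congr (_ * _).
  have := mulmx1C JJi => /matrixP/(_ i i); rewrite [RHS]mxE eqxx mulr1n => <-.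
  by rewrite mxE; apply: eq_bigr => k _; congr (_ * _); rewrite mxE.
under eq_bigr => k _ do rewrite mulrA.
rewrite -mulr_suml; have := mulmx1C JJi => /matrixP/(_ i b).
rewrite [X in _ = X]mxE eq_sym (negPf bi) mulr0n => E.
rewrite (_ : \sum_k _ = 0) ?mul0r // -[RHS]E mxE.
by apply: eq_bigr => k _; congr (_ * _); rewrite mxE.
Qed.

Let dJ a b c : sder a (J c b) = sder c (J a b).
Proof. by rewrite /J !mxE sderC. Qed.

(** The Christoffel symbols of the two charts are never compared: both Laplacians are put in
    divergence form, pulled back to the overlap by naturality, and matched there by
    [lap_div_frame]. *)
Lemma lap_transition (ui : sfun Di) (uj : sfun Dj) :
  pull r ui = pull T uj ->
  pull r (lap (shalf Di) (@sder _ _ Di) Gi Hi ui) =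
  pull T (lap (shalf Dj) (@sder _ _ Dj) Gj Hj uj).
Proof.
move=> ruT.
rewrite (lap_divE (shalf2 Di) (@sder_derivation _ _ Di) (@sderC _ _ Di) GiT GHi).
rewrite (lap_divE (shalf2 Dj) (@sder_derivation _ _ Dj) (@sderC _ _ Dj) GjT GHj).
have Hr : pull r (lap_div (shalf Di) (@sder _ _ Di) Gi Hi ui) =
    lap_div (shalf O) (@sder _ _ O) Gi' Hi' (pull r ui).
  by rewrite -(pull_shalf r); exact: (map_lap_div _ _ _ pull_r).
have HT : pull T (lap_div (shalf Dj) (@sder _ _ Dj) Gj Hj uj) =
    lap_div (shalf O) d' Gj' Hj' (pull T uj).
  by rewrite -(pull_shalf T); exact: (map_lap_div _ _ _ pull_T).
rewrite Hr HT ruT.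
exact: (lap_div_frame (shalf2 O) (@sder_derivation _ _ O) JJi GJ GHi' GHj' dJ).
Qed.

Lemma gdot_transition (ui vi : sfun Di) (uj vj : sfun Dj) :
  pull r ui = pull T uj -> pull r vi = pull T vj ->
  pull r (gdot (@sder _ _ Di) Hi ui vi) = pull T (gdot (@sder _ _ Dj) Hj uj vj).
Proof.
move=> ruT rvT.
have Hr : pull r (gdot (@sder _ _ Di) Hi ui vi) =
    gdot (@sder _ _ O) Hi' (pull r ui) (pull r vi) by exact: (map_gdot _ pull_r).
have HT : pull T (gdot (@sder _ _ Dj) Hj uj vj) =
    gdot d' Hj' (pull T uj) (pull T vj) by exact: (map_gdot _ pull_T).
rewrite Hr HT ruT rvT.
exact: (gdot_frame JJi GJ GHi' GHj').
Qed.

End ChartTransition.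

Section SfunMatrix.
Context {R : realType} {n : nat} {D : domain R n}.

Lemma sfun_natE k x : dom_set D x -> (k%:R : sfun D) x = k%:R.
Proof. by move=> Dx; exact: (rmorph_nat (ev Dx)). Qed.

Lemma sfun_mx_eq p q (M N : 'M[sfun D]_(p, q)) :
  (forall x (Dx : dom_set D x), map_mx (ev Dx) M = map_mx (ev Dx) N) -> M = N.
Proof.
move=> MN; apply/matrixP => i j; apply: sfun_eq => x Dx.
by have /matrixP/(_ i j) := MN x Dx; rewrite !mxE.
Qed.

End SfunMatrix.

(** * Charts, overlaps and their rings of functions *)

Section Charts.
Context {R : realType} {n : nat} {M : topologicalType}.
Variables (c : chart R n M) (cP : is_chart c).

Lemma chart_dom_open : open (chart_dom c). Proof. by case: cP => -[]. Qed.
Lemma chart_cod_open : open (chart_cod c). Proof. by case: cP => -[]. Qed.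

Lemma chart_map_continuous p : chart_dom c p -> {for p, continuous (chart_map c)}.
Proof.
case: cP => -[oD _] _ _ cm _ Dp; move: cm.
by rewrite continuous_open_subspace // => /(_ p); apply; rewrite inE.
Qed.

Lemma chart_inv_continuous x : chart_cod c x -> {for x, continuous (chart_inv c)}.
Proof.
case: cP => -[_ oD] _ _ _ cm Dp; move: cm.
by rewrite continuous_open_subspace // => /(_ x); apply; rewrite inE.
Qed.

Lemma chart_mapK p : chart_dom c p -> chart_inv c (chart_map c p) = p.
Proof. by case: cP => _ H _ _ _ /H[]. Qed.
Lemma chart_invK x : chart_cod c x -> chart_map c (chart_inv c x) = x.
Proof. by case: cP => _ _ H _ _ /H[]. Qed.
Lemma chart_map_in p : chart_dom c p -> chart_cod c (chart_map c p).
Proof. by case: cP => _ H _ _ _ /H[]. Qed.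
Lemma chart_inv_in x : chart_cod c x -> chart_dom c (chart_inv c x).
Proof. by case: cP => _ _ H _ _ /H[]. Qed.

End Charts.

Section ManifoldCharts.
Context {R : realType} {n : nat} {B : riem_data R n}.
Hypothesis BR : riemannian_manifold B.

Lemma atlas_chart i : is_chart (atlas i : chart R n B).
Proof. by case: BR => -[]. Qed.

Lemma in_chart_open (i : atlas_index B) : open (in_chart i).
Proof. exact: chart_cod_open (atlas_chart i). Qed.

Definition chart_domain (i : atlas_index B) x (ix : in_chart i x) : domain R n :=
  Domain (@in_chart_open i) ix.

Lemma overlap_open (i j : atlas_index B) : open (overlap i j).
Proof.
rewrite openE => x [ix jx]; apply: filterI.
  by apply: open_nbhs_nbhs; split => //; exact: in_chart_open.
apply: (chart_inv_continuous (atlas_chart i) ix).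
by apply: open_nbhs_nbhs; split => //; exact: chart_dom_open (atlas_chart j).
Qed.

Lemma transition_in (i j : atlas_index B) x :
  overlap i j x -> in_chart j (transition i j x).
Proof. by case=> _ jx; exact: (chart_map_in (atlas_chart j) jx). Qed.

Lemma local_transition (u : B -> R) (i j : atlas_index B) x : overlap i j x ->
  local j u (transition i j x) = local i u x.
Proof. by case=> _ jx; rewrite /local /= (chart_mapK (atlas_chart j)). Qed.

Lemma metric_unitmx (i : atlas_index B) x : in_chart i x -> metric_mx i x \in unitmx.
Proof.
by move=> ix; apply: posdef_unitmx => v v0; case: BR => _ [_ _ + _]; exact.
Qed.

Lemma chart_metric_ring (i : atlas_index B) x (ix : in_chart i x) :
  exists SG SH : 'M[sfun (chart_domain ix)]_n,
  [/\ forall y, dom_set (chart_domain ix) y -> forall a b, SG a b y = metric_mx i y a b,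
      forall y, dom_set (chart_domain ix) y ->
        forall a b, SH a b y = invmx (metric_mx i y) a b,
      SG^T = SG & SG *m SH = 1%:M].
Proof.
have [_ [sG GT _ _]] := BR.
apply: (@metric_ring _ _ (chart_domain ix) (metric_mx i)).
- exact: sG.
- exact: GT.
- exact: metric_unitmx.
Qed.

Definition chart_fun (u : B -> R) (su : smooth u) (i : atlas_index B) x
    (ix : in_chart i x) : sfun (chart_domain ix) :=
  @mks _ _ (chart_domain ix) _ (su i).

Lemma chart_funE (u : B -> R) (su : smooth u) (i : atlas_index B) x
    (ix : in_chart i x) y :
  dom_set (chart_domain ix) y -> chart_fun su ix y = local i u y.
Proof. exact: (@mksE _ _ (chart_domain ix)). Qed.

Definition overlap_domain (i j : atlas_index B) x (Ox : overlap i j x) : domain R n :=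
  Domain (@overlap_open i j) Ox.

Definition overlap_incl (i j : atlas_index B) x (Ox : overlap i j x) :
    smap (overlap_domain Ox) (chart_domain Ox.1) :=
  @SMap _ _ _ (overlap_domain Ox) (chart_domain Ox.1) id
    (fun b => @smooth_coord R n _ b) (fun y Oy => Oy.1).

Definition overlap_trans (i j : atlas_index B) x (Ox : overlap i j x) :
    smap (overlap_domain Ox) (chart_domain (transition_in Ox)) :=
  @SMap _ _ _ (overlap_domain Ox) (chart_domain (transition_in Ox))
    (transition i j) (fun b => let: conj (And5 _ _ _ _ H) _ := BR in H i j b)
    (@transition_in i j).

End ManifoldCharts.

Lemma rmorph_warping (A A' C : comNzRingType) (g : {rmorphism A -> C})
    (h : {rmorphism A' -> C}) (m : nat) (L F l q p : A) (L' F' l' q' p' : A') :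
  g L = h L' -> g F = h F' -> g l = h l' -> g q = h q' -> g p = h p' ->
  g (L * F ^+ 2 + F * l + (m%:R - 1) * q - F * p)
  = h (L' * F' ^+ 2 + F' * l' + (m%:R - 1) * q' - F' * p').
Proof.
move=> EL EF El Eq Ep.
rewrite !expr2 !rmorphB !rmorphD !rmorphM !rmorphB !rmorph_nat !rmorph1.
by rewrite EL EF El Eq Ep.
Qed.

(** * Independence of the warping expression from the chart *)

Section WarpingConstant.
Context {R : realType} {n : nat} {B : riem_data R n}.
Variables (m : nat) (f lambda phi : B -> R).
Hypotheses (m_gt0 : (0 < m)%N) (BR : riemannian_manifold B).
Hypotheses (f_smooth : smooth f) (lambda_smooth : smooth lambda)
  (phi_smooth : smooth phi) (f_gt0 : forall p : B, 0 < f p).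

Definition warping_fun (i : atlas_index B) x : R :=
  local i lambda x * local i f x ^+ 2
  + local i f x * laplacian (metric_mx i) (local i f) x
  + (m%:R - 1) * grad_dot (metric_mx i) (local i f) (local i f) x
  - local i f x * grad_dot (metric_mx i) (local i phi) (local i f) x.

Definition warping_ring (D : domain R n) (SG SH : 'M[sfun D]_n)
    (F L P : sfun D) : sfun D :=
  L * F ^+ 2 + F * lap (shalf D) (@sder _ _ D) SG SH F
  + (m%:R - 1) * gdot (@sder _ _ D) SH F F
  - F * gdot (@sder _ _ D) SH P F.

Lemma warping_ring_val (i : atlas_index B) (D : domain R n) (SG SH : 'M[sfun D]_n)
    (F L P : sfun D) :
  (forall y, dom_set D y -> forall a b, SG a b y = metric_mx i y a b) ->
  (forall y, dom_set D y -> forall a b, SH a b y = invmx (metric_mx i y) a b) ->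
  (forall y, dom_set D y -> F y = local i f y) ->
  (forall y, dom_set D y -> L y = local i lambda y) ->
  (forall y, dom_set D y -> P y = local i phi y) ->
  forall y, dom_set D y -> warping_ring SG SH F L P y = warping_fun i y.
Proof.
move=> SGE SHE FE LE PE y Dy; rewrite /warping_ring /warping_fun expr2.
refine (etrans (sfunBE _ _ Dy) _).
congr (_ - _).
  refine (etrans (sfunDE _ _ Dy) _); congr (_ + _).
    refine (etrans (sfunDE _ _ Dy) _); congr (_ + _).
      by do 2 rewrite (sfunME _ _ Dy); rewrite LE // FE // expr2.
    rewrite (sfunME _ _ Dy) FE //; congr (_ * _).
    exact: (laplacian_val SGE SHE FE Dy).
  rewrite (sfunME _ _ Dy) (sfunBE _ _ Dy) sfun_natE // (sfun1E Dy).
  congr (_ * _); exact: (grad_dot_val SHE FE FE Dy).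
rewrite (sfunME _ _ Dy) FE //; congr (_ * _).
exact: (grad_dot_val SHE PE FE Dy).
Qed.

Lemma warping_fun_transition (i j : atlas_index B) x : overlap i j x ->
  warping_fun i x = warping_fun j (transition i j x).
Proof.
move=> Ox; have ix := Ox.1; have jx := transition_in BR Ox.
pose Di := chart_domain BR Ox.1; pose Dj := chart_domain BR (transition_in BR Ox).
pose r := overlap_incl BR Ox; pose T := overlap_trans BR Ox.
have [Gi [Hi [GiE HiE GiT GHi]]] := chart_metric_ring BR Ox.1.
have [Gj [Hj [GjE HjE GjT GHj]]] := chart_metric_ring BR (transition_in BR Ox).
pose Fi : sfun Di := chart_fun BR f_smooth _; pose Fj : sfun Dj := chart_fun BR f_smooth _.
pose Li : sfun Di := chart_fun BR lambda_smooth _.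
pose Lj : sfun Dj := chart_fun BR lambda_smooth _.
pose Pi : sfun Di := chart_fun BR phi_smooth _; pose Pj : sfun Dj := chart_fun BR phi_smooth _.
have FiE y : dom_set Di y -> Fi y = local i f y by exact: chart_funE.
have FjE y : dom_set Dj y -> Fj y = local j f y by exact: chart_funE.
have LiE y : dom_set Di y -> Li y = local i lambda y by exact: chart_funE.
have LjE y : dom_set Dj y -> Lj y = local j lambda y by exact: chart_funE.
have PiE y : dom_set Di y -> Pi y = local i phi y by exact: chart_funE.
have PjE y : dom_set Dj y -> Pj y = local j phi y by exact: chart_funE.
have pullEq (u : B -> R) (a : sfun Di) (b : sfun Dj) :
    (forall y, dom_set Di y -> a y = local i u y) ->
    (forall y, dom_set Dj y -> b y = local j u y) -> pull r a = pull T b.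
  move=> aE bE; apply: sfun_eq => y Oy.
  rewrite (pullE r a Oy) (pullE T b Oy).
  refine (etrans (aE _ (smap_in r Oy)) _).
  by refine (etrans _ (esym (bE _ (smap_in T Oy)))); rewrite /= local_transition.
have PF := pullEq f Fi Fj FiE FjE.
have PP := pullEq phi Pi Pj PiE PjE.
have PL := pullEq lambda Li Lj LiE LjE.
have GJ : map_mx (pull r) Gi = \matrix_(a, b) sder a (smap_coord T b)
    *m map_mx (pull T) Gj *m (\matrix_(a, b) sder a (smap_coord T b))^T.
  apply: sfun_mx_eq => y Oy; set J := \matrix_(_, _) _.
  have JE : map_mx (ev Oy) J = transition_jacobian i j y.
    apply/matrixP => a b; rewrite !mxE.
    exact: (sder_val _ (@mksE _ _ _ _ (smap_smooth T b)) Oy).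
  have G1 : map_mx (ev Oy) (map_mx (pull r) Gi) = metric_mx i y.
    apply/matrixP => a b; rewrite !mxE.
    exact: etrans (pullE r _ Oy) (GiE _ (smap_in r Oy) _ _).
  have G2 : map_mx (ev Oy) (map_mx (pull T) Gj) = metric_mx j (transition i j y).
    apply/matrixP => a b; rewrite !mxE.
    exact: etrans (pullE T _ Oy) (GjE _ (smap_in T Oy) _ _).
  rewrite !map_mxM -map_trmx G1 JE G2.
  by have [_ [_ _ _]] := BR; apply.
have rE y : r y = y by [].
have PW : pull r (warping_ring Gi Hi Fi Li Pi) = pull T (warping_ring Gj Hj Fj Lj Pj).
  apply: (rmorph_warping (g := pull r) (h := pull T) m PL PF).
  - exact: (lap_transition rE GiT GHi GjT GHj GJ PF).
  - exact: (gdot_transition rE GHi GHj GJ PF PF).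
  - exact: (gdot_transition rE GHi GHj GJ PP PF).
have := congr1 (fun a : sfun (overlap_domain BR Ox) => a x) PW.
rewrite (pullE r _ Ox) (pullE T _ Ox).
rewrite (warping_ring_val (D := Di) GiE HiE FiE LiE PiE (smap_in r Ox)).
by rewrite (warping_ring_val (D := Dj) GjE HjE FjE LjE PjE (smap_in T Ox)).
Qed.

End WarpingConstant.

Lemma locally_constant_connected (T : topologicalType) (U : Type) (w : T -> U) :
  connected [set: T] -> (forall p, \forall q \near p, w q = w p) ->
  forall p q, w p = w q.
Proof.
move=> conT wc p q; pose A := [set z | w z = w p].
have oA : open A.
  rewrite openE => z Az; apply: filterS (wc z) => y yz.
  by rewrite /A /= yz.
have cA : closed A.
  rewrite -openC openE => z nAz; apply: filterS (wc z) => y yz.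
  by rewrite /A /= yz.
have AT : A = [set: T].
  by apply: conT; [exists p | exists A; rewrite ?setTI | exists A; rewrite ?setTI].
by have : A q by rewrite AT.
Qed.

(** * Local constancy and existence of the warping constant *)

Section WarpingConstant.
Context {R : realType} {n : nat} {B : riem_data R n}.
Variables (m : nat) (f lambda phi : B -> R).
Hypotheses (m_gt0 : (0 < m)%N) (BR : riemannian_manifold B).
Hypotheses (f_smooth : smooth f) (lambda_smooth : smooth lambda)
  (phi_smooth : smooth phi) (f_gt0 : forall p : B, 0 < f p).
Hypotheses (base_eq : base_equation m f lambda phi)
  (base_deq : base_differential_equation m f lambda phi).

Section Chart.
Variables (i : atlas_index B) (x : 'rV[R]_n) (ix : in_chart i x).
Let D := chart_domain BR ix.
Variables (SG SH : 'M[sfun D]_n).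
Hypotheses (GE : forall y, dom_set D y -> forall a b, SG a b y = metric_mx i y a b)
 (HE : forall y, dom_set D y -> forall a b, SH a b y = invmx (metric_mx i y) a b)
 (GT : SG^T = SG) (GH : SG *m SH = 1%:M).
Let F : sfun D := chart_fun BR f_smooth ix.
Let L : sfun D := chart_fun BR lambda_smooth ix.
Let P : sfun D := chart_fun BR phi_smooth ix.
Let FE y : dom_set D y -> F y = local i f y. Proof. exact: chart_funE. Qed.
Let LE y : dom_set D y -> L y = local i lambda y. Proof. exact: chart_funE. Qed.
Let PE y : dom_set D y -> P y = local i phi y. Proof. exact: chart_funE. Qed.
Local Notation d := (@sder _ _ D).

Lemma warping_inv : {Fi : sfun D | F * Fi = 1}.
Proof. by apply: sfun_inv => y Dy; rewrite FE // gt_eqF //; exact: f_gt0. Qed.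

Variable Fi : sfun D.
Hypothesis FFi : F * Fi = 1.

Let FiE y : dom_set D y -> Fi y = (local i f y)^-1.
Proof.
move=> Dy; have := congr1 (fun a : sfun D => a y) FFi.
rewrite sfunME // sfun1E // FE // => E.
have f0 : local i f y != 0 by rewrite gt_eqF //; exact: f_gt0.
by apply: (mulfI f0); rewrite E divff.
Qed.

Lemma base_equation_ring : ric (shalf D) d SG SH + hess (shalf D) d SG SH P
  = L *: SG + (m%:R * Fi) *: hess (shalf D) d SG SH F.
Proof.
apply: sfun_mx_eq => y Dy; rewrite !map_mxD.
have ZE (a : sfun D) (M : 'M[sfun D]_n) :
    map_mx (ev Dy) (a *: M) = a y *: map_mx (ev Dy) M.
  by apply/matrixP => b c; rewrite !mxE; exact: sfunME.
rewrite !ZE.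
have := base_eq Dy.
rewrite (ricci_val GE HE Dy) (hessian_val GE HE PE Dy) (hessian_val GE HE FE Dy).
move=> ->; congr (_ *: _ + _ *: _).
- by rewrite LE.
- by apply/matrixP => a b; rewrite !mxE -GE.
- by rewrite sfunME // sfun_natE // FiE.
Qed.

Lemma base_differential_equation_ring a :
  - 2 * L * d a P + d a ((2 - m%:R - n%:R) * L + gdot d SH P P
    - lap (shalf D) d SG SH P - m%:R * Fi * gdot d SH P F) = 0.
Proof.
apply: sfun_eq => y Dy.
rewrite sfunDE // !sfunME // LE //.
have -> : (- 2 : sfun D) y = - 2.
  by rewrite -[- 2]sub0r sfunBE // sfun_natE // (sfun_natE 0 Dy) sub0r.
rewrite (sder_val _ PE Dy) [RHS](sfun_natE 0 Dy) -[RHS](base_deq a Dy).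
congr (_ + _); apply: (sder_val _ _ Dy) => z Dz.
refine (etrans (sfunBE _ _ Dz) _); congr (_ - _).
  refine (etrans (sfunBE _ _ Dz) _); congr (_ - _).
    refine (etrans (sfunDE _ _ Dz) _); congr (_ + _).
      by rewrite sfunME // LE // !sfunBE // !sfun_natE.
    exact: (grad_dot_val HE PE PE Dz).
  exact: (laplacian_val GE HE PE Dz).
refine (etrans (sfunME _ _ Dz) _); congr (_ * _).
  by rewrite sfunME // sfun_natE // FiE.
exact: (grad_dot_val HE PE FE Dz).
Qed.

Lemma warping_ring_der a : d a (warping_ring m SG SH F L P) = 0.
Proof.
have E := warping_constant_der (shalf2 D) (@sder_derivation _ _ D) (@sderC _ _ D)
  GT GH FFi base_equation_ring base_differential_equation_ring a.
(* The factor m in [E] is cancelled in the field of reals, at each point separately. *)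
apply: sfun_eq => y Dy; have := congr1 (fun a : sfun D => a y) E.
rewrite sfunME // sfun_natE // (sfun_natE 0 Dy) => /eqP.
by rewrite mulf_eq0 pnatr_eq0 -leqn0 leqNgt m_gt0 => /eqP.
Qed.

End Chart.

Lemma warping_fun_locally_constant i x : in_chart i x ->
  \forall y \near x, warping_fun m f lambda phi i y = warping_fun m f lambda phi i x.
Proof.
move=> ix; pose D := chart_domain BR ix.
have [G [H [GE HE GT GH]]] := chart_metric_ring BR ix.
have [Fi FFi] := warping_inv ix.
pose F : sfun D := chart_fun BR f_smooth ix.
pose L : sfun D := chart_fun BR lambda_smooth ix.
pose P : sfun D := chart_fun BR phi_smooth ix.
have WE := warping_ring_val (D := D) m GE HE (@chart_funE _ _ _ BR f f_smooth i x ix)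
  (@chart_funE _ _ _ BR lambda lambda_smooth i x ix)
  (@chart_funE _ _ _ BR phi phi_smooth i x ix).
have W0 := warping_ring_der GE HE GT GH FFi.
have /nbhs_ballP[e /= e0 eD] : nbhs x (in_chart i).
  by apply: open_nbhs_nbhs; split => //; exact: in_chart_open.
apply/nbhs_ballP; exists e => // y ye.
have Dy := eD y ye; have Dx : in_chart i x := ix.
rewrite -(WE y Dy) -(WE x Dx).
apply: (@constant_on_ball R n _ x e); last by rewrite -ball_normE /= distrC in ye.
move=> z a ze; have Dz : dom_set D z by apply: eD; rewrite -ball_normE /= distrC.
split; first exact: sfun_derivable.
have := congr1 (fun u : sfun D => u z) (W0 a).
by rewrite sderE // (sfun_natE 0 Dz).
Qed.

Lemma exists_warping_constant : exists mu, is_warping_constant m f lambda phi mu.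
Proof.
have [[_ [conB [p0 _]] _ cover _] _] := BR.
have chartP p := cid (cover p).
(* A chart is chosen at each point to obtain a function on B; [wE] shows that every other chart
   gives the same value, so the choices may vary wildly without harm. *)
pose w p := warping_fun m f lambda phi (projT1 (chartP p))
  (chart_map (atlas (projT1 (chartP p))) p).
have wE i p : chart_dom (atlas i) p ->
    w p = warping_fun m f lambda phi i (chart_map (atlas i) p).
  rewrite /w; case: (chartP p) => j /= jp ip.
  have O : overlap j i (chart_map (atlas j) p).
    split; first exact: (chart_map_in (atlas_chart BR j) jp).
    by rewrite /= (chart_mapK (atlas_chart BR j)).
  rewrite (warping_fun_transition m BR f_smooth lambda_smooth phi_smooth O).
  by rewrite /transition /= (chart_mapK (atlas_chart BR j)).
have wc p : \forall q \near p, w q = w p.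
  have [i ip] := cover p; have cP := atlas_chart BR i.
  have ix := chart_map_in cP ip.
  have N1 : \forall q \near p, chart_dom (atlas i) q.
    by apply: open_nbhs_nbhs; split => //; exact: chart_dom_open.
  have N2 := chart_map_continuous cP ip (warping_fun_locally_constant ix).
  by apply: filterS2 N1 N2 => q iq E; rewrite (wE i q iq) (wE i p ip).
exists (w p0) => i x ix.
have cP := atlas_chart BR i.
have := locally_constant_connected conB wc (chart_inv (atlas i) x) p0.
by rewrite (wE i _ (chart_inv_in cP ix)) (chart_invK cP ix).
Qed.

End WarpingConstant.

(** * The warped product *)

Section ProductTopology.
Context {S T : topologicalType}.

Lemma hausdorff_prod : hausdorff_space S -> hausdorff_space T ->
  hausdorff_space (S * T)%type.
Proof.
move=> hS hT [p1 p2] [q1 q2] cl.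
congr pair; [apply: hS => A C pA qC | apply: hT => A C pA qC].
  have [||[z1 z2] [[/= Az _] [/= Cz _]]] := cl (A `*` setT) (C `*` setT).
  - by exists (A, setT) => //=; split=> //; exact: filterT.
  - by exists (C, setT) => //=; split=> //; exact: filterT.
  - by exists z1.
have [||[z1 z2] [[/= _ Az] [/= _ Cz]]] := cl (setT `*` A) (setT `*` C).
- by exists (setT, A) => //=; split=> //; exact: filterT.
- by exists (setT, C) => //=; split=> //; exact: filterT.
- by exists z2.
Qed.

Lemma open_setX (A : set S) (C : set T) : open A -> open C -> open (A `*` C).
Proof.
move=> oA oC; rewrite openE => -[p q] [/= Ap Cq].
by exists (A, C) => //=; split; apply: open_nbhs_nbhs; split.
Qed.

Lemma second_countable_prod : @second_countable S -> @second_countable T ->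
  @second_countable (S * T)%type.
Proof.
move=> [b1 c1 [op1 n1]] [b2 c2 [op2 n2]].
exists [set X.1 `*` X.2 | X in b1 `*` b2].
  by apply: sub_countable (card_image_le _ _) _; exact: countableX.
split=> [_ [[A C] [/= /op1 oA /op2 oC] <-]|[p q] W].
  exact: open_setX.
move=> [[P Q] /= [/n1[A [bA Ap] AP] /n2[C [bC Cq] CQ]] PQW].
exists (A `*` C); first by split=> //; exists (A, C).
by move=> [y z] [/= Ay Cz]; apply: PQW; split; [exact: AP|exact: CQ].
Qed.

(** Membership in a set that is open and closed is a locally constant proposition, hence constant on
    every slice of the product; one slice of each kind joins any two points. *)
Lemma connected_prod : connected [set: S] -> connected [set: T] ->
  connected [set: S * T].
Proof.
move=> cS cT A [[p q] Apq] [U oU AU] [V cV AV].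
rewrite setTI in AU; rewrite setTI in AV; subst U.
have oC : open (~` A) by rewrite AV openC.
have lc z : \forall y \near z, A y = A z.
  have [Az|nAz] := pselect (A z).
    by apply: filterS (open_nbhs_nbhs (conj oU Az)) => y Ay; apply/propext.
  apply: filterS (open_nbhs_nbhs (conj oC nAz)) => y nAy.
  by apply/propext.
have cx (t : T) : forall s s', A (s, t) = A (s', t).
  apply: (locally_constant_connected (w := fun s => A (s, t)) cS) => s.
  have [[P Q] /= [nP nQ] PQ] := lc (s, t).
  by apply: filterS nP => s' Ps'; apply: PQ; split => //=; exact: nbhs_singleton.
have cy (s : S) : forall t t', A (s, t) = A (s, t').
  apply: (locally_constant_connected (w := fun t => A (s, t)) cT) => t.
  have [[P Q] /= [nP nQ] PQ] := lc (s, t).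
  by apply: filterS nQ => t' Qt'; apply: PQ; split => //=; exact: nbhs_singleton.
by apply/seteqP; split=> // -[s t] _; rewrite (cx t s p) (cy p t q).
Qed.

End ProductTopology.

(** * Partial derivatives of functions lifted from a factor *)

Section LiftPartials.
Context {R : realType} {n m : nat}.

Lemma pd_lsubmx_l (u : 'rV[R]_n -> R) (x : 'rV[R]_(n + m)) i :
  pd (lshift m i) (u \o lsubmx) x = pd i u (lsubmx x).
Proof.
rewrite /pd /derive.
suff -> : (fun h : R => h^-1 *: ((u \o lsubmx) (h *: delta_mx 0 (lshift m i) + x) -
   (u \o lsubmx) x)) =
  (fun h : R => h^-1 *: (u (h *: delta_mx 0 i + lsubmx x) - u (lsubmx x))) by [].
apply/funext => h; congr (_ *: (u _ - _)); apply/rowP => j.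
by rewrite !mxE eq_lshift.
Qed.

Lemma pd_rsubmx_r (u : 'rV[R]_m -> R) (x : 'rV[R]_(n + m)) i :
  pd (rshift n i) (u \o rsubmx) x = pd i u (rsubmx x).
Proof.
rewrite /pd /derive.
suff -> : (fun h : R => h^-1 *: ((u \o rsubmx) (h *: delta_mx 0 (rshift n i) + x) -
   (u \o rsubmx) x)) =
  (fun h : R => h^-1 *: (u (h *: delta_mx 0 i + rsubmx x) - u (rsubmx x))) by [].
apply/funext => h; congr (_ *: (u _ - _)); apply/rowP => j.
by rewrite !mxE eq_rshift.
Qed.

Let derive_zero (u : 'rV[R]_(n + m) -> R) x v :
  (forall h, u (h *: v + x) = u x) -> 'D_v u x = 0.
Proof.
move=> uv; rewrite /derive.
suff -> : (fun h : R => h^-1 *: (u (h *: v + x) - u x)) = cst 0 by exact: lim_cst.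
by apply/funext => h; rewrite uv subrr scaler0.
Qed.

Lemma pd_lsubmx_r (u : 'rV[R]_n -> R) (x : 'rV[R]_(n + m)) i :
  pd (rshift n i) (u \o lsubmx) x = 0.
Proof.
apply: derive_zero => h; congr (u _); apply/rowP => j.
by rewrite !mxE eq_lrshift mulr0 add0r.
Qed.

Lemma pd_rsubmx_l (u : 'rV[R]_m -> R) (x : 'rV[R]_(n + m)) i :
  pd (lshift m i) (u \o rsubmx) x = 0.
Proof.
apply: derive_zero => h; congr (u _); apply/rowP => j.
by rewrite !mxE eq_rlshift mulr0 add0r.
Qed.

Lemma smooth_lsubmx (O : set 'rV[R]_(n + m)) (D : set 'rV[R]_n) u :
  open O -> open D -> (forall x, O x -> D (lsubmx x)) -> smooth_on D u ->
  smooth_on O (u \o lsubmx).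
Proof.
move=> oO oD OD su; apply: (smooth_comp oO oD OD) => // b.
have -> : (fun y : 'rV[R]_(n + m) => lsubmx y 0 b) = (fun y => y 0 (lshift m b)).
  by apply/funext => y; rewrite mxE.
exact: smooth_coord.
Qed.

Lemma smooth_rsubmx (O : set 'rV[R]_(n + m)) (D : set 'rV[R]_m) u :
  open O -> open D -> (forall x, O x -> D (rsubmx x)) -> smooth_on D u ->
  smooth_on O (u \o rsubmx).
Proof.
move=> oO oD OD su; apply: (smooth_comp oO oD OD) => // b.
have -> : (fun y : 'rV[R]_(n + m) => rsubmx y 0 b) = (fun y => y 0 (rshift n b)).
  by apply/funext => y; rewrite mxE.
exact: smooth_coord.
Qed.

End LiftPartials.

(** * The warped product as a Riemannian manifold *)

Section WarpedProduct.
Context {R : realType} {n m : nat}.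
Variables (B : riem_data R n) (F : riem_data R m) (f : B -> R).
Hypotheses (BR : riemannian_manifold B) (FR : riemannian_manifold F).
Hypotheses (f_smooth : smooth f) (f_gt0 : forall p, 0 < f p).

Local Notation W := (warped_product F f).

Lemma warped_chart (i : atlas_index W) : is_chart (atlas i : chart R (n + m) W).
Proof.
case: i => i j; have ci := atlas_chart BR i; have cj := atlas_chart FR j.
have oi := chart_cod_open ci; have oj := chart_cod_open cj.
have oD : open (chart_dom (atlas ((i, j) : atlas_index W))).
  by apply: open_setX; [exact: chart_dom_open ci | exact: chart_dom_open cj].
have oC : open (chart_cod (atlas ((i, j) : atlas_index W))).
  apply: openI.
    by apply: open_comp => // x _; exact: lsubmx_continuous.
  by apply: open_comp => // x _; exact: rsubmx_continuous.
split=> //.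
- move=> [p q] [/= ip jq]; rewrite row_mxKl row_mxKr (chart_mapK ci) // (chart_mapK cj) //.
  by split => //; split; [exact: chart_map_in ci _ ip | exact: chart_map_in cj _ jq].
- move=> x [/= ix jx]; rewrite (chart_invK ci) // (chart_invK cj) // hsubmxK.
  by split=> //; split; [exact: chart_inv_in ci _ ix | exact: chart_inv_in cj _ jx].
- rewrite continuous_open_subspace // => -[p q]; rewrite inE => -[/= ip jq].
  apply: (@cvg_rV _ _ _ (nbhs (p, q))) => b.
  case: (split_ordP b) => {}b ->.
    rewrite /= row_mxEl; under eq_fun do rewrite row_mxEl.
    have c1 : {for (p, q), continuous (fst : B * F -> B)} by exact: cvg_fst.
    have c2 := @continuous_comp _ _ _ _ _ (p, q) c1 (chart_map_continuous ci ip).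
    exact: (@continuous_comp _ _ _ _ _ (p, q) c2 (@coord_continuous R 1 n 0 b _)).
  rewrite /= row_mxEr; under eq_fun do rewrite row_mxEr.
  have c1 : {for (p, q), continuous (snd : B * F -> F)} by exact: cvg_snd.
  have c2 := @continuous_comp _ _ _ _ _ (p, q) c1 (chart_map_continuous cj jq).
  exact: (@continuous_comp _ _ _ _ _ (p, q) c2 (@coord_continuous R 1 m 0 b _)).
- rewrite continuous_open_subspace // => x; rewrite inE => -[/= ix jx].
  have l1 : {for x, continuous (@lsubmx R 1 n m)} by exact: lsubmx_continuous.
  have r1 : {for x, continuous (@rsubmx R 1 n m)} by exact: rsubmx_continuous.
  have l2 := @continuous_comp _ _ _ _ _ x l1 (chart_inv_continuous ci ix).
  have r2 := @continuous_comp _ _ _ _ _ x r1 (chart_inv_continuous cj jx).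
  exact: cvg_pair l2 r2.
Qed.

Lemma warped_overlap (i j : atlas_index W) x : overlap i j x <->
  overlap i.1 j.1 (lsubmx x) /\ overlap i.2 j.2 (rsubmx x).
Proof. by split=> [[[? ?] [? ?]]|[[? ?] [? ?]]]. Qed.

Lemma warped_transition_l (i j : atlas_index W) b :
  (fun y => transition i j y 0 (lshift m b)) =
  (fun y => transition i.1 j.1 y 0 b) \o lsubmx.
Proof. by apply/funext => y; rewrite /transition /= row_mxEl. Qed.

Lemma warped_transition_r (i j : atlas_index W) b :
  (fun y => transition i j y 0 (rshift n b)) =
  (fun y => transition i.2 j.2 y 0 b) \o rsubmx.
Proof. by apply/funext => y; rewrite /transition /= row_mxEr. Qed.

Let in_chartW_open (i : atlas_index W) : open (in_chart i).
Proof. exact: chart_cod_open (warped_chart i). Qed.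

Let overlapW_open (i j : atlas_index W) : open (overlap i j).
Proof.
have -> : overlap i j = (lsubmx @^-1` overlap i.1 j.1) `&` (rsubmx @^-1` overlap i.2 j.2).
  by apply/seteqP; split=> x /=; [move/warped_overlap | move=> H; apply/warped_overlap].
apply: openI.
  by apply: open_comp; [move=> x _; exact: lsubmx_continuous | exact: overlap_open BR _ _].
by apply: open_comp; [move=> x _; exact: rsubmx_continuous | exact: overlap_open FR _ _].
Qed.

Lemma warped_smooth_manifold : smooth_manifold W.
Proof.
have [[[hB sB] [cB [p0 _]] _ coverB smB] _] := BR.
have [[[hF sF] [cF [q0 _]] _ coverF smF] _] := FR.
split.
- by split; [exact: hausdorff_prod | exact: second_countable_prod].
- by split; [exact: connected_prod | exists (p0, q0)].
- exact: warped_chart.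
- move=> [p q]; have [i ip] := coverB p; have [j jq] := coverF q.
  by exists (i, j).
- move=> i j b; case: (split_ordP b) => {}b ->.
    rewrite warped_transition_l.
    apply: (@smooth_lsubmx _ _ _ _ (overlap i.1 j.1)) => //; first exact: overlap_open BR _ _.
    by move=> x /warped_overlap[].
  rewrite warped_transition_r.
  apply: (@smooth_rsubmx _ _ _ _ (overlap i.2 j.2)) => //; first exact: overlap_open FR _ _.
  by move=> x /warped_overlap[].
Qed.

Lemma warped_jacobian (i j : atlas_index W) x : transition_jacobian i j x =
  block_mx (transition_jacobian i.1 j.1 (lsubmx x)) 0 0
           (transition_jacobian i.2 j.2 (rsubmx x)).
Proof.
apply/matrixP => a b; rewrite [LHS]mxE.
case: (split_ordP b) => {}b ->; case: (split_ordP a) => {}a ->.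
- by rewrite block_mxEul warped_transition_l pd_lsubmx_l [RHS]mxE.
- by rewrite block_mxEdl warped_transition_l pd_lsubmx_r mxE.
- by rewrite block_mxEur warped_transition_r pd_rsubmx_l mxE.
- by rewrite block_mxEdr warped_transition_r pd_rsubmx_r [RHS]mxE.
Qed.

Lemma base_lift_smooth (h : B -> R) : smooth h ->
  smooth (base_lift h : W -> R).
Proof.
move=> sh [i j].
apply: (@smooth_lsubmx _ _ _ _ (in_chart i) (local i h)) => //.
- exact: in_chart_open BR i.
- by move=> x [].
Qed.

Lemma warped_metric : riemannian_metric W.
Proof.
have [_ [sB TB pB jB]] := BR; have [_ [sF TF pF jF]] := FR.
split.
- move=> [i j] a b.
  have oi := @in_chart_open _ _ _ BR i; have oj := @in_chart_open _ _ _ FR j.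
  case: (split_ordP a) => {}a ->; case: (split_ordP b) => {}b ->.
  + have -> : (fun y => metric_mx ((i, j) : atlas_index W) y (lshift m a) (lshift m b))
      = (fun y => metric_mx i y a b) \o lsubmx.
      by apply/funext => y; rewrite /= block_mxEul.
    by apply: (@smooth_lsubmx _ _ _ _ (in_chart i)) => // x [].
  + have -> : (fun y => metric_mx ((i, j) : atlas_index W) y (lshift m a) (rshift n b))
      = cst 0 by apply/funext => y; rewrite /= block_mxEur mxE.
    exact: smooth_cst.
  + have -> : (fun y => metric_mx ((i, j) : atlas_index W) y (rshift n a) (lshift m b))
      = cst 0 by apply/funext => y; rewrite /= block_mxEdl mxE.
    exact: smooth_cst.
  + have -> : (fun y => metric_mx ((i, j) : atlas_index W) y (rshift n a) (rshift n b))
      = (local i f \o lsubmx) \* (local i f \o lsubmx) \*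
        ((fun y => metric_mx j y a b) \o rsubmx).
      by apply/funext => y; rewrite /= block_mxEdr mxE expr2.
    have sf : smooth_on (in_chart ((i, j) : atlas_index W)) (local i f \o lsubmx).
      by apply: (@smooth_lsubmx _ _ _ _ (in_chart i)) => // x [].
    apply: smoothM => //; first exact: smoothM.
    by apply: (@smooth_rsubmx _ _ _ _ (in_chart j)) => // x [].
- move=> [i j] x [ix jx] /=; rewrite tr_block_mx !trmx0 TB //.
  congr (block_mx _ _ _ _); apply/matrixP => a b; rewrite !mxE.
  by rewrite -{1}(TF j _ jx) mxE.
- move=> [i j] x v [ix jx] v0 /=.
  rewrite -[v]hsubmxK tr_row_mx mul_row_block mul_row_col !mulmx0 addr0 add0r.
  rewrite -scalemxAr -scalemxAl addmxE scalemxE.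
  have f2 : 0 < local i f (lsubmx x) ^+ 2 by rewrite exprn_gt0 //; exact: f_gt0.
  have ge0 (k : nat) (G : 'M[R]_k) (w : 'rV[R]_k) :
     (w != 0 -> 0 < (w *m G *m w^T) 0 0) -> 0 <= (w *m G *m w^T) 0 0.
    have [->|w0 /(_ isT)/ltW//] := eqVneq w 0.
    by rewrite !mul0mx mxE.
  have gB := ge0 _ _ _ (pB i _ (lsubmx v) ix); have gF := ge0 _ _ _ (pF j _ (rsubmx v) jx).
  have [l0|l0] := eqVneq (lsubmx v) 0.
    have r0 : rsubmx v != 0.
      by apply: contraNneq v0 => r0; rewrite -[v]hsubmxK l0 r0 row_mx0.
    by apply: ltr_wpDl => //; rewrite mulr_gt0 //; exact: pF.
  by apply: ltr_wpDr; [rewrite mulr_ge0 // ltW | exact: pB].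
- move=> i j x /warped_overlap[lx rx].
  rewrite warped_jacobian tr_block_mx !trmx0 /= row_mxKl row_mxKr.
  rewrite !mulmx_block !(mul0mx, mulmx0, addr0, add0r).
  rewrite -scalemxAr -scalemxAl -jF // -jB //.
  by have := local_transition BR f lx; rewrite /transition /= => <-.
Qed.

Lemma warped_riemannian : riemannian_manifold W.
Proof. by split; [exact: warped_smooth_manifold | exact: warped_metric]. Qed.

End WarpedProduct.

Lemma sfun_invmx_val (R : realType) (n : nat) (D : domain R n)
    (G : 'rV[R]_n -> 'M[R]_n) (SG SH : 'M[sfun D]_n) :
  (forall x, dom_set D x -> forall i j, SG i j x = G x i j) ->
  SG *m SH = 1%:M ->
  forall x, dom_set D x -> forall i j, SH i j x = invmx (G x) i j.
Proof.
move=> GE GH x Dx i j.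
have SGm : map_mx (ev Dx) SG = G x.
  by apply/matrixP => a b; rewrite mxE; exact: GE.
have E : G x *m map_mx (ev Dx) SH = 1%:M by rewrite -SGm -map_mxM GH map_mx1.
have [Gu _] := mulmx1_unit E.
by rewrite -[invmx _]mulmx1 -E mulmxA mulVmx // mul1mx [RHS]mxE.
Qed.

(** * The soliton equation on the warped product *)

Section Equation.
Context {R : realType} {n m : nat}.
Variables (B : riem_data R n) (F : riem_data R m) (f lambda phi : B -> R) (mu : R).
Hypotheses (BR : riemannian_manifold B) (FR : riemannian_manifold F).
Hypotheses (f_smooth : smooth f) (lambda_smooth : smooth lambda)
  (phi_smooth : smooth phi) (f_gt0 : forall p, 0 < f p).
Hypotheses (base_eq : base_equation m f lambda phi)
  (muP : is_warping_constant m f lambda phi mu) (einstein : einstein_with F mu).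

Local Notation W := (warped_product F f).

(** The two projections of a product chart induce ring morphisms that intertwine the coordinate
    derivations, and the derivations of one factor kill functions lifted from the other. Naturality
    thus carries the base equation, the definition of mu and the Einstein condition into one ring,
    where [warped_soliton] applies. *)
Lemma warped_soliton_equation (i : atlas_index W) x : in_chart i x ->
  ricci (metric_mx i) x + hessian (metric_mx i) (local i (base_lift phi)) x
  = local i (base_lift lambda) x *: metric_mx i x.
Proof.
case: i => i j ijx.
have ix : in_chart i (lsubmx x) := ijx.1.
have jx : in_chart j (rsubmx x) := ijx.2.
pose DB := chart_domain BR ix; pose DF := chart_domain FR jx.
pose D := prod_dom DB DF.
have Dx : dom_set D x by [].
have [GB [HB [GBE HBE GBT GHB]]] := chart_metric_ring BR ix.
have [GF [HF [GFE HFE GFT GHF]]] := chart_metric_ring FR jx.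
have [fi0 ffi0] := warping_inv BR f_smooth f_gt0 ix.
pose l := pull (projl DB DF); pose r := pull (projr DB DF).
pose u0 : sfun DB := chart_fun BR f_smooth ix.
pose L0 : sfun DB := chart_fun BR lambda_smooth ix.
pose P0 : sfun DB := chart_fun BR phi_smooth ix.
pose u : sfun D := l u0; pose fi : sfun D := l fi0.
pose L : sfun D := l L0; pose P : sfun D := l P0.
pose muD : sfun D := mks (smooth_cst (dom_set D) mu).
pose muB : sfun DB := mks (smooth_cst (dom_set DB) mu).
pose muF : sfun DF := mks (smooth_cst (dom_set DF) mu).
have lE a y : dom_set D y -> l a y = a (lsubmx y) by exact: pullE.
have rE a y : dom_set D y -> r a y = a (rsubmx y) by exact: pullE.
have ufi : u * fi = 1.
  apply: sfun_eq => y Dy; rewrite sfunME // !lE // sfun1E //.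
  by rewrite -sfunME ?ffi0 ?sfun1E //; case: Dy.
pose gB : 'M[sfun D]_n := map_mx l GB; pose hB : 'M[sfun D]_n := map_mx l HB.
pose gF : 'M[sfun D]_m := map_mx r GF; pose hF : 'M[sfun D]_m := map_mx r HF.
have gBT : gB^T = gB by rewrite /gB map_trmx GBT.
have gFT : gF^T = gF by rewrite /gF map_trmx GFT.
have gBhB : gB *m hB = 1%:M by rewrite -(map_mxM l) GHB (map_mx1 l).
have gFhF : gF *m hF = 1%:M by rewrite -(map_mxM r) GHF (map_mx1 r).
pose SG : 'M[sfun D]_(n + m) := block_mx gB 0 0 (u ^+ 2 *: gF).
pose SH : 'M[sfun D]_(n + m) := block_mx hB 0 0 (fi ^+ 2 *: hF).
have SGH : SG *m SH = 1%:M.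
  rewrite mulmx_block !(mul0mx, mulmx0, addr0, add0r) gBhB.
  rewrite -scalemxAr -scalemxAl gFhF scalerA [fi ^+ 2 * _]mulrC -exprMn ufi.
  by rewrite expr1n scale1r -scalar_mx_block.
have SGE y (Dy : dom_set D y) a b : SG a b y = metric_mx ((i, j) : atlas_index W) y a b.
  have [Dl Dr] := Dy; rewrite /SG /=.
  case: (split_ordP a) => {}a ->; case: (split_ordP b) => {}b ->.
  - rewrite !block_mxEul (_ : gB a b = l (GB a b)); last by rewrite mxE.
    refine (etrans (lE (GB a b) y Dy) (GBE _ Dl a b)).
  - by rewrite !block_mxEur !mxE (sfun_natE 0 Dy).
  - by rewrite !block_mxEdl !mxE (sfun_natE 0 Dy).
  - rewrite !block_mxEdr !scalemxE !expr2 !(sfunME _ _ Dy); congr (_ * _ * _).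
    + refine (etrans (lE u0 y Dy) (chart_funE f_smooth (ix := ix) Dl)).
    + refine (etrans (lE u0 y Dy) (chart_funE f_smooth (ix := ix) Dl)).
    + rewrite (_ : gF a b = r (GF a b)); last by rewrite mxE.
      refine (etrans (rE (GF a b) y Dy) (GFE _ Dr a b)).
(* The block matrix [SH] is identified with the inverse metric through the uniqueness of inverses,
   so [invmx] of a block matrix is never expanded. *)
have SHE := sfun_invmx_val SGE SGH.
have PE y : dom_set D y -> P y = local ((i, j) : atlas_index W) (base_lift phi) y.
  by move=> Dy; refine (etrans (lE P0 y Dy) (chart_funE phi_smooth (ix := ix) Dy.1)).
have LE y : dom_set D y -> L y = local ((i, j) : atlas_index W) (base_lift lambda) y.
  by move=> Dy; refine (etrans (lE L0 y Dy) (chart_funE lambda_smooth (ix := ix) Dy.1)).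
rewrite (ricci_val SGE SHE Dx) (hessian_val SGE SHE PE Dx) -map_mxD.
pose dB a := @sder _ _ D (lshift m a); pose dF a := @sder _ _ D (rshift n a).
have ldB a (v : sfun DB) : l (sder a v) = dB a (l v) by rewrite /l /dB sder_projl_l.
have rdF a (v : sfun DF) : r (sder a v) = dF a (r v) by rewrite /r /dF sder_projr_r.
have lhalf : l (shalf DB) = shalf D by exact: pull_shalf.
have rhalf : r (shalf DF) = shalf D by exact: pull_shalf.
have ricB : map_mx l (ric (shalf DB) (@sder _ _ DB) GB HB) = ric (shalf D) dB gB hB.
  by rewrite -lhalf; exact: (map_ric _ _ _ ldB).
have hessB v : map_mx l (hess (shalf DB) (@sder _ _ DB) GB HB v) =
    hess (shalf D) dB gB hB (l v).
  by rewrite -lhalf; exact: (map_hess _ _ _ ldB).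
have lapB v : l (lap (shalf DB) (@sder _ _ DB) GB HB v) = lap (shalf D) dB gB hB (l v).
  by rewrite -lhalf; exact: (map_lap _ _ _ ldB).
have gdotB v w : l (gdot (@sder _ _ DB) HB v w) = gdot dB hB (l v) (l w).
  exact: (map_gdot _ ldB).
have ricF : map_mx r (ric (shalf DF) (@sder _ _ DF) GF HF) = ric (shalf D) dF gF hF.
  by rewrite -rhalf; exact: (map_ric _ _ _ rdF).
have ZE (k : nat) (E : domain R k) (T : smap D E) p q (a : sfun E) (M : 'M[sfun E]_(p, q)) :
    map_mx (pull T) (a *: M) = pull T a *: map_mx (pull T) M.
  by apply/matrixP => b c; rewrite !mxE; exact: rmorphM.
have beq : ric (shalf D) dB gB hB + hess (shalf D) dB gB hB P
    = L *: gB + (m%:R * fi) *: hess (shalf D) dB gB hB u.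
  have := congr1 (map_mx l)
    (base_equation_ring lambda_smooth phi_smooth f_gt0 base_eq
       GBE HBE ffi0).
  rewrite !(map_mxD l) ricB !ZE hessB => ->; congr (_ + _).
  rewrite hessB; congr (_ *: _).
  by rewrite (rmorphM l) (rmorph_nat l).
have mueq : L * u ^+ 2 + u * lap (shalf D) dB gB hB u
    + (m%:R - 1) * gdot dB hB u u - u * gdot dB hB P u = muD.
  have W0 : warping_ring m GB HB u0 L0 P0 = muB.
    apply: sfun_eq => y Dy.
    rewrite (warping_ring_val (D := DB) m GBE HBE (chart_funE f_smooth (ix := ix))
      (chart_funE lambda_smooth (ix := ix)) (chart_funE phi_smooth (ix := ix)) Dy).
    by rewrite mksE //; exact: muP.
  have -> : muD = l muB.
    by apply: sfun_eq => y Dy; rewrite lE // !mksE //; case: Dy.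
  rewrite -W0 -lapB -!gdotB; symmetry.
  exact: (rmorph_warping (g := l) (h := idfun) m).
have Feq : ric (shalf D) dF gF hF = muD *: gF.
  have F0 : ric (shalf DF) (@sder _ _ DF) GF HF = muF *: GF.
    apply: sfun_mx_eq => y Dy.
    rewrite -(ricci_val GFE HFE Dy) einstein //.
    by apply/matrixP => a b; rewrite !mxE /ev sfunME // mksE // GFE.
  have -> : muD = r muF.
    by apply: sfun_eq => y Dy; rewrite rE // !mksE //; case: Dy.
  by rewrite -ricF F0 ZE.
have -> : ric (shalf D) (@sder _ _ D) SG SH + hess (shalf D) (@sder _ _ D) SG SH P
    = L *: SG.
  apply: (warped_soliton (shalf2 D) (@sder_derivation _ _ D) (@sderC _ _ D)
    gBT gFT gBhB gFhF ufi _ _ _ _ _ _ beq mueq Feq).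
  - by move=> a; exact: sder_projl_r.
  - by move=> a b c; rewrite mxE; exact: sder_projl_r.
  - by move=> a b c; rewrite mxE; exact: sder_projl_r.
  - by move=> a b c; rewrite mxE; exact: sder_projr_l.
  - by move=> a b c; rewrite mxE; exact: sder_projr_l.
  - by move=> a; exact: sder_projl_r.
apply/matrixP => a b; rewrite [LHS]mxE [in LHS]scalemxE [RHS]scalemxE.
by refine (etrans (sfunME _ _ Dx) _); congr (_ * _); [exact: LE | exact: SGE].
Qed.

End Equation.

(** * Lengths of curves and completeness *)

Section UnitInterval.
Context {R : realType}.
Local Notation mu := (@lebesgue_measure R).
Implicit Types g v : R -> R.

Definition continuous01 g : Prop := forall t : R, t \in `[0, 1] -> {for t, continuous g}.

Lemma continuous01_within g : continuous01 g -> {within `[0, 1], continuous g}.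
Proof.
by move=> cg; apply: continuous_in_subspaceT => t; rewrite inE /= => /cg.
Qed.

Lemma integrable01 g : continuous01 g -> mu.-integrable `[0, 1] (EFin \o g).
Proof.
move=> cg; apply: continuous_compact_integrable; first exact: segment_compact.
exact: continuous01_within.
Qed.

(** Only the existence of [dv] is given, so it is not integrated. Instead, for |s| at most 1, the
    antiderivative S of [g] plus s v has nonnegative derivative. *)
Lemma increment_le_integral g v (dv : R -> R) :
  continuous01 g ->
  (forall t : R, t \in `[0, 1] -> is_derive t 1 v (dv t) /\ `|dv t| <= g t) ->
  forall t, t \in `[0, 1] -> `|v t - v 0| <= Rintegral mu `[0, 1] g.
Proof.
move=> cg dvP.
pose S x := Rintegral mu `[0, x] g.
have ig := integrable01 cg.
have oo_cc (t : R) : t \in `]0, 1[ -> t \in `[0, 1] by exact: subset_itv_oo_cc.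
have cS : {within `[0, 1], continuous S} by exact: parameterized_integral_continuous.
have dS (t : R) : t \in `]0, 1[ -> is_derive t 1 S (g t).
  move=> t01; have := t01; rewrite in_itv /= => /andP[t0 t1].
  have [d1 d2] := continuous_FTC1_closed t1 ig t0 (cg t (oo_cc _ t01)).
  by rewrite derive1E in d2; exact: DeriveDef d1 d2.
have cv : {within `[0, 1], continuous v}.
  apply: continuous01_within => t /dvP[[dvt _] _].
  exact/differentiable_continuous/derivable1_diffP.
have S0 : S 0 = 0 by rewrite /S set_itv1 Rintegral_set1.
have in0 : (0 : R) \in `[0, 1] by rewrite in_itv /= lexx ler01.
have in1 : (1 : R) \in `[0, 1] by rewrite in_itv /= lexx ler01.
(* The values s = 1 and s = -1 bound the increment on both sides by S t; s = 0 gives S t <= S 1. *)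
have mono (s : R) : `|s| <= 1 -> {in `[0, 1] &, {homo (S \+ (s \*: v)) : x y / x <= y}}.
  move=> s1.
  have dh (t : R) : t \in `]0, 1[ -> is_derive t 1 (S \+ (s \*: v)) (g t + s *: dv t).
    move=> t01; have [dvt _] := dvP t (oo_cc t t01); have dSt := dS t t01.
    exact: is_deriveD.
  apply: ger0_derive1_le_cc.
  - by move=> t /dh [].
  - move=> t t01; rewrite derive1E (@derive_val _ _ _ _ _ _ _ (dh t t01)).
    have [_ dvg] := dvP t (oo_cc t t01).
    rewrite -[0 : R]/(0 : R) addrC -lerBlDr sub0r.
    apply: le_trans (_ : - `|s *: dv t| <= _); last by rewrite lerNl -normrN ler_norm.
    rewrite lerN2 /GRing.scale /= normrM; apply: le_trans dvg.
    by rewrite ler_piMl.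
  - move=> t; apply: continuousD; first exact: cS.
    by apply: continuousZl_tmp; exact: cv.
move=> t t01; have [t0 t1] : 0 <= t /\ t <= 1 by move: t01; rewrite in_itv /= => /andP.
have St : S t <= S 1.
  have := mono 0 _ t 1 t01 in1 t1; rewrite normr0 ler01 /= !scale0r !addr0.
  by apply.
have H1 := mono 1 _ 0 t in0 t01 t0; have H2 := mono (-1) _ 0 t in0 t01 t0.
rewrite normrN normr1 lexx /= S0 add0r in H2; have {}H2 := H2 isT.
rewrite normr1 lexx /= S0 add0r in H1; have {}H1 := H1 isT.
rewrite /GRing.scale /= ?mul1r ?mulN1r in H1 H2.
by apply: le_trans St; rewrite ler_norml; apply/andP; split; lra.
Qed.

End UnitInterval.

(** * Speed, length and Riemannian distance *)

Section Curves.
Context {R : realType} {n : nat} {M : riem_data R n}.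
Hypothesis MR : riemannian_manifold M.
Implicit Types (i j : atlas_index M) (c : R -> 'rV[R]_n).
Local Notation mu := (@lebesgue_measure R).

Definition speed i c (t : R) : R :=
  Num.sqrt ((derive1 c t *m metric_mx i (c t) *m (derive1 c t)^T) 0 0).

Lemma quadE (G : 'M[R]_n) (v : 'rV[R]_n) :
  (v *m G *m v^T) 0 0 = \sum_a \sum_b v 0 a * v 0 b * G a b.
Proof.
rewrite mxE exchange_big; apply: eq_bigr => b _; rewrite !mxE mulr_suml.
by apply: eq_bigr => a _; ring.
Qed.

Lemma quad_ge0 i x (v : 'rV[R]_n) : in_chart i x -> 0 <= (v *m metric_mx i x *m v^T) 0 0.
Proof.
move=> ix; have [->|v0] := eqVneq v 0; first by rewrite !mul0mx mxE.
by apply: ltW; case: MR => _ [_ _ + _]; apply.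
Qed.

Lemma c1_continuous i c t : c1_curve i c -> {for t, continuous c}.
Proof. by move=> [dc _ _]; apply/differentiable_continuous/derivable1_diffP. Qed.

Lemma metric_continuous i x a b : in_chart i x ->
  {for x, continuous (fun y => metric_mx i y a b)}.
Proof. by move=> ix; case: MR => _ [sm _ _ _]; exact: (sm i a b [::] x ix).1. Qed.

Lemma speed_continuous i c : c1_curve i c -> continuous01 (speed i c).
Proof.
move=> ic t t01; have [dc cc' cin] := ic.
have ct := @c1_continuous i c t ic.
have ix := cin t t01.
have cq : {for t, continuous (fun s => \sum_a \sum_b
    derive1 c s 0 a * derive1 c s 0 b * metric_mx i (c s) a b)}.
  apply: (@cvg_sumR R _ (nbhs t)) => a; apply: (@cvg_sumR R _ (nbhs t)) => b.
  have cd k : {for t, continuous (fun s => derive1 c s 0 k)}.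
    exact: (@continuous_comp _ _ _ _ _ t (cc' t) (@coord_continuous R 1 n 0 k _)).
  have cm : {for t, continuous (fun s => metric_mx i (c s) a b)}.
    have mc := @metric_continuous i (c t) a b ix.
    exact: (@continuous_comp _ _ _ _ _ t ct mc).
  exact: continuousM (continuousM (cd a) (cd b)) cm.
have -> : speed i c = Num.sqrt \o (fun s => \sum_a \sum_b
    derive1 c s 0 a * derive1 c s 0 b * metric_mx i (c s) a b).
  by apply/funext => s; rewrite /speed quadE.
exact: continuous_comp cq (@sqrt_continuous R _).
Qed.

Lemma curve_lengthE i c : curve_length i c = Rintegral mu `[0, 1] (speed i c).
Proof. by []. Qed.

Lemma speed_ge0 i c t : 0 <= speed i c t. Proof. exact: sqrtr_ge0. Qed.

Lemma curve_length_ge0 i c : 0 <= curve_length i c.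
Proof. by apply: Rintegral_ge0 => t _; exact: speed_ge0. Qed.

Lemma pw_curve_ge0 (p q : M) L : pw_curve p q L -> 0 <= L.
Proof. by elim=> // i c q' L' _ _ L0; rewrite addr_ge0 // curve_length_ge0. Qed.

Lemma pw_curve_cat (p q r : M) L L' : pw_curve p q L -> pw_curve q r L' ->
  pw_curve p r (L + L').
Proof.
elim=> [z|i c q' L1 ic _ IH] qr; first by rewrite add0r.
by rewrite -addrA; apply: pw_cons => //; exact: IH.
Qed.

Lemma riem_dist_lt (p q : M) (e : R) : (riem_dist p q < e%:E)%E ->
  exists2 L, pw_curve p q L & L < e.
Proof. by move=> /ereal_inf_lt [_ [L pL <-] Le]; exists L. Qed.

Lemma riem_dist_le (p q : M) L : pw_curve p q L -> (riem_dist p q <= L%:E)%E.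
Proof. by move=> pL; apply: ereal_inf_lbound; exists L. Qed.

Lemma riem_dist_ge0 (p q : M) : (0 <= riem_dist p q)%E.
Proof.
rewrite leNgt; apply/negP => /riem_dist_lt[L /pw_curve_ge0 L0].
by rewrite ltNge L0.
Qed.

Lemma riem_dist_cvg0 (s : nat -> M) (p : M) :
  (fun k => riem_dist (s k) p) @ \oo --> 0%:E <->
  forall e : R, 0 < e -> exists N : nat, forall k : nat, (N <= k)%N ->
    exists2 L, pw_curve (s k) p L & L < e.
Proof.
split=> [sp e e0|H].
  have : \forall k \near \oo, (riem_dist (s k) p < e%:E)%E.
    have N0 : nbhs (0%:E : \bar R) [set y | (y < e%:E)%E].
      by apply: open_nbhs_nbhs; split;
        [exact: open_ereal_lt_ereal | rewrite /= lte_fin].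
    exact: (sp _ N0).
  move=> [N _ NP]; exists N => k Nk; apply: riem_dist_lt; exact: NP.
have lt_e (e : R) : 0 < e -> \forall k \near \oo, (riem_dist (s k) p < e%:E)%E.
  move=> e0; have [N NP] := H e e0; exists N => // k /= Nk.
  have [L pL Le] := NP k Nk.
  by apply: le_lt_trans (riem_dist_le pL) _; rewrite lte_fin.
apply/fine_cvgP; split.
  apply: filterS (lt_e 1 ltr01) => k d1.
  by rewrite ge0_fin_numE ?riem_dist_ge0 //; apply: lt_trans d1 (ltry _).
apply/cvgrPdist_lt => e e0; apply: filterS (lt_e e e0) => k de.
rewrite sub0r normrN /= ger0_norm; last by rewrite fine_ge0 // riem_dist_ge0.
rewrite -lte_fin fineK // ge0_fin_numE ?riem_dist_ge0 //.
by apply: lt_trans de (ltry _).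
Qed.

End Curves.

Section CauchySchwarz.
Context {R : realType} {n : nat}.
Variable G : 'M[R]_n.
Hypotheses (GT : G^T = G)
  (Gpos : forall v : 'rV[R]_n, v != 0 -> 0 < (v *m G *m v^T) 0 0).

(** Here [w] is a covector and [y] its dual vector. Along the line v - s y the quadratic form of [G]
    is least at s = a / A, and its nonnegativity there is the inequality. *)
Lemma cauchy_schwarz_dual (v w : 'rV[R]_n) :
  ((v *m w^T) 0 0) ^+ 2 <=
  (v *m G *m v^T) 0 0 * (w *m invmx G *m w^T) 0 0.
Proof.
have Gu := posdef_unitmx Gpos.
have HT : (invmx G)^T = invmx G by rewrite trmx_inv GT.
pose y := w *m invmx G.
have yG : y *m G = w by rewrite -mulmxA mulVmx // mulmx1.
have Gy : G *m y^T = w^T by rewrite -[G]GT -trmx_mul yG.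
set a := (v *m w^T) 0 0; set A := (w *m invmx G *m w^T) 0 0.
have yGv : (y *m G *m v^T) 0 0 = a.
  by rewrite yG -[LHS]/((w *m v^T) 0 0) -[w *m _]trmxK trmx_mul trmxK mxE.
have [y0|y0] := eqVneq y 0.
  have w0 : w = 0 by rewrite -yG y0 mul0mx.
  by rewrite /a /A w0 trmx0 !mulmx0 mxE expr0n /= mulr0.
have AE : (y *m G *m y^T) 0 0 = A by rewrite yG /y trmx_mul HT /A mulmxA.
have A0 : 0 < A by rewrite -AE; exact: Gpos.
have : 0 <= ((v - (a / A) *: y) *m G *m (v - (a / A) *: y)^T) 0 0.
  have [->|/Gpos/ltW//] := eqVneq (v - (a / A) *: y) 0.
  by rewrite !mul0mx mxE.
rewrite trD trN !mulmxDl !mulmxDr !mulNmx !mulmxN opprK.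
have -> : ((a / A) *: y)^T = (a / A) *: y^T by apply/matrixP => i j; rewrite !mxE.
rewrite -!scalemxAl -!scalemxAr !(addmxE, oppmxE, scalemxE) AE yGv.
rewrite -(mulmxA v G y^T) Gy -/a.
set Q := (v *m G *m v^T) 0 0 => H.
have E : Q - a / A * a - a / A * a + a / A * (a / A * A) = Q - a ^+ 2 / A.
  by field; rewrite gt_eqF.
rewrite -ler_pdivrMr // -subr_ge0 -E; apply: le_trans H _.
by rewrite le_eqVlt; apply/orP; left; apply/eqP; ring.
Qed.

End CauchySchwarz.

Section PosPart.
Context {R : realType}.

Definition pospart (s : R) : R := (s + `|s|) / 2.

Lemma pospart_ge0 s : 0 <= s -> pospart s = s.
Proof. by move=> s0; rewrite /pospart ger0_norm //; field. Qed.

Lemma pospart_le0 s : s <= 0 -> pospart s = 0.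
Proof. by move=> s0; rewrite /pospart ler0_norm // subrr mul0r. Qed.

Lemma pospart_continuous : continuous pospart.
Proof.
move=> s.
have c1 : (t + `|t|) @[t --> s] --> s + `|s|.
  by apply: cvgD; [exact: cvg_id | exact: norm_continuous].
exact: cvgM c1 (cvg_cst _).
Qed.

(** Squaring removes the corner of the positive part at 0, so the bump function is differentiable
    along curves although it is cut off by a simple truncation. *)
Lemma is_derive_pospart2 (s : R) :
  is_derive s 1 (fun s => pospart s ^+ 2) (2 * pospart s).
Proof.
have [s0|s0|->] := ltgtP s 0.
- have N : \forall t \near s, 0 = pospart t ^+ 2.
    have : \forall t \near s, t < 0.
      by apply: open_nbhs_nbhs; split => //; exact: open_lt.
    by apply: filterS => t t0; rewrite pospart_le0 ?expr0n // ltW.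
  rewrite pospart_le0 ?ltW // mulr0.
  exact: near_eq_is_derive N (is_derive_cst _ _ _).
- have N : \forall t \near s, t ^+ 2 = pospart t ^+ 2.
    have : \forall t \near s, 0 < t.
      by apply: open_nbhs_nbhs; split => //; exact: open_gt.
    by apply: filterS => t t0; rewrite pospart_ge0 // ltW.
  rewrite pospart_ge0 ?ltW //.
  apply: near_eq_is_derive N _; apply: is_derive_eq.
  by rewrite /GRing.scale /= mulr1 mulr2n mulrDl mul1r.
rewrite pospart_le0 // mulr0.
have L : (fun h : R => h^-1 *: (pospart (h *: 1 + 0) ^+ 2 - pospart 0 ^+ 2))
    @ 0^' --> (0 : R).
  apply/cvgrPdist_le => e e0; near=> h.
  rewrite (pospart_le0 (lexx 0)) expr0n /= subr0 addr0 [h *: 1]mulr1 sub0r normrN.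
  have h0 : h != 0 by near: h; exact: nbhs_dnbhs_neq.
  have he : `|h| <= e by near: h; exact: dnbhs0_le.
  rewrite /GRing.scale /= normrM normfV ler_pdivrMl ?normr_gt0 //.
  have ph : `|pospart h| <= `|h|.
    have [h1|h1] := leP 0 h; first by rewrite pospart_ge0.
    by rewrite (pospart_le0 (ltW h1)) normr0.
  by rewrite normrX expr2 ler_pM // (le_trans ph he).
apply: DeriveDef; first by apply/cvg_ex; exists 0.
by apply: cvg_lim.
Unshelve. all: by end_near. Qed.

End PosPart.

(** * A Lipschitz bump function supported in a chart *)

Section BumpChart.
Context {R : realType} {n : nat} {M : riem_data R n}.
Hypothesis MR : riemannian_manifold M.
Variables (j : atlas_index M) (x0 : 'rV[R]_n) (r : R).

Let box : set 'rV[R]_n := [set v | forall a, v ord0 a \in `[x0 0 a - r, x0 0 a + r]].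
Hypotheses (r_gt0 : 0 < r) (box_in : box `<=` in_chart j).

(** The Euclidean square is differentiable, unlike the maximum norm of row vectors; the ball where
    this is positive lies in the cube [box]. *)
Definition bump_quad (y : 'rV[R]_n) : R := r ^+ 2 - \sum_a (y 0 a - x0 0 a) ^+ 2.

Definition bump (p : M) : R :=
  if `[< chart_dom (atlas j) p >] then pospart (bump_quad (chart_map (atlas j) p)) ^+ 2
  else 0.

(* The differential of [bump] in the chart [j]. *)
Let omega (y : 'rV[R]_n) : 'rV[R]_n :=
  \row_a (- 4 * pospart (bump_quad y) * (y 0 a - x0 0 a)).

Lemma box_compact : compact box.
Proof.
apply: (@rV_compact _ _ (fun a => `[x0 0 a - r, x0 0 a + r]%classic)) => a.
exact: segment_compact.
Qed.

Lemma bump_quad_box y : 0 < bump_quad y -> box y.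
Proof.
move=> q0 a; have : (y 0 a - x0 0 a) ^+ 2 < r ^+ 2.
  apply: le_lt_trans (_ : \sum_b (y 0 b - x0 0 b) ^+ 2 < _); last by rewrite -subr_gt0.
  rewrite (bigD1 a) //= lerDl; apply: sumr_ge0 => b _; exact: sqr_ge0.
rewrite -real_normK ?num_real // ltr_pXn2r ?nnegrE ?(ltW r_gt0) //.
by rewrite ltr_norml in_itv /= => /andP[h1 h2]; apply/andP; split; lra.
Qed.

Lemma omega_out y : ~ box y -> omega y = 0.
Proof.
move=> nb; apply/rowP => a; rewrite !mxE pospart_le0 ?mulr0 ?mul0r //.
by rewrite leNgt; apply/negP => /bump_quad_box.
Qed.

Let coordB_continuous a y : {for y, continuous (fun z : 'rV[R]_n => z 0 a - x0 0 a)}.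
Proof.
have c1 : {for y, continuous (fun z : 'rV[R]_n => z 0 a)} by exact: coord_continuous.
have c2 : {for y, continuous (fun _ : 'rV[R]_n => x0 0 a)} by exact: cst_continuous.
exact: continuousB c1 c2.
Qed.

Lemma bump_quad_continuous : continuous bump_quad.
Proof.
move=> y.
have c0 : {for y, continuous (fun _ : 'rV[R]_n => r ^+ 2)} by exact: cst_continuous.
have c1 : {for y, continuous (fun z : 'rV[R]_n => \sum_a (z 0 a - x0 0 a) ^+ 2)}.
  apply: (@cvg_sumR R _ (nbhs y)) => a.
  exact: continuousM (@coordB_continuous a y) (@coordB_continuous a y).
exact: continuousB c0 c1.
Qed.

Lemma omega_continuous a : continuous (fun y => omega y 0 a).
Proof.
move=> y; have c1 := @coordB_continuous a y.
have c2 : {for y, continuous (fun z => pospart (bump_quad z))}.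
  exact: (@continuous_comp _ _ _ _ _ y (@bump_quad_continuous y) (@pospart_continuous R _)).
have c3 : {for y, continuous (fun _ : 'rV[R]_n => - 4 : R)} by exact: cst_continuous.
have -> : (fun y => omega y 0 a) = ((fun _ => - 4) \* (fun z => pospart (bump_quad z)))
     \* (fun z : 'rV[R]_n => z 0 a - x0 0 a).
  by apply/funext => z; rewrite mxE.
exact: continuousM (continuousM c3 c2) c1.
Qed.

(** [omega] vanishes off the compact [box], and on it the dual norm squared is continuous, hence
    bounded. *)
Lemma omega_bound : exists2 K : R, 0 < K &
  forall y, in_chart j y ->
    (omega y *m invmx (metric_mx j y) *m (omega y)^T) 0 0 <= K ^+ 2.
Proof.
have x0b : box x0.
  by move=> a; rewrite in_itv /= gerBl lerDl (ltW r_gt0).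
have x0j : in_chart j x0 := box_in x0b.
have [SG [SH [_ SHE _ _]]] := chart_metric_ring MR x0j.
pose Om (y : 'rV[R]_n) := \sum_a \sum_b omega y 0 a * omega y 0 b * SH a b y.
have OmE y : in_chart j y ->
    (omega y *m invmx (metric_mx j y) *m (omega y)^T) 0 0 = Om y.
  move=> jy; rewrite quadE; apply: eq_bigr => a _; apply: eq_bigr => b _.
  by rewrite SHE.
have cOm y : in_chart j y -> {for y, continuous Om}.
  move=> jy; apply: (@cvg_sumR R _ (nbhs y)) => a; apply: (@cvg_sumR R _ (nbhs y)) => b.
  have cS : {for y, continuous (SH a b)}.
    exact: (@sfun_smooth _ _ _ (SH a b) [::] y jy).1.
  exact: continuousM (continuousM (@omega_continuous a y) (@omega_continuous b y)) cS.
have [|c cb cmax] := @EVT_max_rV R n Om box (ex_intro _ x0 x0b) box_compact.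
  apply: continuous_in_subspaceT => y; rewrite inE => yb.
  exact: cOm (box_in yb).
(* The maximum of [Om] must be dominated by the square of a positive number: (1 + z)^2 >= z for z >=
   0. *)
exists (1 + `|Om c|); first by rewrite ltr_pwDl.
have K1 : `|Om c| <= (1 + `|Om c|) ^+ 2.
  by have := normr_ge0 (Om c); set z := `|_| => z0; nra.
move=> y jy; have [yb|nyb] := pselect (box y).
  rewrite OmE //; apply: le_trans K1; apply: le_trans (ler_norm _).
  by apply: cmax; rewrite inE.
by rewrite omega_out // !mul0mx mxE sqr_ge0.
Qed.

Lemma is_derive_bump_quad (g : R -> 'rV[R]_n) (t : R) (dg : 'rV[R]_n) :
  (forall a, is_derive t 1 (fun s => g s 0 a) (dg 0 a)) ->
  is_derive t 1 (fun s => pospart (bump_quad (g s)) ^+ 2) ((dg *m (omega (g t))^T) 0 0).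
Proof.
move=> Dg.
have D1 : is_derive t 1 (fun s => bump_quad (g s))
    (- \sum_a 2 * (g t 0 a - x0 0 a) * dg 0 a).
  have -> : (fun s => bump_quad (g s)) =
      cst (r ^+ 2) - \sum_a (fun s => (g s 0 a - x0 0 a) ^+ 2).
    apply/funext => s; rewrite /bump_quad -[RHS]/(r ^+ 2 - _); congr (_ - _).
    by rewrite fct_sumE.
  have D a : is_derive t 1 (fun s => (g s 0 a - x0 0 a) ^+ 2)
      (2 * (g t 0 a - x0 0 a) * dg 0 a).
    have Da := Dg a; apply: is_derive_eq.
    by rewrite /GRing.scale /= subr0; ring.
  have -> : - (\sum_a 2 * (g t 0 a - x0 0 a) * dg 0 a) =
    0 - \sum_a 2 * (g t 0 a - x0 0 a) * dg 0 a by rewrite sub0r.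
  exact: is_deriveB.
have [d1 E1] := D1; have [d2 E2] := is_derive_pospart2 (bump_quad (g t)).
have dc := @derive1_comp R (fun s => bump_quad (g s)) (fun s => pospart s ^+ 2) t d1 d2.
apply: DeriveDef.
  apply/derivable1_diffP; apply: (@differentiable_comp _ _ _ _
    (fun s => bump_quad (g s)) (fun s => pospart s ^+ 2)); exact/derivable1_diffP.
rewrite -derive1E [LHS]dc !derive1E E1 E2 mxE mulrN mulr_sumr -sumrN.
by apply: eq_bigr => a _; rewrite !mxE; ring.
Qed.

(** Extension by 0 could jump at the edge of the chart domain. It does not, because the image of the
    compact [box] is closed in a Hausdorff space and lies inside that domain. *)
Lemma bump_closed_out p : ~ chart_dom (atlas j) p -> \forall q \near p, bump q = 0.
Proof.
move=> np.
have cj := atlas_chart MR j.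
have hM : hausdorff_space M by case: MR => -[[]].
have cl : closed (chart_inv (atlas j) @` box).
  apply: compact_closed => //; apply: continuous_compact; last exact: box_compact.
  apply: continuous_in_subspaceT => y; rewrite inE => yb.
  exact: (chart_inv_continuous cj (box_in yb)).
have oC : open (~` (chart_inv (atlas j) @` box)) by rewrite openC.
have pC : (~` (chart_inv (atlas j) @` box)) p.
  by move=> [y yb yp]; apply: np; rewrite -yp; exact: (chart_inv_in cj (box_in yb)).
apply: filterS (open_nbhs_nbhs (conj oC pC)) => q nq; rewrite /bump.
case: asboolP => // jq; rewrite pospart_le0 ?expr0n // leNgt; apply/negP => /bump_quad_box qb.
by apply: nq; exists (chart_map (atlas j) q) => //; exact: (chart_mapK cj jq).
Qed.

(** Outside the chart [j] the bump vanishes near the point. Inside, the curve is moved to the chart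
    [j] by the transition map; the derivative is the pairing of its velocity with [omega], to which
    the dual Cauchy-Schwarz inequality applies, and the transformation law of the metric identifies
    the speeds in both charts. *)
Lemma bump_derivative K : 0 < K ->
  (forall y, in_chart j y ->
    (omega y *m invmx (metric_mx j y) *m (omega y)^T) 0 0 <= K ^+ 2) ->
  forall (i : atlas_index M) (c : R -> 'rV[R]_n) (t : R), c1_curve i c -> t \in `[0, 1] ->
  exists2 dv : R, is_derive t 1 (fun s => bump (chart_inv (atlas i) (c s))) dv &
    `|dv| <= K * speed i c t.
Proof.
move=> K0 KP i c t ic t01; have [dc _ cin] := ic.
have ix := cin t t01; have ct := @c1_continuous R n M i c t ic.
have ci := atlas_chart MR i; have cj := atlas_chart MR j.
have [jp|njp] := pselect (chart_dom (atlas j) (chart_inv (atlas i) (c t))); last first.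
  exists 0; last by rewrite normr0 mulr_ge0 ?speed_ge0 // ltW.
  have cc := @continuous_comp _ _ _ _ _ t ct (chart_inv_continuous ci ix).
  have N : \forall s \near t, 0 = bump (chart_inv (atlas i) (c s)).
    have : \forall s \near t, bump (chart_inv (atlas i) (c s)) = 0.
      exact: (cc _ (bump_closed_out njp)).
    by apply: filterS => s ->.
  exact: near_eq_is_derive N (is_derive_cst _ _ _).
have O : overlap i j (c t) by split.
have oO := overlap_open MR (i := i) (j := j).
pose g s := transition i j (c s).
have jy : in_chart j (g t) := transition_in MR O.
pose dg := derive1 c t *m transition_jacobian i j (c t).
have Dg a : is_derive t 1 (fun s => g s 0 a) (dg 0 a).
  have sT : smooth_on (overlap i j) (fun y => transition i j y 0 a).
    by case: MR => -[_ _ _ _ H] _; exact: H.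
  have C1 : Ck 1 (overlap i j) (fun y => transition i j y 0 a).
    by have /smooth_Ck := sT; exact.
  have [Hn Hc] := Ck_differentiable oO C1 O.
  have dcb b : derivable (fun s => c s 0 b) t 1 by have /derivable_mxP := dc t; apply.
  have := chain_rule Hn Hc dcb.
  suff -> : \sum_b 'D_1 (fun s => c s 0 b) t * pd b (fun y => transition i j y 0 a) (c t)
    = dg 0 a by [].
  rewrite mxE; apply: eq_bigr => b _; congr (_ * _); last by rewrite mxE.
  by rewrite derive1E derive_mx // mxE.
exists ((dg *m (omega (g t))^T) 0 0).
  have N : \forall s \near t, pospart (bump_quad (g s)) ^+ 2 = bump (chart_inv (atlas i) (c s)).
    have : \forall s \near t, overlap i j (c s).
      by apply: ct; exact: open_nbhs_nbhs.
    by apply: filterS => s [_ js]; rewrite /bump asboolT.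
  exact: near_eq_is_derive N (is_derive_bump_quad Dg).
have [_ [_ GT Gpos GJ]] := MR.
have CS := cauchy_schwarz_dual (GT j _ jy) (fun v => Gpos j _ v jy) dg (omega (g t)).
have gE : (dg *m metric_mx j (g t) *m dg^T) 0 0 = speed i c t ^+ 2.
  rewrite /speed sqr_sqrtr; last exact: quad_ge0.
  by rewrite (GJ i j _ O) /dg trmx_mul !mulmxA.
rewrite gE in CS.
have Ks : 0 <= K * speed i c t by rewrite mulr_ge0 ?speed_ge0 // ltW.
rewrite -(ler_pXn2r (n := 2)) ?nnegrE // real_normK ?num_real //.
apply: le_trans CS _; rewrite exprMn mulrC.
by rewrite ler_wpM2r ?sqr_ge0 //; exact: KP.
Qed.

End BumpChart.

(** [kappa] is the minimum of [f] over a compact coordinate cube around [b] that contains every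
    point where the bump is positive; [K] bounds the dual norm of the differential of the bump. *)
Lemma bump_function (R : realType) (n : nat) (M : riem_data R n) (f : M -> R) (b : M) :
  riemannian_manifold M -> smooth f -> (forall p, 0 < f p) ->
  exists (u : M -> R) (K kappa : R),
  [/\ 0 < K, 0 < kappa, 0 < u b, (forall p, 0 < u p -> kappa <= f p) &
      forall (i : atlas_index M) (c : R -> 'rV[R]_n) (t : R), c1_curve i c -> t \in `[0, 1] ->
        `|u (chart_inv (atlas i) (c t)) - u (chart_inv (atlas i) (c 0))|
          <= K * curve_length i c].
Proof.
move=> MR sf f0; have [[_ _ _ cover _] _] := MR.
have [j jb] := cover b; have cj := atlas_chart MR j.
pose x0 := chart_map (atlas j) b; have jx0 : in_chart j x0 := chart_map_in cj jb.
have /nbhs_ballP[e /= e0 eD] : nbhs x0 (in_chart j).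
  by apply: open_nbhs_nbhs; split => //; exact: in_chart_open.
pose r := e / 2; have r0 : 0 < r by rewrite divr_gt0.
pose box : set 'rV[R]_n := [set v | forall a, v ord0 a \in `[x0 0 a - r, x0 0 a + r]].
have box_in : box `<=` in_chart j.
  move=> y yb; apply: eD; rewrite -ball_normE /=.
  apply: le_lt_trans (_ : r < e); last by rewrite /r; lra.
  apply: rV_norm_le => [|a]; first exact: ltW.
  have := yb a; rewrite in_itv /= !mxE => /andP[h1 h2].
  by rewrite ler_norml; apply/andP; split; lra.
have x0b : box x0.
  by move=> a; rewrite in_itv /= gerBl lerDl (ltW r0).
have [K K0 KP] := omega_bound MR r0 box_in.
have cbox : compact box by exact: box_compact.
have cf y : in_chart j y -> {for y, continuous (local j f)}.
  by move=> jy; exact: (sf j [::] y jy).1.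
have [|c cb cmin] := @EVT_min_rV R n (local j f) box (ex_intro _ x0 x0b) cbox.
  apply: continuous_in_subspaceT => y; rewrite inE => yb.
  exact: (cf _ (box_in _ yb)).
exists (bump j x0 r), K, (local j f c); split=> //.
- exact: f0.
- rewrite /bump asboolT // -/x0 /bump_quad big1; last by move=> a _; rewrite subrr expr0n.
  by rewrite subr0 pospart_ge0 ?exprn_gt0 // ltW // exprn_gt0.
- move=> p; rewrite /bump; case: asboolP => [jp|_]; last by rewrite ltxx.
  have [q0|q0] := leP (bump_quad x0 r (chart_map (atlas j) p)) 0.
    by rewrite pospart_le0 // expr0n ltxx.
  move=> _; have yb := bump_quad_box r0 q0.
  have := cmin (chart_map (atlas j) p); rewrite inE => /(_ yb).
  by rewrite [X in _ <= X -> _]/local /= (chart_mapK cj jp).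
- move=> i g t ig t01; rewrite curve_lengthE.
  have cs := speed_continuous MR ig.
  rewrite -RintegralZl //; last exact: integrable01.
  (* The value 0 outside the unit interval is a dummy; it makes [choice] yield a total function. *)
  have dvP (s : R) : exists dv : R, s \in `[0, 1] ->
      is_derive s 1 (fun s => bump j x0 r (chart_inv (atlas i) (g s))) dv /\
      `|dv| <= K * speed i g s.
    have [s01|ns] := boolP (s \in `[0, 1]); last by exists 0.
    have [dv d1 d2] := bump_derivative MR r0 box_in K0 KP ig s01.
    by exists dv.
  have [dv dvE] := choice dvP.
  apply: (@increment_le_integral R (fun s => K * speed i g s)
    (fun s => bump j x0 r (chart_inv (atlas i) (g s))) dv _ dvE t t01).
  move=> s s01; apply: continuousM; [exact: cvg_cst | exact: cs].
Qed.

(** * Components of curves in a product of coordinate spaces *)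

Section CurvesInProducts.
Context {R : realType} {n m : nat}.
Implicit Types (c : R -> 'rV[R]_(n + m)) (d : R -> 'rV[R]_n) (e : R -> 'rV[R]_m).

Lemma derive1_entry (k : nat) (c : R -> 'rV[R]_k) t b : derivable c t 1 ->
  derive1 c t 0 b = derive1 (fun s => c s 0 b) t.
Proof. by move=> dc; rewrite !derive1E derive_mx // mxE. Qed.

Lemma derivable_lsubmx c t : derivable c t 1 -> derivable (lsubmx \o c) t 1.
Proof.
move=> /derivable_mxP dc; apply/derivable_mxP => a b.
have -> : (fun s => (lsubmx \o c) s a b) = (fun s => c s a (lshift m b)).
  by apply/funext => s; rewrite /= mxE.
exact: dc.
Qed.

Lemma derivable_rsubmx c t : derivable c t 1 -> derivable (rsubmx \o c) t 1.
Proof.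
move=> /derivable_mxP dc; apply/derivable_mxP => a b.
have -> : (fun s => (rsubmx \o c) s a b) = (fun s => c s a (rshift n b)).
  by apply/funext => s; rewrite /= mxE.
exact: dc.
Qed.

Lemma derive1_lsubmx c t : derivable c t 1 ->
  derive1 (lsubmx \o c) t = lsubmx (derive1 c t).
Proof.
move=> dc; apply/rowP => b; rewrite derive1_entry; last exact: derivable_lsubmx.
rewrite mxE derive1_entry //; congr (derive1 _ t).
by apply/funext => s; rewrite /= mxE.
Qed.

Lemma derive1_rsubmx c t : derivable c t 1 ->
  derive1 (rsubmx \o c) t = rsubmx (derive1 c t).
Proof.
move=> dc; apply/rowP => b; rewrite derive1_entry; last exact: derivable_rsubmx.
rewrite mxE derive1_entry //; congr (derive1 _ t).
by apply/funext => s; rewrite /= mxE.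
Qed.

Lemma derivable_row_mx d e t : derivable d t 1 -> derivable e t 1 ->
  derivable (fun s => row_mx (d s) (e s)) t 1.
Proof.
move=> /derivable_mxP dd /derivable_mxP de; apply/derivable_mxP => a b.
case: (split_ordP b) => {}b ->.
  by under eq_fun do rewrite row_mxEl; exact: dd.
by under eq_fun do rewrite row_mxEr; exact: de.
Qed.

Lemma derive1_row_mx d e t : derivable d t 1 -> derivable e t 1 ->
  derive1 (fun s => row_mx (d s) (e s)) t = row_mx (derive1 d t) (derive1 e t).
Proof.
move=> dd de; have dr := derivable_row_mx dd de.
have -> : derive1 (fun s => row_mx (d s) (e s)) t =
    row_mx (lsubmx (derive1 (fun s => row_mx (d s) (e s)) t))
           (rsubmx (derive1 (fun s => row_mx (d s) (e s)) t)) by rewrite hsubmxK.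
rewrite -(derive1_lsubmx dr) -(derive1_rsubmx dr); congr (row_mx (derive1 _ t) (derive1 _ t)).
  by apply/funext => s; rewrite /= row_mxKl.
by apply/funext => s; rewrite /= row_mxKr.
Qed.

Lemma continuous_row_mx (T : topologicalType) (u : T -> 'rV[R]_n) (v : T -> 'rV[R]_m) :
  continuous u -> continuous v -> continuous (fun s => row_mx (u s) (v s)).
Proof.
move=> cu cv t; apply: (@cvg_rV _ _ _ (nbhs t)) => b.
case: (split_ordP b) => {}b ->.
  rewrite row_mxEl; under eq_fun do rewrite row_mxEl.
  exact: (@continuous_comp _ _ _ _ _ t (cu t) (@coord_continuous R 1 n 0 b _)).
rewrite row_mxEr; under eq_fun do rewrite row_mxEr.
exact: (@continuous_comp _ _ _ _ _ t (cv t) (@coord_continuous R 1 m 0 b _)).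
Qed.

End CurvesInProducts.

(** * Projected and lifted curves, and completeness of the warped product *)

Section WarpedCurves.
Context {R : realType} {n m : nat}.
Variables (B : riem_data R n) (F : riem_data R m) (f : B -> R).
Hypotheses (BR : riemannian_manifold B) (FR : riemannian_manifold F).
Hypotheses (f_smooth : smooth f) (f_gt0 : forall p, 0 < f p).

Local Notation W := (warped_product F f).
Local Notation mu := (@lebesgue_measure R).

Let WR : riemannian_manifold W := warped_riemannian BR FR f_smooth f_gt0.

Lemma c1_curve_lsubmx (i : atlas_index W) c : c1_curve i c ->
  c1_curve i.1 (lsubmx \o c).
Proof.
move=> [dc cc cin]; split.
- by move=> t; exact: derivable_lsubmx.
- have -> : derive1 (lsubmx \o c) = lsubmx \o derive1 c.
    by apply/funext => t; exact: derive1_lsubmx.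
  by move=> t; apply: continuous_comp; [exact: cc | exact: lsubmx_continuous].
- by move=> t /cin[].
Qed.

Lemma c1_curve_rsubmx (i : atlas_index W) c : c1_curve i c ->
  c1_curve i.2 (rsubmx \o c).
Proof.
move=> [dc cc cin]; split.
- by move=> t; exact: derivable_rsubmx.
- have -> : derive1 (rsubmx \o c) = rsubmx \o derive1 c.
    by apply/funext => t; exact: derive1_rsubmx.
  by move=> t; apply: continuous_comp; [exact: cc | exact: rsubmx_continuous].
- by move=> t /cin[].
Qed.

Lemma c1_curve_row_mx (i : atlas_index W) d e : c1_curve i.1 d -> c1_curve i.2 e ->
  c1_curve i (fun s => row_mx (d s) (e s)).
Proof.
move=> [dd cd din] [de ce ein]; split.
- by move=> t; exact: derivable_row_mx.
- have -> : derive1 (fun s => row_mx (d s) (e s)) =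
      fun s => row_mx (derive1 d s) (derive1 e s).
    by apply/funext => t; exact: derive1_row_mx.
  exact: continuous_row_mx.
- by move=> t t01; split; rewrite /= ?row_mxKl ?row_mxKr; [exact: din|exact: ein].
Qed.

Lemma warped_quad (i : atlas_index W) (x v : 'rV[R]_(n + m)) :
  (v *m metric_mx i x *m v^T) 0 0 =
  (lsubmx v *m metric_mx i.1 (lsubmx x) *m (lsubmx v)^T) 0 0 +
  local i.1 f (lsubmx x) ^+ 2 *
    (rsubmx v *m metric_mx i.2 (rsubmx x) *m (rsubmx v)^T) 0 0.
Proof.
rewrite /= -[v in LHS]hsubmxK tr_row_mx mul_row_block mul_row_col !mulmx0 addr0 add0r.
by rewrite -scalemxAr -scalemxAl addmxE scalemxE.
Qed.

Lemma speed_lsubmx_le (i : atlas_index W) c t : c1_curve i c -> t \in `[0, 1] ->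
  speed i.1 (lsubmx \o c) t <= speed i c t.
Proof.
move=> ic t01; have [dc _ cin] := ic; have [ix jx] := cin t t01.
apply: ler_wsqrtr; rewrite derive1_lsubmx // warped_quad lerDl.
by rewrite mulr_ge0 ?sqr_ge0 //; exact: (quad_ge0 FR).
Qed.

Lemma speed_rsubmx_le (i : atlas_index W) c t : c1_curve i c -> t \in `[0, 1] ->
  local i.1 f (lsubmx (c t)) * speed i.2 (rsubmx \o c) t <= speed i c t.
Proof.
move=> ic t01; have [dc _ cin] := ic; have [ix jx] := cin t t01.
have f0 : 0 <= local i.1 f (lsubmx (c t)) by exact/ltW/f_gt0.
rewrite -{1}(ger0_norm f0) -sqrtr_sqr -sqrtrM ?sqr_ge0 //.
apply: ler_wsqrtr; rewrite derive1_rsubmx // warped_quad lerDr.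
exact: (quad_ge0 BR).
Qed.

Lemma le_curve_length (k l : nat) (M : riem_data R k) (N : riem_data R l)
    (i : atlas_index M) (j : atlas_index N) c d K :
  riemannian_manifold M -> riemannian_manifold N -> c1_curve i c -> c1_curve j d ->
  (forall t : R, t \in `[0, 1] -> K * speed i c t <= speed j d t) ->
  K * curve_length i c <= curve_length j d.
Proof.
move=> MR NR ic jd le; have cc := speed_continuous MR ic; have cd := speed_continuous NR jd.
rewrite !curve_lengthE -RintegralZl //; last exact: integrable01.
apply: le_Rintegral => //; last exact: integrable01 cd.
apply: (@integrable01 _ (fun t => K * speed i c t)) => t t01.
by apply: continuousM; [exact: cst_continuous | exact: cc].
Qed.

Lemma pw_curve_fst (p q : W) L : pw_curve p q L ->
  exists2 L', pw_curve (M := B) p.1 q.1 L' & L' <= L.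
Proof.
elim=> [z|i c z L0 ic _ [L1 pL1 L1L]]; first by exists 0 => //; exact: pw_nil.
exists (curve_length i.1 (lsubmx \o c) + L1).
  exact: (pw_cons (c1_curve_lsubmx ic)).
rewrite lerD // -[X in X <= _]mul1r.
apply: (le_curve_length BR WR (c1_curve_lsubmx ic) ic) => t t01.
by rewrite mul1r; exact: speed_lsubmx_le.
Qed.

Section Bump.
Variables (u : B -> R) (K kappa : R).
Hypotheses (K_gt0 : 0 < K) (kappa_gt0 : 0 < kappa).
Hypothesis u_f : forall p, 0 < u p -> kappa <= f p.
Hypothesis u_lip : forall (i : atlas_index B) c t, c1_curve i c -> t \in `[0, 1] ->
  `|u (chart_inv (atlas i) (c t)) - u (chart_inv (atlas i) (c 0))|
     <= K * curve_length i c.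

Lemma bump_lipschitz (p q : B) L : pw_curve p q L -> `|u q - u p| <= K * L.
Proof.
elim=> [z|i c z L0 ic _ IH]; first by rewrite subrr normr0 mulr0.
have in1 : (1 : R) \in `[0, 1] by rewrite in_itv /= lexx ler01.
have H := u_lip ic in1.
rewrite mulrDr (le_trans (ler_distD (u (chart_inv (atlas i) (c 1))) _ _)) //.
by rewrite [leRHS]addrC lerD.
Qed.

(* A curve starting where the bump is large and not too long stays where f is bounded
   below, so it cannot be much shorter than its projection to the fibre. *)
Lemma pw_curve_snd (p q : W) L : pw_curve p q L -> K * L < u p.1 ->
  exists2 L', pw_curve (M := F) p.2 q.2 L' & kappa * L' <= L.
Proof.
elim=> [z _|i c z L0 ic pL0 IH]; first by exists 0; [exact: pw_nil | rewrite mulr0].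
have L0_ge0 := pw_curve_ge0 pL0.
rewrite mulrDr => KL.
have icl := c1_curve_lsubmx ic.
have in1 : (1 : R) \in `[0, 1] by rewrite in_itv /= lexx ler01.
have len : K * curve_length i.1 (lsubmx \o c) <= K * curve_length i c.
  rewrite (ler_wpM2l (ltW K_gt0)) // -[X in X <= _]mul1r.
  apply: (le_curve_length BR WR icl ic) => t t01.
  by rewrite mul1r; exact: speed_lsubmx_le.
(* The first piece lowers [u] by at most K times its length, which leaves more than K L0 at each of
   its points. Hence [u] is positive along the piece, and at its end the induction hypothesis
   applies to the rest. *)
have ut (t : R) : t \in `[0, 1] -> K * L0 < u (chart_inv (atlas i.1) (lsubmx (c t))).
  move=> t01; have := u_lip icl t01; rewrite ler_norml => /andP[H _].
  by move: KL H len => /=; set a := u _; set b := u _; lra.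
have [L1 pL1 kL1] := IH (ut 1 in1).
exists (curve_length i.2 (rsubmx \o c) + L1).
  exact: (pw_cons (c1_curve_rsubmx ic)).
rewrite mulrDr lerD //.
apply: (le_curve_length FR WR (c1_curve_rsubmx ic) ic) => t t01.
apply: le_trans (speed_rsubmx_le ic t01); rewrite ler_wpM2r ?speed_ge0 //.
by apply: u_f; apply: le_lt_trans (ut t t01); rewrite mulr_ge0 // ltW.
Qed.

End Bump.

Lemma pw_curve_horizontal (p q : B) (z : F) L : pw_curve p q L ->
  pw_curve (M := W) (p, z) (q, z) L.
Proof.
have [[_ _ _ cover _] _] := FR; have [j jz] := cover z.
have zE := chart_mapK (atlas_chart FR j) jz.
elim=> [y|i c y L0 ic _ IH]; first exact: pw_nil.
pose d (_ : R) := chart_map (atlas j) z.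
have jd : c1_curve j d.
  split=> [t||t _]; first exact: derivable_cst.
    have -> : derive1 d = cst 0 by apply/funext => t; exact: derive1_cst.
    by move=> t; exact: cst_continuous.
  exact: (chart_map_in (atlas_chart FR j) jz).
have icd : c1_curve ((i, j) : atlas_index W) (fun s => row_mx (c s) (d s)).
  exact: c1_curve_row_mx.
have lE : curve_length ((i, j) : atlas_index W) (fun s => row_mx (c s) (d s))
    = curve_length i c.
  have [dc _ _] := ic; have [dd _ _] := jd.
  rewrite !curve_lengthE; congr (Rintegral _ _ _); apply/funext => t.
  rewrite /speed warped_quad derive1_row_mx // !row_mxKl !row_mxKr.
  have -> : derive1 d t = 0 by exact: derive1_cst.
  by rewrite !mul0mx [X in _ + _ * X]mxE mulr0 addr0.
rewrite -lE.
have E t : chart_inv (atlas ((i, j) : atlas_index W)) (row_mx (c t) (d t)) =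
    (chart_inv (atlas i) (c t), z).
  by rewrite /= row_mxKl row_mxKr zE.
have := @pw_cons R (n + m) W (i, j) _ ((y, z) : W) L0 icd; rewrite !E; apply; exact: IH.
Qed.

Lemma pw_curve_vertical (b : B) (p q : F) L : pw_curve p q L ->
  pw_curve (M := W) (b, p) (b, q) (f b * L).
Proof.
have [[_ _ _ cover _] _] := BR; have [i ib] := cover b.
have bE := chart_mapK (atlas_chart BR i) ib.
elim=> [y|j c y L0 jc _ IH]; first by rewrite mulr0; exact: pw_nil.
pose d (_ : R) := chart_map (atlas i) b.
have jd : c1_curve i d.
  split=> [t||t _]; first exact: derivable_cst.
    have -> : derive1 d = cst 0 by apply/funext => t; exact: derive1_cst.
    by move=> t; exact: cst_continuous.
  exact: (chart_map_in (atlas_chart BR i) ib).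
have icd : c1_curve ((i, j) : atlas_index W) (fun s => row_mx (d s) (c s)).
  exact: c1_curve_row_mx.
have lE : curve_length ((i, j) : atlas_index W) (fun s => row_mx (d s) (c s))
    = f b * curve_length j c.
  have [dc _ _] := jc; have [dd _ _] := jd.
  rewrite !curve_lengthE -RintegralZl //; last exact/integrable01/(speed_continuous FR jc).
  congr (Rintegral _ _ _); apply/funext => t.
  rewrite /speed warped_quad derive1_row_mx // !row_mxKl !row_mxKr.
  have -> : derive1 d t = 0 by exact: derive1_cst.
  rewrite !mul0mx [X in X + _]mxE add0r sqrtrM ?sqr_ge0 // sqrtr_sqr.
  by rewrite /local /= /d bE ger0_norm // ltW.
rewrite mulrDr -lE.
have E t : chart_inv (atlas ((i, j) : atlas_index W)) (row_mx (d t) (c t)) =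
    (b, chart_inv (atlas j) (c t)).
  by rewrite /= row_mxKl row_mxKr bE.
have := @pw_cons R (n + m) W (i, j) _ ((b, y) : W) (f b * L0) icd; rewrite !E; apply; exact: IH.
Qed.

Lemma warped_complete : complete_manifold B -> complete_manifold F ->
  complete_manifold W.
Proof.
move=> BC FC s cauchy.
have [b /riem_dist_cvg0 sb] : exists b : B,
    (fun k => riem_dist (s k).1 b) @ \oo --> 0%:E.
  apply: BC => e e0; have [N NP] := cauchy e e0; exists N => j k Nj Nk.
  have [L pL Le] := riem_dist_lt (NP j k Nj Nk).
  have [L' pL' L'L] := pw_curve_fst pL.
  apply: le_lt_trans (riem_dist_le pL') _.
  by rewrite lte_fin; exact: le_lt_trans L'L Le.
have [u [K [kappa [K0 k0 ub uf ulip]]]] := bump_function b BR f_smooth f_gt0.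
(* A curve shorter than this changes [u] by less than u b / 2, so from [N1] on the base points keep
   more than half of the value at [b]. *)
have u0 : 0 < u b / 2 / K by rewrite !divr_gt0.
have [N1 N1P] := sb _ u0.
have us k : (N1 <= k)%N -> u b / 2 < u (s k).1.
  move=> /N1P[L pL]; rewrite ltr_pdivlMr // => LK.
  have := bump_lipschitz ulip pL; rewrite ler_norml => /andP[_].
  by rewrite mulrC; lra.
have [y /riem_dist_cvg0 sy] : exists y : F,
    (fun k => riem_dist (s k).2 y) @ \oo --> 0%:E.
  (* The second bound gives K L < u b / 2 < u (s j).1, as [pw_curve_snd] requires; the first turns
     its conclusion kappa L' <= L into L' < e. *)
  apply: FC => e e0; pose e' := Num.min (kappa * e) (u b / 2 / K).
  have e'0 : 0 < e' by rewrite lt_min u0 mulr_gt0.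
  have [N2 N2P] := cauchy _ e'0; exists (maxn N1 N2) => j k.
  rewrite !geq_max => /andP[N1j N2j] /andP[_ N2k].
  have [L pL] := riem_dist_lt (N2P j k N2j N2k).
  rewrite lt_min ltr_pdivlMr // => /andP[Le Lu].
  have KL : K * L < u (s j).1 by rewrite mulrC (lt_trans Lu) // us.
  have [L' pL' L'L] := pw_curve_snd K0 uf ulip pL KL.
  apply: le_lt_trans (riem_dist_le pL') _.
  by rewrite lte_fin -(ltr_pM2l k0); exact: le_lt_trans L'L Le.
exists (b, y); apply/riem_dist_cvg0 => e e0.
have e2 : 0 < e / 2 by rewrite divr_gt0.
(* The vertical curve over [b] is stretched by [f b], so its half of [e] is divided by [f b] in
   advance. *)
have [N2 N2P] := sb _ e2; have [N3 N3P] := sy _ (divr_gt0 e2 (f_gt0 b)).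
exists (maxn N2 N3) => k; rewrite geq_max => /andP[/N2P[L pL Le] /N3P[L' pL' Le']].
exists (L + f b * L').
  have := pw_curve_cat (pw_curve_horizontal (s k).2 pL) (pw_curve_vertical b pL').
  by rewrite -surjective_pairing.
by move: Le'; rewrite ltr_pdivlMr // mulrC; lra.
Qed.

End WarpedCurves.

Local Close Scope classical_set_scope.
Unset Implicit Arguments.

Theorem theorem1 (R : realType) (n m : nat) (hm : (1 < m)%N)
    (B : riem_data R n) (f lambda phi : B -> R)
    (B_riemannian : riemannian_manifold B)
    (B_complete : complete_manifold B)
    (f_smooth : smooth f) (lambda_smooth : smooth lambda)
    (phi_smooth : smooth phi)
    (f_gt0 : forall p : B, 0 < f p)
    (base_eq : base_equation m f lambda phi)
    (base_deq : base_differential_equation m f lambda phi) :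
  (exists mu : R, is_warping_constant m f lambda phi mu) /\
  (forall mu : R, is_warping_constant m f lambda phi mu ->
   forall F : riem_data R m,
     riemannian_manifold F -> complete_manifold F -> einstein_with F mu ->
     gradient_ricci_almost_soliton (M := warped_product F f)
       (base_lift phi) (base_lift lambda)).
Proof.
split=> [|mu muP F FR FC Fein].
  exact: (exists_warping_constant (ltnW hm) B_riemannian).
split.
- exact: warped_riemannian.
- exact: warped_complete.
- exact: (base_lift_smooth (f := f) B_riemannian FR phi_smooth).
- exact: (base_lift_smooth (f := f) B_riemannian FR lambda_smooth).
- exact: (warped_soliton_equation B_riemannian FR f_smooth lambda_smooth phi_smooth
    f_gt0 base_eq muP Fein).
Qed.
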